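(* Let $\Omega$ be the bidisc, or the symmetrized bidisc, or an annulus, and let $\Psi$ be the associated collection of holomorphic test functions on $\Omega$ given in the context. Let $\mathscr{U},\mathscr{Y}$ be Hilbert spaces; when $\Omega$ is the annulus, take $\mathscr{U}=\mathscr{Y}=\mathbb{C}$. Let $z_1,\dots,z_n\in\Omega$ and $B_1,\dots,B_n\in B(\mathscr{U},\mathscr{Y})$. Suppose that $f\in H_1^\infty(\Omega,B(\mathscr{U},\mathscr{Y}))$ satisfies $f(z_i)=B_i$ for $1\le i\le n$, and that $f$ is affiliated with a completely positive kernel $\Gamma:\{z_1,\dots,z_n\}\times\{z_1,\dots,z_n\}\to B(\mathcal{C}_b(\Psi),B(\mathscr{Y}))$ satisfying $I_{\mathscr{Y}}-B_iB_j^*=\Gamma(z_i,z_j)(1-E(z_i)E(z_j)^* )$ for all $i,j$. Let $\mathscr{M}_1,\mathscr{M}_2$ and $G:\Omega\to B(\mathscr{M}_2\oplus\mathscr{U},\mathscr{M}_1\oplus\mathscr{Y})$ be the Hilbert spaces and the function constructed from the data $(z_i,B_i)_{i=1}^n$ and $\Gamma$ as described in the context, and write $$G(z)=\begin{pmatrix}G_{11}(z)&G_{12}(z)\\ G_{21}(z)&G_{22}(z)\end{pmatrix}:\mathscr{M}_2\oplus\mathscr{U}\to\mathscr{M}_1\oplus\mathscr{Y}.$$ Then there exists $\mathbf{t}\in H_1^\infty(\Omega,B(\mathscr{M}_1,\mathscr{M}_2))$ such that $$f(z)=G_{22}(z)+G_{21}(z)\bigl(I_{\mathscr{M}_2}-\mathbf{t}(z)G_{11}(z)\bigr)^{-1}\mathbf{t}(z)G_{12}(z)\quad\text{for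 all } z\in\Omega,$$ where the inverses exist in $B(\mathscr{M}_2)$.
   Context: Schur class. $H_1^\infty(\Omega,B(\mathscr{U},\mathscr{Y}))$ is the closed unit ball, in the supremum norm, of the space of bounded holomorphic $B(\mathscr{U},\mathscr{Y})$-valued functions on the domain $\Omega$. Domains and test functions. (i) Bidisc: $\Omega=\mathbb{D}^2$, $\Psi=\{z_1,z_2\}$ (the two coordinate functions). (ii) Symmetrized bidisc: $\Omega=\{(\zeta_1+\zeta_2,\zeta_1\zeta_2):\zeta_1,\zeta_2\in\mathbb{D}\}\subset\mathbb{C}^2$, $\Psi=\{\varphi_\alpha:\alpha\in\overline{\mathbb{D}}\}$ with $\varphi_\alpha(s,p)=\dfrac{2\alpha p-s}{2-\alpha s}$. (iii) Annulus: $\Omega=\{z\in\mathbb{C}:q<|z|<1\}$ for a fixed $0<q<1$, and $\Psi$ is the collection of all functions $\psi$ analytic in a neighbourhood of $\overline{\Omega}$ with $|\psi|=1$ on $\partial\Omega$, with exactly two zeros in $\Omega$ counted with multiplicity, and with $\psi(\sqrt q)=0$ and $\psi(1)=1$. $\Psi$ carries the subspace topology from $\overline{\mathbb{D}}^{\,\Omega}$ with the product topology; $\mathcal{C}_b(\Psi)$ is the $C^*$-algebra of bounded continuous functions on $\Psi$ with the supremum norm; and for $x\in\Omega$, $E(x)\in\mathcal{C}_b(\Psi)$ is $E(x)(\psi)=\psi(x)$. One has $\|E(x)\|<1$ for each $x\in\Omega$. Completely positive kernels. For a set $\Lambda$ and $C^*$-algebras $\mathscr{A},\mathscr{B}$,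 a function $\Gamma:\Lambda\times\Lambda\to B(\mathscr{A},\mathscr{B})$ (bounded linear maps) is a completely positive kernel if $\sum_{i,j=1}^n b_i^*\,\Gamma(x_i,x_j)(a_i^*a_j)\,b_j\ge0$ for all $n\ge1$, $a_i\in\mathscr{A}$, $b_i\in\mathscr{B}$, $x_i\in\Lambda$. Every completely positive kernel $\Gamma:\Lambda\times\Lambda\to B(\mathcal{C}_b(\Psi),B(\mathscr{Y}))$ has a Kolmogorov decomposition: a Hilbert space $\mathscr{X}_1$, a unital $*$-representation $\mu:\mathcal{C}_b(\Psi)\to B(\mathscr{X}_1)$ and $h:\Lambda\to B(\mathscr{X}_1,\mathscr{Y})$ with $\Gamma(x,y)(\delta)=h(x)\mu(\delta)h(y)^*$. Affiliation. Let $\Gamma$ be a completely positive kernel on $\{z_1,\dots,z_n\}$ with $I_{\mathscr{Y}}-B_iB_j^*=\Gamma(z_i,z_j)(1-E(z_i)E(z_j)^* )$ for all $i,j$. A solution $f$ of the interpolation problem $z_i\mapsto B_i$ is affiliated with $\Gamma$ if there is a completely positive kernel $\Delta:\Omega\times\Omega\to B(\mathcal{C}_b(\Psi),B(\mathscr{Y}))$ with $I_{\mathscr{Y}}-f(z)f(w)^*=\Delta(z,w)(1-E(z)E(w)^* )$ for all $z,w\in\Omega$ and $\Delta(z_i,z_j)=\Gamma(z_i,z_j)$ for all $i,j=1,\dots,n$. Construction of $\mathscr{M}_1,\mathscr{M}_2,G$. Fix a Kolmogorov decomposition $(\mathscr{X}_1,\mu,h)$ of $\Gamma$ on $\{z_1,\dots,z_n\}$.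 Let $\mathscr{L}_1=\overline{\mathrm{span}}\{\mu(\delta)h(z_i)^*y:1\le i\le n,\ \delta\in\mathcal{C}_b(\Psi),\ y\in\mathscr{Y}\}$, which reduces $\mu$; operators $\mu(\delta)$ below are restricted to $\mathscr{L}_1$. Let $$\mathscr{N}_2=\overline{\mathrm{span}}\{\mu(E(z_i))^*h(z_i)^*y\oplus y:\ y\in\mathscr{Y},1\le i\le n\}\subset\mathscr{L}_1\oplus\mathscr{Y},$$ $$\mathscr{N}_1=\overline{\mathrm{span}}\{h(z_i)^*y\oplus B_i^*y:\ y\in\mathscr{Y},1\le i\le n\}\subset\mathscr{L}_1\oplus\mathscr{U}.$$ There is a unitary $V:\mathscr{N}_2\to\mathscr{N}_1$ sending $\mu(E(z_i))^*h(z_i)^*y\oplus y$ to $h(z_i)^*y\oplus B_i^*y$ for all $i$ and $y$. Put $\mathscr{M}_1=(\mathscr{L}_1\oplus\mathscr{U})\ominus\mathscr{N}_1$ and $\mathscr{M}_2=(\mathscr{L}_1\oplus\mathscr{Y})\ominus\mathscr{N}_2$. Let $\mathcal{Q}:\mathscr{N}_2\oplus\mathscr{M}_2\oplus\mathscr{M}_1\to\mathscr{N}_1\oplus\mathscr{M}_1\oplus\mathscr{M}_2$ be the unitary $n_2\oplus m_2\oplus m_1\mapsto Vn_2\oplus m_1\oplus m_2$. Identifying $\mathscr{N}_2\oplus\mathscr{M}_2\oplus\mathscr{M}_1$ with $\mathscr{L}_1\oplus(\mathscr{M}_1\oplus\mathscr{Y})$ and $\mathscr{N}_1\oplus\mathscr{M}_1\oplus\mathscr{M}_2$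 with $\mathscr{L}_1\oplus(\mathscr{M}_2\oplus\mathscr{U})$, write $$\mathcal{Q}=\begin{pmatrix}\mathcal{Q}_{11}&\mathcal{Q}_{12}\\ \mathcal{Q}_{21}&\mathcal{Q}_{22}\end{pmatrix}:\mathscr{L}_1\oplus(\mathscr{M}_1\oplus\mathscr{Y})\to\mathscr{L}_1\oplus(\mathscr{M}_2\oplus\mathscr{U}),$$ and define, for $z\in\Omega$, $$G(z)=\mathcal{Q}_{22}^*+\mathcal{Q}_{12}^*\bigl(I_{\mathscr{L}_1}-\mu(E(z))\mathcal{Q}_{11}^*\bigr)^{-1}\mu(E(z))\mathcal{Q}_{21}^*\in B(\mathscr{M}_2\oplus\mathscr{U},\mathscr{M}_1\oplus\mathscr{Y}).$$ *)

(* Defs.v *)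
From HB Require Import structures.
From mathcomp Require Import all_boot all_order all_algebra.
From mathcomp Require Import all_classical all_reals all_analysis.
From mathcomp.real_closed Require Import complex.
From mathcomp Require Import ring lra.

Set Implicit Arguments.
Unset Strict Implicit.
Unset Printing Implicit Defensive.

Import Order.TTheory GRing.Theory Num.Theory.
Import numFieldNormedType.Exports.

Local Open Scope classical_set_scope.
Local Open Scope ring_scope.

(* The scalars are R[i]; norms of normedModType R[i] are R[i]-valued, and in the
   order of R[i] the relation 0 <= c means that c is a nonnegative real. *)
HB.instance Definition _ (R : realType) := NormedModule.copy R[i] R[i]^o.

(* Inner products are linear in the first and conjugate-linear in the second
   argument. *)
HB.mixin Record isInner (R : realType) H & NormedModule R[i] H := {
  inner : H -> H -> R[i];
  innerDl : forall x y z, inner (x + y) z = inner x z + inner y z;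
  innerZl : forall a x z, inner (a *: x) z = a * inner x z;
  innerC : forall x y, inner y x = (inner x y)^*;
  inner_norm : forall x : H, inner x x = `|x| ^+ 2
}.

HB.structure Definition PreHilbert (R : realType) :=
  {H of NormedModule R[i] H & isInner R H}.

#[short(type="hilbertType")]
HB.structure Definition Hilbert (R : realType) :=
  {H of PreHilbert R H & Complete H}.

HB.factory Record Lmodule_isPreHilbert (R : realType) H
    & GRing.Lmodule R[i] H := {
  inner : H -> H -> R[i];
  innerDl : forall x y z, inner (x + y) z = inner x z + inner y z;
  innerZl : forall a x z, inner (a *: x) z = a * inner x z;
  innerC : forall x y, inner y x = (inner x y)^*;
  inner_gt0 : forall x, x != 0 -> 0 < inner x x
}.

HB.builders Context R H & Lmodule_isPreHilbert R H.

Let norm (x : H) : R[i] := sqrtC (inner x x).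

Let inner0l x : inner 0 x = 0.
Proof. by rewrite -[0 in LHS](scale0r 0) innerZl mul0r. Qed.

Let innerDr x y z : inner x (y + z) = inner x y + inner x z.
Proof. by rewrite innerC innerDl rmorphD/= -!innerC. Qed.

Let innerZr a x y : inner x (a *: y) = a^* * inner x y.
Proof. by rewrite innerC innerZl rmorphM/= -innerC. Qed.

Let inner_ge0 x : 0 <= inner x x.
Proof.
by have [->|/inner_gt0/ltW//] := eqVneq x 0; rewrite inner0l.
Qed.

Let norm2 x : norm x ^+ 2 = inner x x.
Proof. exact: sqrtCK. Qed.

Let norm_ge0 x : 0 <= norm x.
Proof. by rewrite sqrtC_ge0. Qed.

Let cauchy_schwarz x y : `|inner x y| <= norm x * norm y.
Proof.
have [->|y0] := eqVneq y 0.
  by rewrite innerC inner0l rmorph0 normr0 mulr_ge0.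
have iy0 := inner_gt0 y0.
rewrite -(@ler_pXn2r _ 2) ?nnegrE ?mulr_ge0// exprMn !norm2.
have := inner_ge0 (inner y y *: x - inner x y *: y).
rewrite -scaleNr !(innerDl, innerDr, innerZl, innerZr) [inner y x]innerC.
rewrite rmorphN/= [(inner y y)^*](geC0_conj (ltW iy0)).
set a := inner x x; set b := inner y y; set c := inner x y.
rewrite normCK.
rewrite [X in 0 <= X -> _](_ : _ = b * (a * b - c * c^*)); last by ring.
by rewrite pmulr_rge0// subr_ge0.
Qed.

Let ler_normD x y : norm (x + y) <= norm x + norm y.
Proof.
rewrite -(@ler_pXn2r _ 2) ?nnegrE ?addr_ge0// norm2 sqrrD !norm2.
rewrite innerDl !innerDr [inner y x]innerC.
have h : inner x y + (inner x y)^* <= norm x * norm y *+ 2.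
  apply: (le_trans (real_ler_norm _)).
    by rewrite CrealE rmorphD/= conjCK addrC.
  apply: (le_trans (Num.Theory.ler_normD _ _)).
  by rewrite norm_conjC -mulr2n lerMn2r/= cauchy_schwarz.
by rewrite addrA -(addrA (inner x x)) lerD2r lerD2l.
Qed.

Let normrZ (a : R[i]) x : norm (a *: x) = `|a| * norm x.
Proof.
by rewrite /norm innerZl innerZr mulrA -normCK sqrtCM ?nnegrE ?exprn_ge0// sqrCK.
Qed.

Let normr0_eq0 x : norm x = 0 -> x = 0.
Proof.
move=> /eqP; rewrite sqrtC_eq0 => /eqP x0; apply/eqP/negPn/negP => /inner_gt0.
by rewrite x0 ltxx.
Qed.

HB.instance Definition _ :=
  Lmodule_isNormed.Build R[i] H ler_normD normrZ normr0_eq0.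

Let inner_norm (x : H) : inner x x = `|x| ^+ 2.
Proof. by rewrite -norm2. Qed.

HB.instance Definition _ :=
  isInner.Build R H innerDl innerZl innerC inner_norm.

HB.end.

Section InnerTheory.
Variables (R : realType) (H : PreHilbert.type R).
Implicit Types x y z : H.

Lemma inner0l x : inner 0 x = 0.
Proof. by rewrite -[0 in LHS](scale0r 0) innerZl mul0r. Qed.

Lemma innerDr x y z : inner x (y + z) = inner x y + inner x z.
Proof. by rewrite innerC innerDl rmorphD/= -!innerC. Qed.

Lemma innerZr a x y : inner x (a *: y) = a^* * inner x y.
Proof. by rewrite innerC innerZl rmorphM/= -innerC. Qed.

Lemma innerBl x y z : inner (x - y) z = inner x z - inner y z.
Proof. by rewrite innerDl -scaleN1r innerZl mulN1r. Qed.

Lemma cauchy_schwarz x y : `|inner x y| <= `|x| * `|y|.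
Proof.
have [->|y0] := eqVneq y 0.
  by rewrite innerC inner0l rmorph0 !normr0 mulr0.
have iy0 : 0 < inner y y by rewrite inner_norm exprn_gt0// normr_gt0.
rewrite -(@ler_pXn2r _ 2) ?nnegrE ?mulr_ge0// exprMn -!inner_norm.
have : 0 <= inner (inner y y *: x - inner x y *: y)
                  (inner y y *: x - inner x y *: y).
  by rewrite inner_norm exprn_ge0.
rewrite -scaleNr !(innerDl, innerDr, innerZl, innerZr) [inner y x]innerC.
rewrite rmorphN/= [(inner y y)^*](geC0_conj (ltW iy0)).
set a := inner x x; set b := inner y y; set c := inner x y.
rewrite normCK.
rewrite [X in 0 <= X -> _](_ : _ = b * (a * b - c * c^*)); last by ring.
by rewrite pmulr_rge0// subr_ge0.
Qed.

End InnerTheory.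

Lemma cauchy_lip (K : numFieldType) (V W : normedModType K) (g : V -> W)
    (F : set_system V) : ProperFilter F ->
  (forall x y, `|g x - g y| <= `|x - y|) -> cauchy F -> cauchy (g @ F).
Proof.
move=> FF gl /cauchy_ballP Fc; apply/cauchy_ballP => e e0.
have := Fc _ e0; rewrite !near_simpl => h.
rewrite near_map2; apply: filterS h => -[x y]/=.
rewrite -!ball_normE/=; exact: le_lt_trans.
Qed.

Section ComplexComplete.
Variable R : realType.

Let normi : `|'i%C : R[i]| = 1.
Proof. by rewrite normc_def/= expr0n expr1n add0r sqrtr1. Qed.

Let normc_lt2 (z w : R[i]) (d e : R) :
  `|complex.Re z - complex.Re w| < d -> `|complex.Im z - complex.Im w| < e ->
  `|z - w| < (d + e)%:C%C.
Proof.
case: z w => [a b] [x y] /= hR hI.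
have -> : (a +i* b - (x +i* y) = (a - x)%:C + 'i * (b - y)%:C)%C.
  apply/eqP; rewrite eq_complex/=.
  by rewrite !(mul0r, mulr0, mul1r, subr0, add0r, addr0) !eqxx.
apply: (le_lt_trans (ler_normD _ _)).
rewrite normrM normi mul1r !normc_def/=.
by rewrite !expr0n/= !addr0 !sqrtr_sqr -rmorphD/= ltcR ltrD.
Qed.

Lemma complex_complete (F : set_system R[i]) :
  ProperFilter F -> cauchy F -> cvg F.
Proof.
move=> FF /cauchy_ballP Fc.
have cRe : cvg ((@complex.Re R) @ F).
  apply: R_complete; apply/cauchy_ballP => e e0.
  have e0' : 0 < e%:C%C by rewrite ltcR.
  have := Fc _ e0'; rewrite !near_simpl => h.
  rewrite near_map2; apply: filterS h => -[x y]/=.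
  rewrite -!ball_normE/= => xy; rewrite -ltcR (le_lt_trans _ xy)//.
  have := normc_ge_Re (x - y); rewrite raddfB/=; exact.
have cIm : cvg ((@complex.Im R) @ F).
  apply: R_complete; apply/cauchy_ballP => e e0.
  have e0' : 0 < e%:C%C by rewrite ltcR.
  have := Fc _ e0'; rewrite !near_simpl => h.
  rewrite near_map2; apply: filterS h => -[x y]/=.
  rewrite -!ball_normE/= => xy; rewrite -ltcR (le_lt_trans _ xy)//.
  have := normc_ge_Re ('i%C * (x - y)); rewrite normrM normi mul1r.
  by case: (x) (y) => [a b] [c d] /=; rewrite mul0r mul1r sub0r normrN.
apply/cvg_ex; exists (Complex (lim (@complex.Re R @ F)) (lim (@complex.Im R @ F))).
move: cRe cIm => /cvgrPdist_lt cRe /cvgrPdist_lt cIm.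
apply/cvgrPdist_lt => e e0.
have [r r0 re] : exists2 r : R, 0 < r & e = r%:C%C.
  case: e e0 => a b; rewrite ltcE/= => /andP[/eqP -> a0].
  by exists a.
have r20 : 0 < r / 2 by rewrite divr_gt0.
have {}cRe := cRe _ r20; have {}cIm := cIm _ r20.
near=> z.
rewrite re (splitr r); apply: normc_lt2 => /=.
- by near: z.
- by near: z.
Unshelve. all: by end_near. Qed.

HB.instance Definition _ := Uniform_isComplete.Build R[i] complex_complete.

Let cinner (x y : R[i]) : R[i] := x * y^*.

Let cinnerDl x y z : cinner (x + y) z = cinner x z + cinner y z.
Proof. exact: mulrDl. Qed.
Let cinnerZl a x z : cinner (a *: x) z = a * cinner x z.
Proof. by rewrite /cinner mulrA. Qed.
Let cinnerC x y : cinner y x = (cinner x y)^*.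
Proof. by rewrite /cinner rmorphM/= conjCK mulrC. Qed.
Let cinner_norm (x : R[i]) : cinner x x = `|x| ^+ 2.
Proof. by rewrite normCK. Qed.

HB.instance Definition _ :=
  isInner.Build R R[i] cinnerDl cinnerZl cinnerC cinner_norm.

End ComplexComplete.

Section DirectSum.
Variables (R : realType) (H K : hilbertType R).

(* An alias of H * K, because H * K already carries the max norm. *)
Definition dsum : Type := (H * K)%type.
HB.instance Definition _ := GRing.Lmodule.copy dsum (H * K)%type.

Let dinner (x y : dsum) : R[i] := inner x.1 y.1 + inner x.2 y.2.
Let dinnerDl x y z : dinner (x + y) z = dinner x z + dinner y z.
Proof. by rewrite /dinner !innerDl addrACA. Qed.
Let dinnerZl a x z : dinner (a *: x) z = a * dinner x z.
Proof. by rewrite /dinner !innerZl mulrDr. Qed.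
Let dinnerC x y : dinner y x = (dinner x y)^*.
Proof. by rewrite /dinner rmorphD/= -!innerC. Qed.
Let dinner_gt0 x : x != 0 -> 0 < dinner x x.
Proof.
case: x => x y xy; rewrite lt_def /dinner/= !inner_norm.
rewrite addr_ge0 ?exprn_ge0// andbT; apply: contra xy.
rewrite paddr_eq0 ?exprn_ge0// !sqrf_eq0 !normr_eq0.
by move=> /andP[/eqP-> /eqP->].
Qed.

HB.instance Definition _ :=
  Lmodule_isPreHilbert.Build R dsum dinnerDl dinnerZl dinnerC dinner_gt0.

Lemma dsum_normE (x : dsum) : `|x| ^+ 2 = `|x.1| ^+ 2 + `|x.2| ^+ 2.
Proof. by rewrite -!inner_norm. Qed.

Lemma dsum_norm1 (x : dsum) : `|x.1| <= `|x|.
Proof.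
by rewrite -(@ler_pXn2r _ 2) ?nnegrE// dsum_normE lerDl exprn_ge0.
Qed.

Lemma dsum_norm2 (x : dsum) : `|x.2| <= `|x|.
Proof.
by rewrite -(@ler_pXn2r _ 2) ?nnegrE// dsum_normE lerDr exprn_ge0.
Qed.

Lemma dsum_norm_le (x : dsum) : `|x| <= `|x.1| + `|x.2|.
Proof.
rewrite -(@ler_pXn2r _ 2) ?nnegrE ?addr_ge0// dsum_normE sqrrD.
by rewrite -addrA lerD2l lerDr mulrn_wge0// mulr_ge0.
Qed.

Let dsum_complete (F : set_system dsum) : ProperFilter F -> cauchy F -> cvg F.
Proof.
move=> FF Fc.
have c1 : cvg ((fun x : dsum => x.1) @ F).
  apply: cauchy_cvg; apply: cauchy_lip => // x y.
  exact: (dsum_norm1 (x - y)).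
have c2 : cvg ((fun x : dsum => x.2) @ F).
  apply: cauchy_cvg; apply: cauchy_lip => // x y.
  exact: (dsum_norm2 (x - y)).
apply/cvg_ex; exists (lim ((fun x : dsum => x.1) @ F),
                      lim ((fun x : dsum => x.2) @ F)).
move: c1 c2 => /cvgrPdist_lt c1 /cvgrPdist_lt c2.
apply/cvgrPdist_lt => e e0.
have e20 : 0 < e / 2 by rewrite divr_gt0.
near=> z.
apply: (le_lt_trans (dsum_norm_le _)); rewrite (splitr e) ltrD//=.
- by near: z; exact: c1.
- by near: z; exact: c2.
Unshelve. all: by end_near. Qed.

HB.instance Definition _ := Uniform_isComplete.Build dsum dsum_complete.

End DirectSum.

(* Closed linear subspaces; [csub S] is S itself as a Hilbert space, with
   inclusion [cs_val]. *)
Record csubspace (R : realType) (H : hilbertType R) := CSubspace {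
  cs_set :> set H;
  cs_closed : closed cs_set;
  cs_submod : submod_closed (fun x => x \in cs_set)
}.

Section Subspace.
Variables (R : realType) (H : hilbertType R) (S : csubspace H).

Definition cs_pred : {pred H} := fun x => x \in cs_set S.
HB.instance Definition _ := GRing.isSubmodClosed.Build R[i] H cs_pred (cs_submod S).

Record csub : Type := CSub { cs_val : H; cs_valP : cs_val \in cs_pred }.
HB.instance Definition _ := [isSub for cs_val].
HB.instance Definition _ := [Choice of csub by <:].
HB.instance Definition _ := [SubChoice_isSubLmodule of csub by <:].

Let sinner (x y : csub) : R[i] := inner (cs_val x) (cs_val y).
Let sinnerDl x y z : sinner (x + y) z = sinner x z + sinner y z.
Proof. exact: innerDl. Qed.
Let sinnerZl a x z : sinner (a *: x) z = a * sinner x z.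
Proof. exact: innerZl. Qed.
Let sinnerC x y : sinner y x = (sinner x y)^*.
Proof. exact: innerC. Qed.
Let sinner_gt0 x : x != 0 -> 0 < sinner x x.
Proof.
move=> x0; rewrite /sinner inner_norm exprn_gt0// normr_gt0.
by apply: contra x0 => /eqP x0; apply/eqP/val_inj.
Qed.

HB.instance Definition _ :=
  Lmodule_isPreHilbert.Build R csub sinnerDl sinnerZl sinnerC sinner_gt0.

Lemma csub_norm (x : csub) : `|x| = `|cs_val x|.
Proof.
by apply/eqP; rewrite -(@eqrXn2 _ 2)// -!inner_norm.
Qed.

Let csub_complete (F : set_system csub) : ProperFilter F -> cauchy F -> cvg F.
Proof.
move=> FF Fc.
have c1 : cvg (cs_val @ F).
  apply: cauchy_cvg; apply: cauchy_lip => // x y.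
  by rewrite csub_norm.
have lS : lim (cs_val @ F) \in cs_pred.
  rewrite inE.
  have /closed_cvg : closed (cs_set S) := @cs_closed _ _ S.
  move=> /(_ csub F _ cs_val); apply; last exact: c1.
  by near=> x; have := cs_valP x; rewrite inE.
apply/cvg_ex; exists (CSub lS).
move: c1 => /cvgrPdist_lt c1; apply/cvgrPdist_lt => e e0.
near=> z; rewrite csub_norm/=.
by near: z; exact: c1.
Unshelve. all: by end_near. Qed.

HB.instance Definition _ := Uniform_isComplete.Build csub csub_complete.

End Subspace.

Section SupNorm.
Variables (R : realType) (I : Type) (V : normedModType R[i]).
Implicit Types (A : set I) (f g : I -> V) (M : R[i]).

Definition bounded_on A f := exists M, forall i, A i -> `|f i| <= M.

(* sup over A of |f i|; meaningful when f is bounded on A, 0 when A is empty. *)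
Definition supnorm A f : R[i] :=
  (sup [set complex.Re `|f i| | i in A])%:C%C.

Let Re_norm (x : V) : (complex.Re `|x|)%:C%C = `|x|.
Proof.
by have := normr_ge0 x; case: `|x| => a b; rewrite lecE/= => /andP[/eqP->].
Qed.

Let Re_le (x y : R[i]) : x <= y -> complex.Re x <= complex.Re y.
Proof. by rewrite lecE => /andP[]. Qed.

Lemma supnorm_ge0 A f : 0 <= supnorm A f.
Proof.
rewrite ler0c; set E := [set _ | _ in _].
have [hs|hs] := pselect (has_sup E); last by rewrite sup_out.
have [[y Ey] ubE] := hs; apply: (@le_trans _ _ y); last exact: ub_le_sup.
by case: Ey => i _ <-; exact: (@Re_le 0).
Qed.

Lemma supnorm_ub A f i : bounded_on A f -> A i -> `|f i| <= supnorm A f.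
Proof.
move=> [M fM] Ai; rewrite -Re_norm lecR; apply: ub_le_sup; last by exists i.
by exists (complex.Re M) => _ [j /fM + <-]; exact: Re_le.
Qed.

Lemma supnorm_le A f M : 0 <= M -> (forall i, A i -> `|f i| <= M) ->
  supnorm A f <= M.
Proof.
move=> M0 fM.
have -> : M = (complex.Re M)%:C%C.
  by move: M0; case: M {fM} => a b; rewrite lecE/= => /andP[/eqP->].
rewrite lecR.
have [->|/set0P[i Ai]] := eqVneq A set0.
  by rewrite image_set0 sup0; exact: (@Re_le 0).
by apply: ge_sup; [exists (complex.Re `|f i|), i|move=> _ [j /fM + <-]; exact: Re_le].
Qed.

Lemma supnormD A f g : bounded_on A f -> bounded_on A g ->
  supnorm A (f + g) <= supnorm A f + supnorm A g.
Proof.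
move=> bf bg; apply: supnorm_le => [|i Ai]; first by rewrite addr_ge0 ?supnorm_ge0.
by rewrite (le_trans (ler_normD _ _))// lerD ?supnorm_ub.
Qed.

Lemma supnormZ A (a : R[i]) f : bounded_on A f ->
  supnorm A (a *: f) = `|a| * supnorm A f.
Proof.
move=> bf.
have baf b : bounded_on A (b *: f).
  case: bf => M fM; exists (`|b| * M) => i /fM h.
  by rewrite normrZ ler_wpM2l.
have le b g : bounded_on A g -> supnorm A (b *: g) <= `|b| * supnorm A g.
  move=> bg; apply: supnorm_le => [|i Ai]; first by rewrite mulr_ge0 ?supnorm_ge0.
  by rewrite normrZ ler_wpM2l ?supnorm_ub.
apply/eqP; rewrite eq_le le//=.
have [->|a0] := eqVneq a 0; first by rewrite normr0 mul0r supnorm_ge0.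
rewrite -ler_pdivlMl ?normr_gt0// -normfV.
by rewrite -{1}[f](scalerK a0) le.
Qed.

End SupNorm.

Section BoundedOperators.
Variables (R : realType) (V W : normedModType R[i]).

(* B(V, W), normed by the operator norm. *)
Definition bop_pred : {pred V -> W} := fun f =>
  `[< (forall (a : R[i]) x y, f (a *: x + y) = a *: f x + f y)
      /\ exists M, forall x, `|f x| <= M * `|x| >].

Lemma bop_submod : submod_closed bop_pred.
Proof.
split.
  apply/asboolP; split; first by move=> a x y; change (0 = a *: 0 + 0 :> W); rewrite scaler0 addr0.
  by exists 0 => x; rewrite mul0r; change (`|0 : W| <= 0); rewrite normr0.
move=> a f g /asboolP[lf [M fM]] /asboolP[lg [N gN]]; apply/asboolP; split.
  move=> b x y; change (a *: f (b *: x + y) + g (b *: x + y) =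
    b *: (a *: f x + g x) + (a *: f y + g y)); rewrite lf lg !scalerDr !scalerA (mulrC a).
  by rewrite addrACA.
exists (`|a| * M + N) => x; rewrite (le_trans (ler_normD _ _))//.
by rewrite mulrDl lerD// normrZ -mulrA ler_wpM2l.
Qed.
HB.instance Definition _ := GRing.isSubmodClosed.Build R[i] (V -> W) bop_pred bop_submod.

Record bop : Type := Bop { bop_fun :> V -> W; bopP : bop_fun \in bop_pred }.
HB.instance Definition _ := [isSub for bop_fun].
HB.instance Definition _ := [Choice of bop by <:].
HB.instance Definition _ := [SubChoice_isSubLmodule of bop by <:].

Lemma bop_lin (T : bop) (a : R[i]) x y : T (a *: x + y) = a *: T x + T y.
Proof. by have /asboolP[] := bopP T. Qed.

Lemma bop_bounded (T : bop) : exists M, forall x, `|T x| <= M * `|x|.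
Proof. by have /asboolP[] := bopP T. Qed.

HB.instance Definition _ (T : bop) :=
  GRing.isLinear.Build R[i] V W _ T (bop_lin T).

Lemma bopE (S T : bop) : (forall x, S x = T x) -> S = T.
Proof. by move=> ST; apply/val_inj/funext. Qed.

Definition unit_ball : set V := [set x | `|x| <= 1].

Let opnorm (T : bop) : R[i] := supnorm unit_ball T.

Let bop_bounded_on (T : bop) : bounded_on unit_ball T.
Proof.
have [M TM] := bop_bounded T.
exists `|M| => x x1; have h := le_trans (normr_ge0 _) (TM x).
apply: (le_trans (TM x)); rewrite -(ger0_norm h) normrM normr_id.
by rewrite ler_piMr.
Qed.

Let opnormD (S T : bop) : opnorm (S + T) <= opnorm S + opnorm T.
Proof. exact: supnormD. Qed.
Let opnormZ (a : R[i]) (T : bop) : opnorm (a *: T) = `|a| * opnorm T.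
Proof. exact: supnormZ. Qed.
Let opnorm0 (T : bop) : opnorm T = 0 -> T = 0.
Proof.
move=> T0; apply: bopE => x; change (T x = 0).
have [->|x0] := eqVneq x 0; first by rewrite linear0.
have : `|T (`|x|^-1 *: x)| <= opnorm T.
  by apply: supnorm_ub => //; rewrite /unit_ball/= normfZV.
rewrite T0 normr_le0 linearZ/= scaler_eq0 invr_eq0 normr_eq0 (negPf x0)/=.
by move/eqP.
Qed.

HB.instance Definition _ := Lmodule_isNormed.Build R[i] bop opnormD opnormZ opnorm0.

Lemma bop_normE (T : bop) : `|T| = supnorm unit_ball T.
Proof. by []. Qed.

End BoundedOperators.

Section Cb.
Variables (R : realType) (K : topologicalType).

(* The C*-algebra C_b(K): pointwise ring structure, involution [cb_conj],
   supremum norm. *)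
Definition cb_pred : {pred K -> R[i]} := fun f =>
  `[< continuous f /\ bounded_on setT f >].

Let cb_subring : subring_closed cb_pred.
Proof.
split.
- apply/asboolP; split; first exact: cst_continuous.
  by exists 1 => i _; rewrite normr1.
- move=> f g /asboolP[cf [M fM]] /asboolP[cg [N gN]]; apply/asboolP; split.
    by move=> x; apply: cvgB; [exact: cf|exact: cg].
  exists (M + N) => i _.
  by rewrite (le_trans (ler_normB _ _))// lerD ?fM ?gN.
- move=> f g /asboolP[cf [M fM]] /asboolP[cg [N gN]]; apply/asboolP; split.
    by move=> x; apply: cvgM; [exact: cf|exact: cg].
  by exists (M * N) => i _; rewrite normrM ler_pM ?fM ?gN.
Qed.
HB.instance Definition _ := GRing.isSubringClosed.Build (K -> R[i]) cb_pred cb_subring.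

Let cb_scale : GRing.scaler_closed cb_pred.
Proof.
move=> a f /asboolP[cf [M fM]]; apply/asboolP; split.
  by move=> x; apply: cvgZr; exact: cf.
by exists (`|a| * M) => i _; rewrite normrZ ler_wpM2l ?fM.
Qed.
HB.instance Definition _ := GRing.isScaleClosed.Build R[i] (K -> R[i]) cb_pred cb_scale.

Record Cb : Type := mkCb { cb_fun :> K -> R[i]; cbP : cb_fun \in cb_pred }.
HB.instance Definition _ := [isSub for cb_fun].
HB.instance Definition _ := [Choice of Cb by <:].
HB.instance Definition _ :=
  GRing.SubChoice_isSubComPzRing.Build _ _ Cb (subringClosedP _).
HB.instance Definition _ := [SubZmodule_isSubLmodule of Cb by <:].

Lemma cb_bounded (f : Cb) : bounded_on setT f.
Proof. by have /asboolP[] := cbP f. Qed.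

Lemma cb_continuous (f : Cb) : continuous f.
Proof. by have /asboolP[] := cbP f. Qed.

Let cbnorm (f : Cb) : R[i] := supnorm setT f.

Let cbnormD (f g : Cb) : cbnorm (f + g) <= cbnorm f + cbnorm g.
Proof. by apply: supnormD; exact: cb_bounded. Qed.
Let cbnormZ (a : R[i]) (f : Cb) : cbnorm (a *: f) = `|a| * cbnorm f.
Proof. by apply: supnormZ; exact: cb_bounded. Qed.
Let cbnorm0 (f : Cb) : cbnorm f = 0 -> f = 0.
Proof.
move=> f0; apply/val_inj/funext => x; apply/eqP; rewrite -normr_le0.
by have := @supnorm_ub _ _ _ setT f x (cb_bounded f) I; rewrite -/(cbnorm f) f0.
Qed.

HB.instance Definition _ := Lmodule_isNormed.Build R[i] Cb cbnormD cbnormZ cbnorm0.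

Let cb_conj_subproof (f : Cb) : (fun x => (f x)^*) \in cb_pred.
Proof.
apply/asboolP; split.
  move=> x; apply/cvgrPdist_lt => e e0.
  have /cvgrPdist_lt/(_ e e0) := @cb_continuous f x.
  by apply: filterS => y /=; rewrite -rmorphB/= norm_conjC.
by have [M fM] := cb_bounded f; exists M => x Tx; rewrite norm_conjC; exact: fM.
Qed.

Definition cb_conj (f : Cb) : Cb := mkCb (cb_conj_subproof f).

End Cb.

Section ClosedSpan.
Variables (R : realType) (H : hilbertType R).
Implicit Types A : set H.

Definition lin_span A : set H := [set x | exists n (c : 'I_n -> R[i]) (a : 'I_n -> H),
  (forall i, A (a i)) /\ x = \sum_i c i *: a i].

Let closureE A x : closure A x <-> forall e : R[i], 0 < e -> exists2 a, A a & `|x - a| < e.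
Proof.
split=> [Ax e e0|Ax B /nbhs_ballP[e/= e0 xB]].
  have [a [Aa]] := Ax _ (nbhsx_ballx x e e0).
  by rewrite -ball_normE/= => xa; exists a.
have [a Aa xa] := Ax _ e0; exists a; split=> //; apply: xB.
by rewrite -ball_normE.
Qed.

Let lin_span_submod A a x y : lin_span A x -> lin_span A y -> lin_span A (a *: x + y).
Proof.
move=> [m [c [u [Au ->]]]] [n [d [v [Av ->]]]].
exists (m + n)%N, (fun i : 'I_(m + n) => match fintype.split i with inl j => a * c j | inr j => d j end),
  (fun i : 'I_(m + n) => match fintype.split i with inl j => u j | inr j => v j end); split.
  by move=> i; case: fintype.split.
rewrite big_split_ord/= scaler_sumr; congr (_ + _); apply: eq_bigr => i _.
  by rewrite (unsplitK (inl i)) scalerA.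
by rewrite (unsplitK (inr i)).
Qed.

Let closure_lin_span_submod A : submod_closed (fun x => x \in closure (lin_span A)).
Proof.
split.
  rewrite inE; apply: subset_closure.
  exists 0%N, (fun=> 0), (fun=> 0); split; first by case.
  by rewrite big_ord0.
move=> a x y; rewrite !inE => /closureE Sx /closureE Sy; apply/closureE => e e0.
have a0 : 0 < `|a| + 1 by rewrite ltr_wpDl.
have [|x' Sx' xx'] := Sx (e / 2 / (`|a| + 1)); first by rewrite !divr_gt0.
have [|y' Sy' yy'] := Sy (e / 2); first by rewrite divr_gt0.
exists (a *: x' + y'); first exact: lin_span_submod.
rewrite opprD addrACA -scalerBr (le_lt_trans (ler_normD _ _))// normrZ.
rewrite (splitr e) ler_ltD//.
rewrite ltr_pdivlMr// in xx'; rewrite (le_trans _ (ltW xx'))// mulrC.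
by rewrite ler_wpM2l// lerDl.
Qed.

Definition closed_span A : csubspace H :=
  CSubspace (@closed_closure _ (lin_span A)) (@closure_lin_span_submod A).

Definition ocompl_set (S : csubspace H) : set H :=
  [set x | forall y, cs_set S y -> inner x y = 0].

Let ocompl_closed S : closed (ocompl_set S).
Proof.
move=> x /closureE Cx y Sy; apply/eqP; rewrite -normr_le0.
apply/ler_addgt0Pr => e e0; rewrite add0r.
have y0 : 0 < `|y| + 1 by rewrite ltr_wpDl.
have [|x' Cx' xx'] := Cx (e / (`|y| + 1)); first by rewrite divr_gt0.
rewrite -[inner x y]subr0 -(Cx' _ Sy) -innerBl (le_trans (cauchy_schwarz _ _))//.
rewrite ltr_pdivlMr// in xx'; rewrite (le_trans _ (ltW xx'))//.
by rewrite ler_wpM2l// lerDl.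
Qed.

Let ocompl_submod S : submod_closed (fun x => x \in ocompl_set S).
Proof.
split; first by rewrite inE => y _; rewrite inner0l.
move=> a x y; rewrite !inE => Cx Cy w Sw.
by rewrite innerDl innerZl Cx// Cy// mulr0 addr0.
Qed.

Definition ocompl (S : csubspace H) : csubspace H :=
  CSubspace (@ocompl_closed S) (@ocompl_submod S).

End ClosedSpan.

Section Operators.
Variable R : realType.

Lemma mkbop_subproof (V W : normedModType R[i]) (f : V -> W) (M : R[i]) :
  (forall (a : R[i]) x y, f (a *: x + y) = a *: f x + f y) ->
  (forall x, `|f x| <= M * `|x|) -> f \in @bop_pred R V W.
Proof. by move=> lf bf; apply/asboolP; split=> //; exists M. Qed.

Lemma id_op_subproof (V : normedModType R[i]) : @id V \in @bop_pred R V V.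
Proof. by apply: (@mkbop_subproof _ _ _ 1) => // x; rewrite mul1r. Qed.
Definition id_op (V : normedModType R[i]) : bop V V := Bop (id_op_subproof V).

Lemma comp_op_subproof (V W Z : normedModType R[i]) (S : bop W Z) (T : bop V W) :
  S \o T \in @bop_pred R V Z.
Proof.
have [M SM] := bop_bounded S; have [N TN] := bop_bounded T.
apply: (@mkbop_subproof _ _ _ (`|M| * `|N|)) => [a x y|x] /=.
  by rewrite !linearP.
have SM' y : `|S y| <= `|M| * `|y|.
  have h1 := le_trans (normr_ge0 _) (SM y).
  by apply: (le_trans (SM y)); rewrite -(ger0_norm h1) normrM normr_id.
have TN' y : `|T y| <= `|N| * `|y|.
  have h1 := le_trans (normr_ge0 _) (TN y).
  by apply: (le_trans (TN y)); rewrite -(ger0_norm h1) normrM normr_id.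
by rewrite (le_trans (SM' _))// -mulrA ler_wpM2l.
Qed.
Definition comp_op (V W Z : normedModType R[i]) (S : bop W Z) (T : bop V W) : bop V Z :=
  Bop (comp_op_subproof S T).

Definition op_invertible (V : normedModType R[i]) (T : bop V V) : Prop :=
  exists S, comp_op S T = id_op V /\ comp_op T S = id_op V.

(* [xget 0 P] is an element of P when P is nonempty, and 0 otherwise; the sets P
   below have at most one element. *)
Definition op_inv (V : normedModType R[i]) (T : bop V V) : bop V V :=
  xget 0 [set S : bop V V | comp_op S T = id_op V /\ comp_op T S = id_op V].

Section Hilbert.
Variables H K : hilbertType R.

Definition adj (T : bop H K) : bop K H :=
  xget 0 [set S : bop K H | forall x y, inner (T x) y = inner x (S y)].

Definition unitary (T : bop H K) : Prop :=
  comp_op (adj T) T = id_op H /\ comp_op T (adj T) = id_op K.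

Definition positive_op (T : bop H H) : Prop := forall x, 0 <= inner (T x) x.

(* Used for S invariant under T. *)
Definition restr (T : bop H H) (S : csubspace H) : bop (csub S) (csub S) :=
  xget 0 [set T' : bop (csub S) (csub S) | forall x, cs_val (T' x) = T (cs_val x)].

Lemma dfst_subproof : (fun x : dsum H K => x.1) \in @bop_pred R (dsum H K) H.
Proof.
apply: (@mkbop_subproof _ _ _ 1) => // x.
by rewrite mul1r; exact: dsum_norm1.
Qed.
Definition dfst : bop (dsum H K) H := Bop dfst_subproof.

Lemma dsnd_subproof : (fun x : dsum H K => x.2) \in @bop_pred R (dsum H K) K.
Proof.
apply: (@mkbop_subproof _ _ _ 1) => // x.
by rewrite mul1r; exact: dsum_norm2.
Qed.
Definition dsnd : bop (dsum H K) K := Bop dsnd_subproof.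

Lemma dinl_subproof : (fun x : H => (x, 0) : dsum H K) \in @bop_pred R H (dsum H K).
Proof.
apply: (@mkbop_subproof _ _ _ 1) => [a x y|x].
  change ((a *: x + y, 0) = (a *: x + y, a *: 0 + 0) :> (H * K)%type).
  by rewrite scaler0 addr0.
by rewrite mul1r (le_trans (dsum_norm_le _))//= normr0 addr0.
Qed.
Definition dinl : bop H (dsum H K) := Bop dinl_subproof.

Lemma dinr_subproof : (fun x : K => (0, x) : dsum H K) \in @bop_pred R K (dsum H K).
Proof.
apply: (@mkbop_subproof _ _ _ 1) => [a x y|x].
  change ((0, a *: x + y) = (a *: 0 + 0, a *: x + y) :> (H * K)%type).
  by rewrite scaler0 addr0.
by rewrite mul1r (le_trans (dsum_norm_le _))//= normr0 add0r.
Qed.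
Definition dinr : bop K (dsum H K) := Bop dinr_subproof.
End Hilbert.

Section Blocks.
Variables (H1 H2 K1 K2 : hilbertType R) (T : bop (dsum H1 H2) (dsum K1 K2)).
Definition block11 : bop H1 K1 := comp_op (dfst K1 K2) (comp_op T (dinl H1 H2)).
Definition block12 : bop H2 K1 := comp_op (dfst K1 K2) (comp_op T (dinr H1 H2)).
Definition block21 : bop H1 K2 := comp_op (dsnd K1 K2) (comp_op T (dinl H1 H2)).
Definition block22 : bop H2 K2 := comp_op (dsnd K1 K2) (comp_op T (dinr H1 H2)).
End Blocks.

End Operators.

Section Riesz.
Variables (R : realType) (H : hilbertType R) (phi : bop H R[i]).

Let nr (x : H) : R := complex.Re `|x|.
Let nrE x : (nr x)%:C%C = `|x|.
Proof.
by rewrite /nr; have := normr_ge0 x; case: `|x| => a b; rewrite lecE/= => /andP[/eqP->].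
Qed.

Let nr_ge0 x : 0 <= nr x.
Proof. by rewrite -ler0c nrE. Qed.

Let parallelogram x y : nr (x - y) ^+ 2 + nr (x + y) ^+ 2 = 2 * nr x ^+ 2 + 2 * nr y ^+ 2.
Proof.
rewrite !mulrDl !mul1r; apply: (@complexI R).
rewrite !rmorphD !rmorphXn/= !nrE -!inner_norm.
rewrite -[- y]scaleN1r !(innerDl, innerDr, innerZl, innerZr) rmorphN rmorph1.
by ring.
Qed.

Let ltr0c (k : R) : (0 < k%:C%C) = (0 < k).
Proof. exact: (ltcR 0 k). Qed.

Let nr_half x : nr (2^-1 *: x) = 2^-1 * nr x.
Proof.
apply: (@complexI R); rewrite nrE normrZ normfV normr_nat -nrE.
by rewrite rmorphM fmorphV rmorph_nat.
Qed.

Let min_point : (exists x, phi x = 1) ->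
  exists2 x0, phi x0 = 1 & forall y, phi y = 1 -> nr x0 <= nr y.
Proof.
move=> [w w1]; pose S := [set nr x | x in [set x | phi x = 1]].
have infS : has_inf S.
  by split; [exists (nr w), w|exists 0 => _ [x _ <-]].
pose d := inf S.
have dS y : phi y = 1 -> d <= nr y by move=> y1; apply: ge_inf; [exact: infS.2|exists y].
have d0 : 0 <= d by apply: lb_le_inf => [|_ [x _ <-]//]; exact: infS.1.
pose A e := [set x | phi x = 1 /\ nr x < d + e].
have AN0 e : 0 < e -> A e !=set0.
  move=> e0; have [_ [x x1 <-] xe] := inf_adherent e0 infS.
  by exists x.
have Adist e x y : 0 < e -> A e x -> A e y -> nr (x - y) ^+ 2 <= 4 * e * (2 * d + e).
  move=> e0 [x1 xe] [y1 ye].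
  have hxy : 2 * d <= nr (x + y).
    have : phi (2^-1 *: (x + y)) = 1.
      rewrite linearZ linearD/= x1 y1 -mulr2n /GRing.scale/= -mulr_natl mulr1.
      by rewrite mulVf// pnatr_eq0.
    by move/dS; rewrite nr_half ler_pdivlMl.
  have := parallelogram x y.
  have := nr_ge0 x; have := nr_ge0 y.
  by nra.
pose F := filter_from [set e : R | 0 < e] A.
have FF : ProperFilter F.
  apply: filter_from_proper; last by move=> e /AN0.
  apply: filter_from_filter; first by exists 1 => /=.
  move=> i j /= i0 j0; exists (Num.min i j); first by rewrite /= lt_min i0 j0.
  by move=> x [x1]; rewrite -ltrBlDl lt_min => /andP[xi xj]; split; split => //; rewrite -ltrBlDl.
have small (e : R) : 0 < e -> exists2 r, 0 < r & forall x y, A r x -> A r y -> nr (x - y) < e.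
  move=> e0; pose r := Num.min 1 (e ^+ 2 / (8 * (2 * d + 1))).
  have r0 : 0 < r by rewrite lt_min ltr01/= divr_gt0// ?exprn_gt0// mulr_gt0// ltr_wpDl// mulr_ge0.
  exists r => // x y Ax Ay.
  have := Adist _ _ _ r0 Ax Ay.
  have r1 : r <= 1 by rewrite ge_min lexx.
  have : r <= e ^+ 2 / (8 * (2 * d + 1)) by rewrite ge_min lexx orbT.
  rewrite ler_pdivlMr; last by rewrite mulr_gt0// ltr_wpDl// mulr_ge0.
  move=> h1 h2; rewrite ltNge; apply/negP => h3.
  have : e ^+ 2 <= nr (x - y) ^+ 2 by rewrite ler_pXn2r// nnegrE ?(ltW e0)//.
  nra.
have Fc : cauchy F.
  apply: cauchy_exP => e e0.
  have eE : e = (complex.Re e)%:C%C.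
    by move: e0; case: e => a b; rewrite ltcE/= => /andP[/eqP->].
  have [|r r0 hr] := small (complex.Re e); first by rewrite -ltr0c -eE.
  have [x Ax] := AN0 _ r0; exists x, r => // y Ay.
  by rewrite -ball_normE/= eE -nrE ltcR; exact: hr.
have /cvg_ex[x0 Fx0] : cvg F by exact: cauchy_cvg.
have near0 (e r : R) : 0 < e -> 0 < r -> exists2 x, A r x & nr (x0 - x) < e.
  move=> e0 r0.
  have eC : 0 < e%:C%C by rewrite ltr0c.
  have [s /= s0 hs] : F (ball x0 e%:C%C) by apply: Fx0; exact: nbhsx_ballx.
  have [|x Ax] := AN0 (Num.min s r); first by rewrite lt_min s0.
  exists x.
    by case: Ax => x1 xsr; split=> //; apply: (lt_le_trans xsr); rewrite lerD2l ge_min lexx orbT.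
  rewrite -ltcR nrE; have := hs x; rewrite -ball_normE/=; apply.
  case: Ax => x1 xsr; split=> //.
  by apply: (lt_le_trans xsr); rewrite lerD2l ge_min lexx.
exists x0; last first.
  move=> y /dS dy; apply: le_trans dy; apply/ler_addgt0Pr => e e0.
  have [||x [_ xe] x0x] := near0 (e / 2) (e / 2); rewrite ?divr_gt0//.
  have : nr x0 <= nr (x0 - x) + nr x.
    by rewrite -lecR rmorphD/= !nrE -{1}(subrK x x0) ler_normD.
  lra.
have [M phiM] := bop_bounded phi.
apply/eqP; rewrite -subr_eq0 -normr_le0; apply/ler_addgt0Pr => e e0; rewrite add0r.
have M1 : 0 < `|M| + 1 by rewrite ltr_wpDl.
pose e' := complex.Re (e / (`|M| + 1)).
have e'E : e'%:C%C = e / (`|M| + 1).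
  rewrite /e'; have : 0 < e / (`|M| + 1) by rewrite divr_gt0.
  by case: (e / _) => a b; rewrite ltcE/= => /andP[/eqP->].
have [||x [x1 _] x0x] := near0 e' 1 => //; first by rewrite -ltr0c e'E divr_gt0.
rewrite -x1 -linearB; have h := le_trans (normr_ge0 _) (phiM (x0 - x)).
apply: (le_trans (phiM _)); rewrite -(ger0_norm h) normrM normr_id.
move: x0x; rewrite -ltcR nrE e'E ltr_pdivlMr// => /ltW; apply: le_trans.
by rewrite mulrC ler_wpM2l// lerDl.
Qed.

Lemma riesz : exists v, forall x, phi x = inner x v.
Proof.
have [h|h] := pselect (exists x, phi x = 1); last first.
  exists 0 => x; rewrite innerC inner0l rmorph0; apply/eqP; apply: contrapT => /negP px.
  by apply: h; exists ((phi x)^-1 *: x); rewrite linearZ; exact: mulVf.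
have [x0 x01 x0min] := min_point h.
have ort u : phi u = 0 -> inner u x0 = 0.
  move=> u0; have [->|un0] := eqVneq u 0; first by rewrite inner0l.
  have uu0 : 0 < inner u u by rewrite inner_norm exprn_gt0// normr_gt0.
  pose c := - (inner x0 u / inner u u).
  have : phi (x0 + c *: u) = 1 by rewrite linearD linearZ/= u0 scaler0 addr0.
  move/x0min; rewrite -lecR !nrE -(@ler_pXn2r _ 2) ?nnegrE// -!inner_norm.
  rewrite !(innerDl, innerDr, innerZl, innerZr) -addrA lerDl.
  rewrite /c rmorphN rmorphM/= fmorphV/= [(inner u u)^*](geC0_conj (ltW uu0)).
  rewrite -[(inner x0 u)^*]innerC.
  set a := inner u x0; set b := inner u u.
  have aE : inner x0 u = a^* by rewrite /a [LHS]innerC.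
  rewrite aE (_ : _ + _ = - (`|a| ^+ 2 / b)); last first.
    rewrite normCK; have : b != 0 by rewrite gt_eqF.
    by move=> b0; field.
  rewrite oppr_ge0 pmulr_lle0 ?invr_gt0// => a0.
  have : `|a| ^+ 2 == 0 by rewrite eq_le a0 exprn_ge0.
  by rewrite expf_eq0/= normr_eq0 => /eqP.
have x0n : inner x0 x0 != 0.
  rewrite inner_norm expf_eq0/= normr_eq0; apply/negP => /eqP x00.
  by move: x01; rewrite x00 linear0 => /esym/eqP; rewrite oner_eq0.
exists ((inner x0 x0)^-1 *: x0) => x.
have := ort (x - phi x *: x0); rewrite linearB linearZ/= x01 /GRing.scale/= mulr1 subrr.
move=> /(_ erefl) /eqP; rewrite innerBl innerZl subr_eq0 => /eqP xx0.
rewrite innerZr fmorphV/= -innerC xx0 mulrC mulfK//.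
Qed.
End Riesz.

Lemma adjP (R : realType) (H K : hilbertType R) (T : bop H K) x y :
  inner (T x) y = inner x (adj T y).
Proof.
move: x y.
suff ex : exists S : bop K H, forall x y, inner (T x) y = inner x (S y).
  exact: (@xgetPex _ 0 [set S : bop K H | forall x y, inner (T x) y = inner x (S y)] ex).
have [M TM] := bop_bounded T.
have fb (y : K) : (fun x => inner (T x) y) \in @bop_pred R H R[i].
  apply: (@mkbop_subproof _ _ _ _ (`|M| * `|y|)) => [a u v|u].
    by rewrite linearP innerDl innerZl.
  rewrite (le_trans (cauchy_schwarz _ _))// mulrAC ler_wpM2r//.
  have h := le_trans (normr_ge0 _) (TM u).
  by apply: (le_trans (TM u)); rewrite -(ger0_norm h) normrM normr_id.
have /choice[S ST] : forall y, exists v, forall x, inner (T x) y = inner x v.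
  by move=> w; have [v hv] := riesz (Bop (fb w)); exists v.
have inj (u v : H) : (forall x, inner x u = inner x v) -> u = v.
  move=> uv; apply/eqP; rewrite -subr_eq0.
  have : `|u - v| ^+ 2 == 0.
    rewrite -inner_norm -[- v]scaleN1r innerDr innerZr uv rmorphN rmorph1.
    by rewrite mulN1r subrr.
  by rewrite expf_eq0/= normr_eq0.
have Sb : S \in @bop_pred R K H.
  apply: (@mkbop_subproof _ _ _ _ `|M|) => [a u v|u].
    apply: inj => w; rewrite -ST innerDr innerZr innerDr innerZr.
    by rewrite -!ST.
  have [->|Su0] := eqVneq (S u) 0; first by rewrite normr0 mulr_ge0.
  rewrite -(@ler_pM2l _ `|S u|) ?normr_gt0// -expr2 -inner_norm -ST.
  rewrite (le_trans (real_ler_norm _)) //.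
    by rewrite ST inner_norm realX// ger0_real.
  rewrite (le_trans (cauchy_schwarz _ _))// mulrA ler_wpM2r// mulrC.
  have h := le_trans (normr_ge0 _) (TM (S u)).
  by apply: (le_trans (TM _)); rewrite -(ger0_norm h) normrM normr_id.
by exists (Bop Sb).
Qed.

Definition cdisc (R : realType) : set R[i] := [set z | `|z| <= 1].

(* A domain with a set of test functions, seen as points of the product of copies
   of the closed disc indexed by the domain: {ptws _ -> _} carries the product
   topology and the type of a subset carries the subspace topology. *)
Record test_domain (R : realType) := TestDomain {
  td_space : normedModType R[i];
  td_dom : set td_space;
  td_test : set {ptws td_dom -> @cdisc R}
}.

Section TestDomain.
Variables (R : realType) (D : test_domain R).

Definition td_point : Type := set_type (@td_dom R D).
Definition td_fun : topologicalType := set_type (@td_test R D).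

Let td_eval_subproof (x : td_point) :
  (fun psi : td_fun => set_val (set_val psi x)) \in @cb_pred R td_fun.
Proof.
apply/asboolP; split; last first.
  by exists 1 => psi _; have := set_valP (set_val psi x).
move=> psi.
apply: (@continuous_comp _ _ _ (fun psi : td_fun => set_val psi x) set_val).
  apply: (@continuous_comp _ _ _ (set_val : td_fun -> _) (fun psi => psi x)).
    exact: initial_continuous.
  exact: (@proj_continuous (@td_dom R D) (fun=> @cdisc R)).
exact: initial_continuous.
Qed.

Definition td_eval (x : td_point) : Cb R td_fun := mkCb (td_eval_subproof x).

(* Functions on the (open) domain are given as total functions on the ambient
   space; their values off the domain play no role.  [differentiable] is Frechet
   differentiability over R[i], for the operator norm on the target. *)
Definition schur_class (H K : hilbertType R) (F : td_space D -> bop H K) : Prop :=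
  [/\ forall z, td_dom z -> differentiable F z,
      bounded_on (@td_dom R D) F & supnorm (@td_dom R D) F <= 1].

End TestDomain.

Notation "S \oc T" := (comp_op S T) (at level 40, left associativity) : ring_scope.

Section Domains.
Variable R : realType.

Definition bidisc_set : set (R[i] * R[i]) := [set z | `|z.1| < 1 /\ `|z.2| < 1].

Definition bidisc : test_domain R := @TestDomain R (R[i] * R[i])%type bidisc_set
  [set psi | (forall z, set_val (psi z) = (set_val z).1) \/
             (forall z, set_val (psi z) = (set_val z).2)].

Definition symbidisc_set : set (R[i] * R[i]) :=
  [set (zeta.1 + zeta.2, zeta.1 * zeta.2) | zeta in bidisc_set].

Definition symbidisc_test (alpha s p : R[i]) : R[i] :=
  (2 * alpha * p - s) / (2 - alpha * s).

Definition symbidisc : test_domain R := @TestDomain R (R[i] * R[i])%type symbidisc_set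
  [set psi | exists2 alpha : R[i], `|alpha| <= 1 &
     forall z, set_val (psi z) = symbidisc_test alpha (set_val z).1 (set_val z).2].

Definition annulus_set (q : R) : set R[i] := [set z | q%:C%C < `|z| < 1].

Definition zero_of_order (phi : R[i] -> R[i]) (a : R[i]) (m : nat) : Prop :=
  exists g : R[i] -> R[i],
    [/\ \forall z \near a, differentiable g z, g a != 0 &
        \forall z \near a, phi z = (z - a) ^+ m * g z].

(* [s] lists the zeros of phi in the annulus, repeated according to their
   multiplicity. *)
Definition annulus_test (q : R) (phi : R[i] -> R[i]) : Prop :=
  [/\ exists W : set R[i], [/\ open W, closure (annulus_set q) `<=` W &
        forall z, W z -> differentiable phi z],
      forall z, (closure (annulus_set q) `\` (annulus_set q)°) z -> `|phi z| = 1,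
      exists2 s : seq R[i], size s = 2 /\ (forall a, a \in s -> annulus_set q a) &
        forall a, annulus_set q a -> zero_of_order phi a (count_mem a s),
      phi (Num.sqrt q)%:C%C = 0 & phi 1 = 1].

Definition annulus (q : R) : test_domain R := @TestDomain R R[i] (annulus_set q)
  [set psi | exists2 phi, annulus_test q phi &
     forall z, set_val (psi z) = phi (set_val z)].

Variant setting : test_domain R -> hilbertType R -> hilbertType R -> Prop :=
| Bidisc U Y : setting bidisc U Y
| SymBidisc U Y : setting symbidisc U Y
| Annulus q : 0 < q -> q < 1 -> setting (annulus q) R[i] R[i].

End Domains.

Section Kernels.
Variables (R : realType) (T : Type) (K : topologicalType) (Y : hilbertType R).

(* Kernels on a set L are total functions of which only the values on L * L
   matter; boundedness of Gamma x y is part of its type. *)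
Definition cp_kernel (L : set T) (Gamma : T -> T -> bop (Cb R K) (bop Y Y)) : Prop :=
  forall n (x : 'I_n -> T) (a : 'I_n -> Cb R K) (b : 'I_n -> bop Y Y),
    (forall i, L (x i)) ->
    positive_op (\sum_i \sum_j
      adj (b i) \oc Gamma (x i) (x j) (cb_conj (a i) * a j) \oc b j).

Definition star_rep (X : hilbertType R) (mu : Cb R K -> bop X X) : Prop :=
  [/\ forall c a b, mu (c *: a + b) = c *: mu a + mu b,
      mu 1 = id_op X,
      forall a b, mu (a * b) = mu a \oc mu b &
      forall a, mu (cb_conj a) = adj (mu a)].

Definition kolmogorov (L : set T) (Gamma : T -> T -> bop (Cb R K) (bop Y Y))
    (X : hilbertType R) (mu : Cb R K -> bop X X) (h : T -> bop X Y) : Prop :=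
  star_rep mu /\ forall x y, L x -> L y ->
    forall delta, Gamma x y delta = h x \oc mu delta \oc adj (h y).

End Kernels.

Section Interpolation.
Variables (R : realType) (D : test_domain R) (U Y : hilbertType R).
Variables (n : nat) (z : 'I_n -> td_point D).

Local Notation CPsi := (Cb R (td_fun D)).
Local Notation E := (@td_eval R D).

Definition affiliated (f : td_space D -> bop U Y)
    (Gamma : td_point D -> td_point D -> bop CPsi (bop Y Y)) : Prop :=
  exists Delta : td_point D -> td_point D -> bop CPsi (bop Y Y),
    [/\ cp_kernel setT Delta,
        forall x w, id_op Y - f (set_val x) \oc adj (f (set_val w)) =
                    Delta x w (1 - E x * cb_conj (E w)) &
        forall i j, Delta (z i) (z j) = Gamma (z i) (z j)].

Variables (B : 'I_n -> bop U Y).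
Variables (X : hilbertType R) (mu : CPsi -> bop X X) (h : td_point D -> bop X Y).

Definition spaceL1 : csubspace X :=
  closed_span [set x | exists i delta y, x = mu delta (adj (h (z i)) y)].

Definition muL (delta : CPsi) : bop (csub spaceL1) (csub spaceL1) :=
  restr (mu delta) spaceL1.

(* The vectors mu(E(z_i))^* h(z_i)^* y (+) y and h(z_i)^* y (+) B_i^* y: their
   first components lie in spaceL1, hence the detour through [cs_val]. *)
Definition N2_gen (i : 'I_n) (y : Y) (w : dsum (csub spaceL1) Y) : Prop :=
  cs_val w.1 = adj (mu (E (z i))) (adj (h (z i)) y) /\ w.2 = y.

Definition N1_gen (i : 'I_n) (y : Y) (w : dsum (csub spaceL1) U) : Prop :=
  cs_val w.1 = adj (h (z i)) y /\ w.2 = adj (B i) y.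

Definition spaceN2 : csubspace (dsum (csub spaceL1) Y) :=
  closed_span [set w | exists i y, N2_gen i y w].

Definition spaceN1 : csubspace (dsum (csub spaceL1) U) :=
  closed_span [set w | exists i y, N1_gen i y w].

Definition spaceM2 : csubspace (dsum (csub spaceL1) Y) := ocompl spaceN2.
Definition spaceM1 : csubspace (dsum (csub spaceL1) U) := ocompl spaceN1.

Definition unitaryV : bop (csub spaceN2) (csub spaceN1) :=
  xget 0 [set V : bop (csub spaceN2) (csub spaceN1) | unitary V /\
    forall i y w, N2_gen i y (cs_val w) -> N1_gen i y (cs_val (V w))].

(* The identification of (H (+) K) (+) M with H (+) (M (+) K). *)
Definition regroup (H K M : hilbertType R) (w : dsum H K) (m : M) : dsum H (dsum M K) :=
  (w.1, (m, w.2)).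

Local Notation Qdom := (dsum (csub spaceL1) (dsum (csub spaceM1) Y)).
Local Notation Qcod := (dsum (csub spaceL1) (dsum (csub spaceM2) U)).

(* (spaceL1 (+) Y) is the orthogonal sum of spaceN2 and spaceM2, and
   (spaceL1 (+) U) that of spaceN1 and spaceM1, so the condition determines Q. *)
Definition unitaryQ : bop Qdom Qcod :=
  xget 0 [set Q : bop Qdom Qcod |
    forall (n2 : csub spaceN2) (m2 : csub spaceM2) (m1 : csub spaceM1),
      Q (regroup (cs_val n2 + cs_val m2) m1) =
      regroup (cs_val (unitaryV n2) + cs_val m1) m2].

Definition transferG (x : td_point D) : bop (dsum (csub spaceM2) U) (dsum (csub spaceM1) Y) :=
  adj (block22 unitaryQ) +
  adj (block12 unitaryQ)
    \oc op_inv (id_op (csub spaceL1) - muL (E x) \oc adj (block11 unitaryQ))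
    \oc muL (E x) \oc adj (block21 unitaryQ).

End Interpolation.

(* Main.v *)
(* Extend [Gamma] to the completely positive kernel [Delta] of the affiliation, and
   let [k] and [m] be a Kolmogorov decomposition of [Delta] on a Hilbert space [H].
   The lurking isometry argument turns [I - f f^* = Delta (1 - E E^* )] into a
   contraction [A : H (+) Y -> H (+) U] sending [(m(E x)^* k, y)] to [(k, f(x)^* y)]
   for [k = k(1, x, y)].  As [Delta] restricts to [Gamma], the space [L1] embeds
   isometrically in [H], and there [A] coincides with [V] on [N2].  Removing this
   part from [A] leaves a contraction [H (+) M2 -> H (+) M1], whose transfer function
   is [t]; closing the loop between it and [Q] gives back [A], hence [f].

   That [t] is holomorphic and contractive follows from two properties of
   [E : Omega -> C_b(Psi)]: it has norm less than 1 at each point, and it has first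
   order expansions with a quadratic remainder.  Both are explicit for the bidisc
   and the symmetrized bidisc.  For the annulus they must hold uniformly over the
   test functions: the expansion comes from Cauchy's estimate for the derivative,
   and the strict bound propagates from [sqrt q], where all test functions vanish,
   along a chain of points, by a Schwarz-Pick estimate whose step length is
   uniform. *)
Require Import Defs.
From HB Require Import structures.
From mathcomp Require Import all_boot all_order all_algebra.
From mathcomp Require Import all_classical all_reals all_analysis.
From mathcomp.real_closed Require Import complex.
From mathcomp Require Import ring lra.

Set Implicit Arguments.
Unset Strict Implicit.
Unset Printing Implicit Defensive.

Import Order.TTheory GRing.Theory Num.Theory.
Import numFieldNormedType.Exports.

Local Open Scope classical_set_scope.
Local Open Scope ring_scope.

(** * Operators between Hilbert spaces *)

(** Transfer functions are defined through adjoints of blocks of [Q] and a resolvent. Everything is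
    checked on the adjoint side, where [adj G p = o] holds as soon as [Q] sends (F^* h, p) to (h, o)
    for some state h. The formula for f then amounts to splitting one state of [A] into its part in
    L1, a state of [Q], and the rest, a state of the system that defines t.

    The inverse of I - t G11 has to exist at every point although t is only a contraction. It does
    because [Q] has no direct path from M1 to M2: a signal going that way passes through the state
    space and loses a factor less than 1.

    [A] is the lurking isometry extended by zero, hence contractive but in general not unitary; this
    avoids auxiliary defect spaces and keeps M1 and M2 as given.

    For holomorphy, the representation is just a bounded linear map on C_b(Psi), so the derivative
    of E must itself lie in C_b(Psi), that is, depend continuously on the test function. On the
    annulus, where the test functions are not explicit, it arises as a uniform limit of difference
    quotients; hence the need for a remainder bound uniform over Psi. *)

Section InnerMore.
Variables (R : realType) (H : hilbertType R).
Implicit Types x y z : H.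

Lemma inner0r x : inner x 0 = 0.
Proof. by rewrite innerC inner0l rmorph0. Qed.

Lemma innerBr x y z : inner x (y - z) = inner x y - inner x z.
Proof. by rewrite innerDr -scaleN1r innerZr rmorphN rmorph1 mulN1r. Qed.

Lemma inner_ge0 x : 0 <= inner x x.
Proof. by rewrite inner_norm exprn_ge0. Qed.

Lemma inner_eq0 x : inner x x = 0 -> x = 0.
Proof.
by move/eqP; rewrite inner_norm expf_eq0/= normr_eq0 => /eqP.
Qed.

Lemma inner_injr x y : (forall z, inner z x = inner z y) -> x = y.
Proof.
move=> xy; apply/eqP; rewrite -subr_eq0; apply/eqP/inner_eq0.
by rewrite innerBr xy subrr.
Qed.

Lemma inner_suml I (s : seq I) (F : I -> H) y :
  inner (\sum_(i <- s) F i) y = \sum_(i <- s) inner (F i) y.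
Proof.
by elim/big_rec2: _ => [|i u v _ <-]; rewrite ?inner0l ?innerDl.
Qed.

Lemma inner_sumr I (s : seq I) (F : I -> H) y :
  inner y (\sum_(i <- s) F i) = \sum_(i <- s) inner y (F i).
Proof.
by elim/big_rec2: _ => [|i u v _ <-]; rewrite ?inner0r ?innerDr.
Qed.

Lemma norm_le_inner (K : hilbertType R) x (y : K) :
  (`|x| <= `|y|) = (inner x x <= inner y y).
Proof. by rewrite !inner_norm ler_pXn2r ?nnegrE. Qed.

Lemma norm_leM_inner (K : hilbertType R) x (y : K) (M : R[i]) : 0 <= M ->
  (`|x| <= M * `|y|) = (inner x x <= M ^+ 2 * inner y y).
Proof.
by move=> M0; rewrite !inner_norm -exprMn ler_pXn2r ?nnegrE// mulr_ge0.
Qed.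

End InnerMore.

Section Adjoint.
Variable R : realType.
Implicit Types H K L : hilbertType R.

Lemma adjPr H K (T : bop H K) x y : inner x (T y) = inner (adj T x) y.
Proof. by rewrite innerC adjP -innerC. Qed.

Lemma adj_unique H K (T : bop H K) (S : bop K H) :
  (forall x y, inner (T x) y = inner x (S y)) -> adj T = S.
Proof.
by move=> TS; apply: bopE => y; apply: inner_injr => x; rewrite -adjP TS.
Qed.

Lemma adjK H K (T : bop H K) : adj (adj T) = T.
Proof. by apply: adj_unique => x y; rewrite -adjPr. Qed.

Lemma adj_inj H K (S T : bop H K) : adj S = adj T -> S = T.
Proof. by move=> ST; rewrite -[S]adjK ST adjK. Qed.

Lemma adj_comp H K L (S : bop K L) (T : bop H K) : adj (S \oc T) = adj T \oc adj S.
Proof. by apply: adj_unique => x y /=; rewrite !adjP. Qed.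

Lemma adjD H K (S T : bop H K) : adj (S + T) = adj S + adj T.
Proof.
apply: adj_unique => x y.
by change (inner (S x + T x) y = inner x (adj S y + adj T y));
  rewrite innerDl innerDr !adjP.
Qed.

Lemma adjB H K (S T : bop H K) : adj (S - T) = adj S - adj T.
Proof.
apply: adj_unique => x y.
by change (inner (S x - T x) y = inner x (adj S y - adj T y));
  rewrite innerBl innerBr !adjP.
Qed.

Lemma adj_id H : adj (id_op H) = id_op H.
Proof. exact: adj_unique. Qed.

Lemma adj_dinl H K : adj (dinl H K) = dfst H K.
Proof.
apply: adj_unique => x y.
by change (inner x y.1 + inner 0 y.2 = inner x y.1); rewrite inner0l addr0.
Qed.

Lemma adj_dinr H K : adj (dinr H K) = dsnd H K.
Proof.
apply: adj_unique => x y.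
by change (inner 0 y.1 + inner x y.2 = inner x y.2); rewrite inner0l add0r.
Qed.

Lemma adj_dfst H K : adj (dfst H K) = dinl H K.
Proof. by rewrite -adj_dinl adjK. Qed.

Lemma adj_dsnd H K : adj (dsnd H K) = dinr H K.
Proof. by rewrite -adj_dinr adjK. Qed.

(** Cauchy-Schwarz applied to |T^* y|^2 = <y, T (T^* y)>, followed by division by |T^* y|. *)
Lemma adj_bound H K (T : bop H K) (M : R[i]) : 0 <= M ->
  (forall x, `|T x| <= M * `|x|) -> forall y, `|adj T y| <= M * `|y|.
Proof.
move=> M0 TM y; have [->|n0] := eqVneq (adj T y) 0.
  by rewrite normr0 mulr_ge0.
rewrite -(ler_pM2l (x := `|adj T y|)) ?normr_gt0// -expr2 -inner_norm -adjPr.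
have -> : inner y (T (adj T y)) = `|inner y (T (adj T y))|.
  by rewrite ger0_norm// adjPr inner_ge0.
rewrite (le_trans (cauchy_schwarz _ _))//.
apply: (@le_trans _ _ (`|y| * (M * `|adj T y|))); first by rewrite ler_wpM2l.
by rewrite mulrC mulrAC mulrC mulrA.
Qed.

End Adjoint.

Section OpNorm.
Variable R : realType.
Implicit Types V W Z : normedModType R[i].

Lemma bop_norm_le V W (T : bop V W) x : `|T x| <= `|T| * `|x|.
Proof.
have [->|x0] := eqVneq x 0; first by rewrite linear0 !normr0 mulr0.
have [M TM] := bop_bounded T.
have : `|T (`|x|^-1 *: x)| <= `|T|.
  rewrite bop_normE; apply: supnorm_ub.
    exists `|M| => y y1; have h := le_trans (normr_ge0 _) (TM y).
    by rewrite (le_trans (TM y))// -(ger0_norm h) normrM normr_id ler_piMr.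
  by rewrite /unit_ball/= normfZV.
rewrite linearZ/= normrZ normfV normr_id mulrC ler_pdivrMr ?normr_gt0//.
Qed.

Lemma bop_norm_bound V W (T : bop V W) (M : R[i]) : 0 <= M ->
  (forall x, `|T x| <= M * `|x|) -> `|T| <= M.
Proof.
move=> M0 TM; rewrite bop_normE; apply: supnorm_le => // x x1.
by rewrite (le_trans (TM x))// ler_piMr.
Qed.

Lemma comp_norm_le V W Z (S : bop W Z) (T : bop V W) : `|S \oc T| <= `|S| * `|T|.
Proof.
apply: bop_norm_bound => [|x]; first by rewrite mulr_ge0.
by apply: (le_trans (bop_norm_le S (T x))); rewrite -mulrA ler_wpM2l// bop_norm_le.
Qed.

Lemma adj_norm (H K : hilbertType R) (T : bop H K) : `|adj T| = `|T|.
Proof.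
have le (H' K' : hilbertType R) (S : bop H' K') : `|adj S| <= `|S|.
  by apply: bop_norm_bound => //; apply: adj_bound => // x; exact: bop_norm_le.
by apply/eqP; rewrite eq_le le -{1}[T]adjK le.
Qed.

Lemma comp_opA (V W Z Z' : normedModType R[i]) (A : bop Z Z') (B : bop W Z) (C : bop V W) :
  A \oc (B \oc C) = A \oc B \oc C.
Proof. exact: bopE. Qed.

Lemma comp_op1 V W (T : bop V W) : T \oc id_op V = T.
Proof. exact: bopE. Qed.

Lemma comp_1op V W (T : bop V W) : id_op W \oc T = T.
Proof. exact: bopE. Qed.

Lemma comp_opBl V W Z (S S' : bop W Z) (T : bop V W) : (S - S') \oc T = S \oc T - S' \oc T.
Proof. exact: bopE. Qed.

Lemma comp_opBr V W Z (S : bop W Z) (T T' : bop V W) : S \oc (T - T') = S \oc T - S \oc T'.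
Proof. by apply: bopE => x; exact: linearB. Qed.

Lemma op_invP V (T : bop V V) : op_invertible T ->
  op_inv T \oc T = id_op V /\ T \oc op_inv T = id_op V.
Proof.
move=> ex; apply: (@xgetPex _ 0
  [set S : bop V V | comp_op S T = id_op V /\ comp_op T S = id_op V] ex).
Qed.

End OpNorm.

Section RealNorm.
Variable R : realType.

Lemma ReK (x : R[i]) : 0 <= x -> (complex.Re x)%:C%C = x.
Proof. by case: x => a b; rewrite lecE/= => /andP[/eqP->]. Qed.

(** Norms over [R[i]] are complex numbers; the real copy lets [lra], [nra], square roots and real
    suprema work on them. *)
Definition rnorm (V : normedModType R[i]) (x : V) : R := complex.Re `|x|.

Variable V : normedModType R[i].
Implicit Types x y : V.

Lemma rnormE x : (rnorm x)%:C%C = `|x|.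
Proof. exact: ReK. Qed.

Lemma rnorm_ge0 x : 0 <= rnorm x.
Proof. by rewrite -ler0c rnormE. Qed.

Lemma rnormD x y : rnorm (x + y) <= rnorm x + rnorm y.
Proof. by rewrite -lecR rmorphD/= !rnormE ler_normD. Qed.

Lemma rnormN x : rnorm (- x) = rnorm x.
Proof. by rewrite /rnorm normrN. Qed.

Lemma rdistC x y : rnorm (x - y) = rnorm (y - x).
Proof. by rewrite -rnormN opprB. Qed.

Lemma rnorm0 : rnorm (0 : V) = 0.
Proof. by rewrite /rnorm normr0. Qed.

Lemma rnorm0_eq0 x : rnorm x = 0 -> x = 0.
Proof. by move=> x0; apply/normr0_eq0; rewrite -rnormE x0. Qed.

Lemma rnormZ (a : R[i]) x : rnorm (a *: x) = rnorm a * rnorm x.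
Proof. by apply: (@complexI R); rewrite rmorphM/= !rnormE normrZ. Qed.

End RealNorm.

Lemma rnorm_le (R : realType) (V W : normedModType R[i]) (x : V) (y : W) :
  (rnorm x <= rnorm y) = (`|x| <= `|y|).
Proof. by rewrite -lecR !rnormE. Qed.

Lemma ltr0c (R : realType) (k : R) : (0 < k%:C%C) = (0 < k).
Proof. exact: (ltcR 0 k). Qed.

Lemma rnorm_sqr (R : realType) (V : normedModType R[i]) (x : V) :
  (rnorm x ^+ 2)%:C%C = `|x| ^+ 2.
Proof. by rewrite -rnormE rmorphXn. Qed.

Lemma rnorm_inner (R : realType) (H : hilbertType R) (x : H) :
  (rnorm x ^+ 2)%:C%C = inner x x.
Proof. by rewrite inner_norm rnorm_sqr. Qed.

Section Sequences.
Variables (R : realType) (H : completeNormedModType R[i]).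

Lemma rcauchy_limit (u : nat -> H) :
  (forall e : R, 0 < e -> exists N, forall m n, (N <= m)%N -> (N <= n)%N ->
     rnorm (u m - u n) < e) ->
  exists l, forall e : R, 0 < e -> exists N, forall n, (N <= n)%N -> rnorm (l - u n) < e.
Proof.
move=> uc.
have Fc : cauchy (u @ \oo).
  apply: cauchy_exP => e e0.
  have [|N hN] := uc (complex.Re e); first by rewrite -ltr0c ReK// ltW.
  exists (u N); exists N => // n /= Nn.
  by rewrite -ball_normE/= -rnormE -(ReK (ltW e0)) ltcR; exact: hN.
have /cvgrPdist_lt ul : u @ \oo --> lim (u @ \oo) by exact: cauchy_cvg.
exists (lim (u @ \oo)) => e e0.
have [|N _ hN] := ul e%:C%C; first by rewrite ltr0c.
by exists N => n Nn; rewrite -ltcR rnormE; exact: hN.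
Qed.

End Sequences.

(** * Inversion of I - T for a strict contraction T *)

Section Neumann.
Variables (R : realType) (H : hilbertType R).

Lemma expr_small (c e : R) : 0 <= c < 1 -> 0 < e -> exists N, forall n, (N <= n)%N -> c ^+ n < e.
Proof.
move=> /andP[c0 c1] e0.
have /cvgrPdist_lt/(_ e e0)[N _ hN] : (fun n => c ^+ n) @ \oo --> (0 : R).
  by apply: cvg_expr; rewrite ger0_norm.
by exists N => n /hN; rewrite sub0r normrN ger0_norm// exprn_ge0.
Qed.

(** Picard iteration from 0: the iterates stay below |y| / (1 - c), and u (n + k) - u n is T^n (u
    k), so it is at most c^n |u k|. Completeness then gives the fixed point. *)
Lemma contraction_solve (T : bop H H) (c : R) y : 0 <= c < 1 ->
  (forall x, rnorm (T x) <= c * rnorm x) -> exists x, x - T x = y.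
Proof.
move=> /[dup] c01 /andP[c0 c1] Tc.
pose u := fix u n := if n is n'.+1 then y + T (u n') else 0.
have uS n : u n.+1 = y + T (u n) by [].
have b n : (1 - c) * rnorm (u n) <= rnorm y.
  elim: n => [|n IH]; first by rewrite /= rnorm0 mulr0 rnorm_ge0.
  have := rnormD y (T (u n)); rewrite -uS => h.
  have := Tc (u n); have := rnorm_ge0 (u n); nra.
have d n k : rnorm (u (n + k)%N - u n) <= c ^+ n * rnorm (u k).
  elim: n => [|n IH]; first by rewrite add0n expr0 mul1r subr0.
  rewrite addSn !uS opprD addrACA subrr add0r -linearB (le_trans (Tc _))//.
  by rewrite exprS -mulrA ler_wpM2l.
pose M := rnorm y / (1 - c).
have uM n : rnorm (u n) <= M by rewrite ler_pdivlMr ?subr_gt0// mulrC.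
have M0 : 0 <= M := le_trans (rnorm_ge0 _) (uM 0%N).
have [|l hl] := @rcauchy_limit _ _ u.
  move=> e e0; have [|N hN] := @expr_small c (e / 2 / (M + 1)) c01.
    by rewrite !divr_gt0// ltr_wpDl.
  exists N.
  have h n : (N <= n)%N -> rnorm (u n - u N) < e / 2.
    move=> Nn; rewrite -(subnKC Nn); apply: (le_lt_trans (d _ _)).
    have := hN N (leqnn N); rewrite ltr_pdivlMr ?ltr_wpDl//; apply: le_lt_trans.
    by rewrite ler_wpM2l ?exprn_ge0// (le_trans (uM _))// lerDl.
  move=> m n /h hm /h hn; rewrite -(subrKA (u N)).
  by rewrite (le_lt_trans (rnormD _ _))// (splitr e) ltrD// rdistC.
exists l; apply/eqP; rewrite -subr_eq0; apply/eqP/rnorm0_eq0/eqP.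
rewrite eq_le rnorm_ge0 andbT; apply/ler_addgt0Pr => e e0; rewrite add0r.
have [N hN] := hl (e / 2) (divr_gt0 e0 (ltr0Sn _ 1)).
have -> : l - T l - y = (l - u N.+1) - T (l - u N).
  by rewrite uS linearB opprD opprB addrA addrA subrK addrAC.
rewrite (le_trans (rnormD _ _))// rnormN.
have := Tc (l - u N); have := hN N.+1 (leqnSn N); have := hN N (leqnn N).
have := rnorm_ge0 (l - u N); nra.
Qed.

(** The solution of x - T x = y is unique because T shrinks norms, and uniqueness makes the chosen
    solution linear in y. *)
Lemma invertible_1B (T : bop H H) (c : R) : 0 <= c < 1 ->
  (forall x, rnorm (T x) <= c * rnorm x) -> op_invertible (id_op H - T).
Proof.
move=> c01 Tc; have /choice[S hS] y := contraction_solve y c01 Tc.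
have inj x : x - T x = 0 -> x = 0.
  move/eqP; rewrite subr_eq0 => /eqP xT; apply: rnorm0_eq0.
  have := Tc x; rewrite -xT; have := rnorm_ge0 x; case/andP: c01 => ? ?; nra.
have inj2 x y : x - T x = y - T y -> x = y.
  move=> xy; apply/eqP; rewrite -subr_eq0; apply/eqP/inj.
  by rewrite linearB opprD opprK addrACA xy -[X in _ + X]opprK opprD opprK subrr.
have Sb : S \in @bop_pred R H H.
  apply: (@mkbop_subproof _ _ _ _ (1 - c)^-1%:C%C) => [a x y|x].
    by apply: inj2; rewrite hS linearP opprD addrACA -scalerBr !hS.
  rewrite -!rnormE -rmorphM/= lecR mulrC ler_pdivlMr ?subr_gt0; last by case/andP: c01.
  have := hS x; set s := S x => sx.
  have := rnormD x (T s); rewrite -{1}sx subrK => h1.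
  have := Tc s; lra.
exists (Bop Sb); split; apply: bopE => x; last exact: hS.
by apply: inj2; rewrite hS.
Qed.

End Neumann.

(** * Closed spans, total families and orthogonal projections *)

Section Span.
Variables (R : realType) (H : hilbertType R).
Implicit Types (A : set H) (S : csubspace H).

Lemma cs_in S (x : csub S) : cs_set S (cs_val x).
Proof. by have := cs_valP x; rewrite inE. Qed.

Lemma cs_sub (S : csubspace H) x (Sx : cs_set S x) : {y : csub S | cs_val y = x}.
Proof. by exists (CSub (mem_set Sx)). Qed.

Lemma mem_closed_span A a : A a -> cs_set (closed_span A) a.
Proof.
move=> Aa; apply: subset_closure.
by exists 1%N, (fun=> 1), (fun=> a); split=> //; rewrite big_ord1 scale1r.
Qed.

Lemma closed_span_approx A x : cs_set (closed_span A) x ->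
  forall e : R[i], 0 < e -> exists2 a, lin_span A a & `|x - a| < e.
Proof.
move=> Ax e e0; have [a [Aa]] := Ax _ (nbhsx_ballx x e e0).
by rewrite -ball_normE/= => xa; exists a.
Qed.

Lemma closed_span_orth A w : (forall a, A a -> inner a w = 0) ->
  forall x, cs_set (closed_span A) x -> inner x w = 0.
Proof.
move=> Aw x Ax; apply/eqP; rewrite -normr_le0; apply/ler_addgt0Pr => e e0; rewrite add0r.
have w0 : 0 < `|w| + 1 by rewrite ltr_wpDl.
have [|a [n [c [b [Ab ab]]]] xa] := closed_span_approx Ax (e := e / (`|w| + 1)).
  by rewrite divr_gt0.
have aw : inner a w = 0.
  by rewrite ab inner_suml big1// => i _; rewrite innerZl Aw// mulr0.
rewrite -[inner x w]subr0 -aw -innerBl (le_trans (cauchy_schwarz _ _))//.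
rewrite ltr_pdivlMr// in xa; rewrite (le_trans _ (ltW xa))//.
by rewrite ler_wpM2l// lerDl.
Qed.

(** Density of the span in dual form. Through adjoints it makes two bounded operators equal as soon
    as they agree on the family, with no approximation argument. *)
Definition total_family (I : Type) (k : I -> H) := forall x, (forall i, inner (k i) x = 0) -> x = 0.

Lemma total_eq (K : hilbertType R) (I : Type) (k : I -> H) (S T : bop H K) : total_family k ->
  (forall i, S (k i) = T (k i)) -> S = T.
Proof.
move=> kt ST; apply: adj_inj; apply: bopE => y; apply/eqP; rewrite -subr_eq0; apply/eqP.
by apply: kt => i; rewrite innerBr -!adjP ST subrr.
Qed.

Lemma total_closed_span A (T : Type) (k : T -> csub (closed_span A)) :
  (forall a, A a -> exists i, cs_val (k i) = a) ->
  forall x, (forall i, inner (k i) x = 0) -> x = 0.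
Proof.
move=> Ak x kx; apply: inner_eq0.
apply: (@closed_span_orth A (cs_val x)); last exact: cs_in.
by move=> a /Ak[i <-]; exact: kx.
Qed.

End Span.

Section Projection.
Variables (R : realType) (H : hilbertType R) (S : csubspace H).

Lemma cs_incl_subproof : (@cs_val R H S) \in @bop_pred R (csub S) H.
Proof. by apply: (@mkbop_subproof _ _ _ _ 1) => // x; rewrite mul1r csub_norm. Qed.
Definition cs_incl : bop (csub S) H := Bop cs_incl_subproof.

(** As the adjoint of the inclusion, the projection owes its existence to the Riesz theorem behind
    [adj]. *)
Definition orth_proj : bop H (csub S) := adj cs_incl.

Lemma inner_orth_proj x s : inner (orth_proj x) s = inner x (cs_val s).
Proof. by rewrite /orth_proj -adjPr. Qed.

Lemma orth_projK s : orth_proj (cs_val s) = s.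
Proof. by apply: inner_injr => u; rewrite innerC inner_orth_proj [RHS]innerC. Qed.

Lemma sub_orth_proj x : cs_set (ocompl S) (x - cs_val (orth_proj x)).
Proof.
move=> y Sy; have [s <-] := cs_sub Sy; rewrite innerBl -inner_orth_proj.
by apply/eqP; rewrite subr_eq0.
Qed.

Lemma inner_ocompl (s : csub S) (r : csub (ocompl S)) : inner (cs_val s) (cs_val r) = 0.
Proof. by rewrite innerC (cs_in r) ?rmorph0//; exact: cs_in. Qed.

Lemma decomp_ocompl x : exists (s : csub S) (r : csub (ocompl S)), x = cs_val s + cs_val r.
Proof.
have [r rE] := cs_sub (sub_orth_proj x).
by exists (orth_proj x), r; rewrite rE addrC subrK.
Qed.

End Projection.

Section ContractionIsometry.
Variable R : realType.
Implicit Types H K : hilbertType R.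

(* [|A^* A x - x|^2 = |A^* A x|^2 - 2 |A x|^2 + |x|^2] *)
Lemma contraction_isometric H K (A : bop H K) x : (forall x, `|A x| <= `|x|) ->
  `|A x| = `|x| -> adj A (A x) = x.
Proof.
move=> Ac Ax; apply/eqP; rewrite -subr_eq0; apply/eqP/inner_eq0/eqP.
have n : inner (A x) (A x) = inner x x by rewrite !inner_norm Ax.
have e1 : inner (adj A (A x)) x = inner x x by rewrite -adjPr.
have e2 : inner x (adj A (A x)) = inner x x by rewrite -adjP.
rewrite eq_le inner_ge0 andbT innerBl !innerBr e1 e2 subrr subr0 subr_le0.
rewrite -norm_le_inner -Ax -[leRHS]mul1r.
by apply: adj_bound => // y; rewrite mul1r.
Qed.

End ContractionIsometry.

(** * Bounded extension of a map given on a family of vectors *)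

Section Extension.
Variables (R : realType) (H H' : hilbertType R) (I : Type) (k : I -> H) (k' : I -> H').
Variable M : R[i].
Hypothesis M0 : 0 <= M.
Hypothesis kM : forall s : seq (R[i] * I),
  `|\sum_(p <- s) p.1 *: k' p.2| <= M * `|\sum_(p <- s) p.1 *: k p.2|.

(** Closure of the graph of the map sought. The bound [kM] survives the closure, so the second
    projection [P2] is at most M times the first, and [P1] is bounded below on the graph. *)
Let graph := closed_span [set w : dsum H H' | exists i, w = (k i, k' i)].

Let graph_bound w : cs_set graph w -> `|w.2| <= M * `|w.1|.
Proof.
move=> gw; apply/ler_addgt0Pr => e e0.
have M1 : 0 < M + 1 by rewrite ltr_wpDl.
have [|a [n [c [b [Ab ab]]]] wa] := closed_span_approx gw (e := e / (M + 1)).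
  by rewrite divr_gt0.
have la : `|a.2| <= M * `|a.1|.
  have /choice[i iE] := Ab.
  have := kM [seq (c j, i j) | j <- index_enum 'I_n].
  rewrite !big_map/= ab.
  have -> : \sum_j c j *: b j = (\sum_j c j *: k (i j), \sum_j c j *: k' (i j)) :> dsum H H'.
    by elim/big_rec3: _ => // j x y _ _ ->; rewrite iE.
  exact.
have w1 : `|a.1 - w.1| <= `|w - a|.
  by rewrite distrC; exact: (dsum_norm1 (w - a)).
have w2 : `|w.2 - a.2| <= `|w - a| by exact: (dsum_norm2 (w - a)).
have -> : w.2 = a.2 + (w.2 - a.2) by rewrite addrC subrK.
rewrite (le_trans (ler_normD _ _))//.
apply: (@le_trans _ _ (M * (`|w.1| + `|w - a|) + `|w - a|)).
  apply: lerD => //; apply: (le_trans la); apply: ler_wpM2l => //.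
  have -> : a.1 = w.1 + (a.1 - w.1) by rewrite addrC subrK.
  by rewrite (le_trans (ler_normD _ _))// lerD2l.
rewrite mulrDr -addrA lerD2l -{2}[`|w - a|]mul1r -mulrDl.
by rewrite mulrC -ler_pdivlMr// ltW.
Qed.

Let P1 : bop (csub graph) H := dfst H H' \oc cs_incl graph.
Let P2 : bop (csub graph) H' := dsnd H H' \oc cs_incl graph.

Let P1norm g : `|P1 g| <= `|g|.
Proof. by rewrite csub_norm; exact: dsum_norm1. Qed.

Let P2norm g : `|P2 g| <= M * `|P1 g|.
Proof. by apply: graph_bound; exact: cs_in. Qed.

Let Pnorm g : inner g g <= (1 + M ^+ 2) * inner (P1 g) (P1 g).
Proof.
have -> : inner g g = inner (P1 g) (P1 g) + inner (P2 g) (P2 g) by [].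
by rewrite mulrDl mul1r lerD2l -norm_leM_inner.
Qed.

Let inv : op_invertible (adj P1 \oc P1).
Proof.
pose T := id_op _ - adj P1 \oc P1.
have -> : adj P1 \oc P1 = id_op _ - T by rewrite /T opprB addrC subrK.
(* [d] is a lower bound of P1^* P1, and |T g|^2 = |g|^2 - 2 |P1 g|^2 + |P1^* P1 g|^2 <= |g|^2 - |P1
   g|^2 <= (1 - d) |g|^2. Hence T contracts by the square root of 1 - d. *)
pose d := (1 + M ^+ 2)^-1.
have M2 : 1 <= 1 + M ^+ 2 by rewrite lerDl exprn_ge0.
have M20 : 0 < 1 + M ^+ 2 := lt_le_trans ltr01 M2.
have d0 : 0 < d by rewrite invr_gt0.
have d1 : d <= 1 by rewrite invf_le1.
have Tb g : inner (T g) (T g) <= (1 - d) * inner g g.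
  change (inner (g - adj P1 (P1 g)) (g - adj P1 (P1 g)) <= (1 - d) * inner g g).
  have e1 : inner g (adj P1 (P1 g)) = inner (P1 g) (P1 g) by rewrite -adjP.
  have e2 : inner (adj P1 (P1 g)) g = inner (P1 g) (P1 g) by rewrite -adjPr.
  rewrite innerBl !innerBr e1 e2.
  have h1 : inner (adj P1 (P1 g)) (adj P1 (P1 g)) <= inner (P1 g) (P1 g).
    rewrite -norm_le_inner -[leRHS]mul1r; apply: adj_bound => // x.
    by rewrite mul1r.
  have h2 : d * inner g g <= inner (P1 g) (P1 g).
    by rewrite mulrC ler_pdivrMr// mulrC.
  by rewrite mulrBl mul1r -addrA lerD2l -opprD lerN2 (le_trans h2)// lerDl subr_ge0.
have dR : (complex.Re d)%:C%C = d by apply: ReK; exact: ltW.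
apply: (@invertible_1B _ _ _ (Num.sqrt (1 - complex.Re d))).
  rewrite sqrtr_ge0/= -[ltRHS]sqrtr1 ltr_sqrt ?ltr01// ltrBlDr ltrDl -ltr0c.
  by rewrite dR.
move=> g; rewrite -(@ler_pXn2r _ 2) ?nnegrE ?mulr_ge0 ?rnorm_ge0 ?sqrtr_ge0//.
rewrite exprMn sqr_sqrtr; last by rewrite subr_ge0 -lecR dR.
rewrite -lecR; apply: (le_trans _ (_ : ((1 - complex.Re d)%:C * (rnorm g ^+ 2)%:C)%C <= _)); last by rewrite -rmorphM.
by rewrite !rnorm_inner rmorphB/= dR; exact: Tb.
Qed.

(* The extension is the map [x |-> P2 g], where [g] is the point of the graph
   whose first component is nearest to [x]. *)
Lemma extend_bounded : exists T : bop H H',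
  (forall i, T (k i) = k' i) /\ forall x, `|T x| <= M * `|x|.
Proof.
have [l r] := op_invP inv.
exists (P2 \oc op_inv (adj P1 \oc P1) \oc adj P1); split=> [i|x].
  have [|g gE] := @cs_sub _ _ graph (k i, k' i); first by apply: mem_closed_span; exists i.
  have -> : k i = P1 g by rewrite /P1/= gE.
  have -> : k' i = P2 g by rewrite /P2/= gE.
  exact: (congr1 (fun S : bop _ _ => P2 (S g)) l).
set g := op_inv (adj P1 \oc P1) (adj P1 x).
change (`|P2 g| <= M * `|x|); apply: (le_trans (P2norm g)); rewrite ler_wpM2l//.
have gx : adj P1 (P1 g) = adj P1 x by exact: (congr1 (fun S : bop _ _ => S (adj P1 x)) r).
have [->|g0] := eqVneq (P1 g) 0; first by rewrite normr0.
rewrite -(ler_pM2l (x := `|P1 g|)) ?normr_gt0// -expr2 -inner_norm adjP gx -adjP.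
rewrite (le_trans (real_ler_norm _))//; last exact: cauchy_schwarz.
by rewrite adjP -gx -adjP inner_norm realX// ger0_real.
Qed.

End Extension.

(** * Kolmogorov decompositions *)

Section Limits.
Variables (R : realType) (V : normedModType R[i]).
Implicit Types (a b : nat -> V) (l m : V).

Definition scvg a l :=
  forall e : R, 0 < e -> exists N, forall n, (N <= n)%N -> rnorm (l - a n) < e.

Lemma scvg_cst l : scvg (fun=> l) l.
Proof. by move=> e e0; exists 0%N => n _; rewrite subrr rnorm0. Qed.

Lemma scvgD a b l m : scvg a l -> scvg b m -> scvg (fun n => a n + b n) (l + m).
Proof.
move=> al bm e e0.
have [N hN] := al _ (divr_gt0 e0 (ltr0Sn _ 1)); have [M hM] := bm _ (divr_gt0 e0 (ltr0Sn _ 1)).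
exists (maxn N M) => n; rewrite geq_max => /andP[/hN h1 /hM h2].
by rewrite opprD addrACA (le_lt_trans (rnormD _ _))// (splitr e) ltrD.
Qed.

Lemma scvgZ a l (c : R[i]) : scvg a l -> scvg (fun n => c *: a n) (c *: l).
Proof.
move=> al e e0; have c0 : 0 < rnorm c + 1 by rewrite ltr_wpDl ?rnorm_ge0.
have [N hN] := al _ (divr_gt0 e0 c0).
exists N => n /hN h; rewrite -scalerBr rnormZ.
rewrite ltr_pdivlMr// in h; apply: le_lt_trans h; rewrite mulrC ler_wpM2l ?rnorm_ge0//.
by rewrite lerDl.
Qed.

Lemma scvg_unique a l m : scvg a l -> scvg a m -> l = m.
Proof.
move=> al am; apply/eqP; rewrite -subr_eq0; apply/eqP/rnorm0_eq0/eqP.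
rewrite eq_le rnorm_ge0 andbT; apply/ler_addgt0Pr => e e0; rewrite add0r.
have [N hN] := al _ (divr_gt0 e0 (ltr0Sn _ 1)); have [M hM] := am _ (divr_gt0 e0 (ltr0Sn _ 1)).
have := hN (maxn N M) (leq_maxl _ _); have := hM (maxn N M) (leq_maxr _ _).
rewrite -(subrKA (a (maxn N M))) => h1 h2.
by rewrite (le_trans (rnormD _ _))// (splitr e) lerD// ltW// rdistC.
Qed.

End Limits.

Lemma scvg_conj (R : realType) (a : nat -> R[i]) l : scvg a l -> scvg (fun n => (a n)^*) (l^*).
Proof.
move=> al e e0; have [N hN] := al e e0; exists N => n /hN; rewrite -rmorphB.
by rewrite /rnorm norm_conjC.
Qed.

Lemma scvg_ge0 (R : realType) (a : nat -> R[i]) l : scvg a l -> (forall n, 0 <= a n) -> 0 <= l.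
Proof.
move=> al a0.
have : l^* = l.
  have := scvg_conj al; rewrite (_ : (fun n => _) = a); last by apply/funext => n; exact: geC0_conj.
  by move=> alc; exact: scvg_unique alc al.
move=> /eqP; rewrite -CrealE => lr.
suff : 0 <= complex.Re l.
  move: lr; case: (l) => x y; rewrite lecE realE/= !lecE/=.
  by move=> /orP[] /andP[/eqP]; rewrite ?eqxx => // ->; rewrite eqxx.
rewrite leNgt; apply/negP => l0.
have [|N hN] := al (- complex.Re l); first by rewrite oppr_gt0.
have := hN N (leqnn N); have := a0 N; rewrite lecE => /andP[_ aN].
rewrite /= in aN; apply/negP; rewrite -leNgt.
have := normc_ge_Re (l - a N); rewrite -rnormE lecR; apply: le_trans.
have -> : complex.Re (l - a N) = complex.Re l - complex.Re (a N) by rewrite raddfB.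
rewrite ler0_norm ?opprB; lra.
Qed.

Record psd_kernel (R : realType) (I : Type) := PsdKernel {
  psd_fun :> I -> I -> R[i];
  psdP : forall s : seq (R[i] * I),
    0 <= \sum_(p <- s) \sum_(r <- s) p.1 * r.1^* * psd_fun p.2 r.2
}.

(** * The form of a positive semidefinite kernel and its Cauchy sequences *)

Section PsdForm.
Variables (R : realType) (I : Type) (K : psd_kernel R I).
Implicit Types (s t : seq (R[i] * I)).

(** Finitely supported combinations are lists of weighted points, with repetitions and without a
    quotient, because lists are only compared through this form. *)
Definition psd_form s t : R[i] := \sum_(p <- s) \sum_(r <- t) p.1 * r.1^* * K p.2 r.2.
Local Notation form := psd_form.

Definition comb_scale (a : R[i]) s := [seq (a * p.1, p.2) | p <- s].

Lemma form_catl s t u : form (s ++ t) u = form s u + form t u.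
Proof. by rewrite /form big_cat. Qed.

Lemma form_catr s t u : form u (s ++ t) = form u s + form u t.
Proof. by rewrite /form -big_split/=; apply: eq_bigr => p _; rewrite big_cat. Qed.

Lemma form_scalel a s t : form (comb_scale a s) t = a * form s t.
Proof.
rewrite /form big_map mulr_sumr; apply: eq_bigr => p _.
by rewrite mulr_sumr; apply: eq_bigr => r _ /=; rewrite !mulrA.
Qed.

Lemma form_scaler a s t : form s (comb_scale a t) = a^* * form s t.
Proof.
rewrite /form mulr_sumr; apply: eq_bigr => p _.
rewrite big_map mulr_sumr; apply: eq_bigr => r _ /=.
by rewrite rmorphM/= !mulrA; congr (_ * _ * _); rewrite mulrC.
Qed.

Let form_ge0 s : 0 <= form s s := psdP K s.

(** Hermitian symmetry follows from nonnegativity by polarization: the form is real on s + a t, and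
    the cases a = 1 and a = i suffice. *)
Lemma psd_formC s t : form t s = (form s t)^*.
Proof.
have h a : (a^* * form s t + a * form t s)^* = a^* * form s t + a * form t s.
  apply: conj_Creal.
  have -> : a^* * form s t + a * form t s =
      form (s ++ comb_scale a t) (s ++ comb_scale a t) - (form s s + `|a| ^+ 2 * form t t).
    rewrite !form_catl !form_catr !form_scalel !form_scaler normCK; ring.
  by rewrite rpredB ?rpredD ?ger0_real// mulr_ge0 ?exprn_ge0.
have e1 := h 1; have e2 := h 'i; move: e1 e2.
rewrite rmorph1 !mul1r conjCi !rmorphD 2!rmorphM/= [(- 'i)^*]rmorphN/= conjCi opprK.
set x := form s t; set y := form t s => e1 e2.
have {}e2 : 'i * (x^* - y^* + x - y) = 0.
  have -> : 'i * (x^* - y^* + x - y) = ('i * x^* + - 'i * y^*) - (- 'i * x + 'i * y) by ring.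
  by rewrite e2 subrr.
have {}e3 : x^* - y^* + x - y = 0.
  by apply/eqP; move/eqP: e2; rewrite mulf_eq0 (negPf (neq0Ci _)).
have e4 : 2 * (y - x^*) = 0.
  have -> : 2 * (y - x^*) = - (x^* - y^* + x - y) - (x^* + y^* - (x + y)) by ring.
  by rewrite e3 e1 subrr oppr0 addr0.
apply/eqP; rewrite -subr_eq0; move/eqP: e4; rewrite mulf_eq0 pnatr_eq0//.
Qed.

Lemma form_cauchy_schwarz s t : `|form s t| ^+ 2 <= form s s * form t t.
Proof.
have h (l : R[i]) : l \is Num.real ->
    0 <= form s s - 2 * l * `|form s t| ^+ 2 + l ^+ 2 * `|form s t| ^+ 2 * form t t.
  move=> lr; have lc := conj_Creal lr.
  have := form_ge0 (s ++ comb_scale (- (l * form s t)) t).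
  rewrite !form_catl !form_catr !form_scalel !form_scaler (psd_formC s t) normCK.
  have E (x y a b : R[i]) : a + - (l * y) * x + (- (l * x) * y + - (l * x) * (- (l * y) * b)) =
      a - 2 * l * (x * y) + l ^+ 2 * (x * y) * b by ring.
  by rewrite rmorphN rmorphM/= lc E.
have s0 := form_ge0 s; have t0 := form_ge0 t; have n0 : 0 <= `|form s t| ^+ 2 by rewrite exprn_ge0.
have [tt0|tt0] := eqVneq (form t t) 0.
  have [->|st0] := eqVneq (`|form s t| ^+ 2) 0; first by rewrite mulr_ge0.
  (* When [form t t] vanishes, the bound [h] is affine in l; this l gives it the value -1, a
     contradiction. *)
  have := h ((form s s + 1) / (2 * `|form s t| ^+ 2)).
  rewrite tt0 mulr0 addr0.
  have E (a N : R[i]) : N != 0 -> a - 2 * ((a + 1) / (2 * N)) * N = -1 by move=> N0; field.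
  rewrite E//.
  rewrite realM ?ger0_real ?invr_ge0 ?mulr_ge0// ?addr_ge0//.
  by rewrite oppr_ge0 ler10 => /(_ isT).
have := h (form t t)^-1; rewrite ger0_real ?invr_ge0// => /(_ isT).
have E (a b N : R[i]) : N != 0 -> a - 2 * N^-1 * b + N^-1 ^+ 2 * b * N = a - b / N.
  by move=> N0; field.
rewrite E//.
by rewrite subr_ge0 ler_pdivrMr// lt_def tt0.
Qed.

Definition snorm s : R := Num.sqrt (complex.Re (form s s)).

Lemma snorm_ge0 s : 0 <= snorm s.
Proof. exact: sqrtr_ge0. Qed.

Lemma snormK s : (snorm s ^+ 2)%:C%C = form s s.
Proof. by rewrite sqr_sqrtr ?ReK// -ler0c ReK. Qed.

Lemma form_le s t : rnorm (form s t) <= snorm s * snorm t.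
Proof.
rewrite -(@ler_pXn2r _ 2) ?nnegrE ?rnorm_ge0 ?mulr_ge0 ?snorm_ge0//.
rewrite -lecR exprMn [leRHS]rmorphM/= !snormK rnorm_sqr; exact: form_cauchy_schwarz.
Qed.

Lemma snormD s t : snorm (s ++ t) <= snorm s + snorm t.
Proof.
rewrite -(@ler_pXn2r _ 2) ?nnegrE ?addr_ge0 ?snorm_ge0// sqrrD.
rewrite -lecR mulr2n !rmorphD/= !snormK form_catl !form_catr (psd_formC s t).
rewrite addrA lerD2r -addrA lerD2l.
rewrite (le_trans (real_ler_norm _))//.
  by rewrite CrealE rmorphD/= conjCK addrC.
by rewrite (le_trans (ler_normD _ _))// norm_conjC lerD// -rnormE lecR form_le.
Qed.

Lemma snorm_scale a s : snorm (comb_scale a s) = rnorm a * snorm s.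
Proof.
apply/eqP; rewrite -(@eqrXn2 _ 2) ?mulr_ge0 ?snorm_ge0 ?rnorm_ge0//; apply/eqP.
apply: (@complexI R); rewrite snormK form_scalel form_scaler exprMn rmorphM/= !snormK.
by rewrite rnorm_sqr normCK mulrA.
Qed.

Definition comb_diff s t := s ++ comb_scale (-1) t.

Lemma form_diffl s t u : form (comb_diff s t) u = form s u - form t u.
Proof. by rewrite form_catl form_scalel mulN1r. Qed.

Lemma form_diffr s t u : form u (comb_diff s t) = form u s - form u t.
Proof. by rewrite form_catr form_scaler rmorphN rmorph1 mulN1r. Qed.

(** [phi i] is the inner product of the limit of the Cauchy sequence [u] with the kernel vector at
    i: the limit is recorded as a function instead of an equivalence class. *)
Definition rep (u : nat -> seq (R[i] * I)) (phi : I -> R[i]) :=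
  (forall e : R, 0 < e -> exists N, forall m n, (N <= m)%N -> (N <= n)%N ->
     snorm (comb_diff (u m) (u n)) < e) /\
  (forall i, scvg (fun n => form (u n) [:: (1, i)]) (phi i)).

Lemma rep_bounded u phi : rep u phi -> exists M, exists N, forall n, (N <= n)%N -> snorm (u n) <= M.
Proof.
move=> [/(_ 1 ltr01)[N hN] _]; exists (1 + snorm (u N)), N => n Nn.
have := ltW (hN n N Nn (leqnn N)).
pose w := comb_diff (u n) (u N) ++ u N.
have -> : snorm (u n) = snorm w.
  congr (Num.sqrt (complex.Re _)).
  by rewrite /w !form_catl !form_catr !form_scalel !form_scaler rmorphN rmorph1; ring.
move=> h; apply: (le_trans (snormD _ _)); by rewrite lerD2r.
Qed.

Lemma rep_form_cvg u phi w psi : rep u phi -> rep w psi ->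
  exists l, scvg (fun n => form (u n) (w n)) l.
Proof.
move=> ru rw; have [M [N hM]] := rep_bounded ru; have [M' [N' hM']] := rep_bounded rw.
have M0 : 0 <= M := le_trans (snorm_ge0 _) (hM N (leqnn N)).
have M0' : 0 <= M' := le_trans (snorm_ge0 _) (hM' N' (leqnn N')).
apply: rcauchy_limit => e e0.
pose d := e / (M + M' + 1).
have D0 : 0 < M + M' + 1 by rewrite ltr_wpDl ?addr_ge0.
have d0 : 0 < d by rewrite divr_gt0.
have [N1 h1] := ru.1 d d0; have [N2 h2] := rw.1 d d0.
exists (maxn (maxn N N') (maxn N1 N2)) => m n.
rewrite !geq_max => /andP[/andP[mN mN'] /andP[mN1 mN2]] /andP[/andP[nN nN'] /andP[nN1 nN2]].
have -> : form (u m) (w m) - form (u n) (w n) =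
    form (comb_diff (u m) (u n)) (w m) + form (u n) (comb_diff (w m) (w n)).
  by rewrite form_diffl form_diffr; ring.
apply: (le_lt_trans (rnormD _ _)).
have := form_le (comb_diff (u m) (u n)) (w m); have := form_le (u n) (comb_diff (w m) (w n)).
have := h1 m n mN1 nN1; have := h2 m n mN2 nN2; have := hM n nN; have := hM' m mN'.
have eE : d * (M + M' + 1) = e by rewrite divfK// gt_eqF.
have := snorm_ge0 (u n); have := snorm_ge0 (w m).
have := snorm_ge0 (comb_diff (u m) (u n)); have := snorm_ge0 (comb_diff (w m) (w n)).
move: (snorm _) (snorm _) (snorm _) (snorm _) (rnorm _) (rnorm _) => a b c f x y.
move=> a0 b0 c0 f0 cM fM ad bd yle xle.
have := ler_pM f0 a0 fM (ltW ad); have := ler_pM b0 c0 (ltW bd) cM.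
lra.
Qed.

Lemma rep0_form_pt u s : rep u (fun=> 0) -> scvg (fun n => form (u n) s) 0.
Proof.
move=> ru; elim: s => [|[c i] s IH].
  rewrite (_ : (fun _ => _) = fun=> 0); first exact: scvg_cst.
  by apply/funext => n; rewrite /form big1// => p _; rewrite big_nil.
rewrite (_ : (fun _ => _) = fun n => c^* *: form (u n) [:: (1, i)] + form (u n) s).
  rewrite -[0]addr0; apply: scvgD => //.
  by have := scvgZ (c^*) (ru.2 i); rewrite scaler0.
apply/funext => n; rewrite -[in LHS]cat1s form_catr; congr (_ + _).
by rewrite -[_ *: _]form_scaler /comb_scale/= mulr1.
Qed.

(** Freezing w at a late index leaves a fixed finite combination, on which pointwise convergence of
    u suffices; the error is small because u is bounded in the seminorm. This is what makes the
    limit form depend on the represented functions alone. *)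
Lemma rep0_form u w psi : rep u (fun=> 0) -> rep w psi -> scvg (fun n => form (u n) (w n)) 0.
Proof.
move=> ru rw e e0; have [M [N hM]] := rep_bounded ru.
have M0 : 0 <= M := le_trans (snorm_ge0 _) (hM N (leqnn N)).
have D0 : 0 < M + 1 by rewrite ltr_wpDl.
have [N1 h1] := rw.1 (e / 2 / (M + 1)) (divr_gt0 (divr_gt0 e0 (ltr0Sn _ 1)) D0).
have [N2 h2] := rep0_form_pt (w N1) ru (divr_gt0 e0 (ltr0Sn _ 1)).
exists (maxn N (maxn N1 N2)) => n; rewrite !geq_max => /andP[nN /andP[nN1 nN2]].
have -> : 0 - form (u n) (w n) = (0 - form (u n) (w N1)) - form (u n) (comb_diff (w n) (w N1)).
  by rewrite form_diffr; ring.
apply: (le_lt_trans (rnormD _ _)); rewrite rnormN (splitr e) ltr_leD ?h2//.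
apply: (le_trans (form_le _ _)).
have := h1 n N1 nN1 (leqnn _); rewrite ltr_pdivlMr// => /ltW; apply: le_trans.
rewrite mulrC ler_wpM2l ?snorm_ge0//.
by rewrite (le_trans (hM n nN))// lerDl.
Qed.

Lemma repD u phi v psi : rep u phi -> rep v psi -> rep (fun n => u n ++ v n) (fun i => phi i + psi i).
Proof.
move=> ru rv; split; last first.
  move=> i; rewrite (_ : (fun _ => _) = fun n => form (u n) [:: (1, i)] + form (v n) [:: (1, i)]).
    by apply: scvgD; [exact: ru.2|exact: rv.2].
  by apply/funext => n; rewrite form_catl.
move=> e e0; have [N hN] := ru.1 _ (divr_gt0 e0 (ltr0Sn _ 1)).
have [M hM] := rv.1 _ (divr_gt0 e0 (ltr0Sn _ 1)).
exists (maxn N M) => m n; rewrite !geq_max => /andP[mN mM] /andP[nN nM].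
rewrite (splitr e); apply: le_lt_trans (ltrD (hN _ _ mN nN) (hM _ _ mM nM)).
apply: le_trans (snormD _ _); rewrite le_eqVlt; apply/orP; left; apply/eqP.
by congr (Num.sqrt (complex.Re _)); rewrite /comb_diff !(form_catl, form_catr, form_scalel, form_scaler) ?rmorphN ?rmorph1; ring.
Qed.

Lemma repZ a u phi : rep u phi -> rep (fun n => comb_scale a (u n)) (fun i => a * phi i).
Proof.
move=> ru; split; last first.
  move=> i; rewrite (_ : (fun _ => _) = fun n => a *: form (u n) [:: (1, i)]).
    by apply: scvgZ; exact: ru.2.
  by apply/funext => n; rewrite form_scalel.
move=> e e0; have a0 : 0 < rnorm a + 1 by rewrite ltr_wpDl ?rnorm_ge0.
have [N hN] := ru.1 _ (divr_gt0 e0 a0); exists N => m n mN nN.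
have -> : snorm (comb_diff (comb_scale a (u m)) (comb_scale a (u n))) = snorm (comb_scale a (comb_diff (u m) (u n))).
  congr (Num.sqrt (complex.Re _)).
  by rewrite /comb_diff !(form_catl, form_catr, form_scalel, form_scaler) ?rmorphN ?rmorph1; ring.
have := hN m n mN nN; rewrite ltr_pdivlMr// snorm_scale; apply: le_lt_trans.
by rewrite mulrC ler_wpM2l ?snorm_ge0// lerDl.
Qed.

Lemma rep_cst s : rep (fun=> s) (fun i => form s [:: (1, i)]).
Proof.
split=> [e e0|i]; last exact: scvg_cst.
exists 0%N => m n _ _; rewrite (_ : snorm _ = 0)//.
by rewrite /snorm form_diffl !form_diffr subrr sqrtr0.
Qed.

Definition limform (phi psi : I -> R[i]) : R[i] :=
  xget 0 [set l | forall u w, rep u phi -> rep w psi -> scvg (fun n => form (u n) (w n)) l].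

Lemma limformP u phi w psi : rep u phi -> rep w psi ->
  scvg (fun n => form (u n) (w n)) (limform phi psi).
Proof.
move=> ru rw; have [l ul] := rep_form_cvg ru rw.
suff ex : exists l, forall u w, rep u phi -> rep w psi -> scvg (fun n => form (u n) (w n)) l.
  exact: (@xgetPex _ 0 [set l | forall u w, rep u phi -> rep w psi ->
    scvg (fun n => form (u n) (w n)) l] ex).
exists l => u' w' ru' rw'.
have r0 (v v' : nat -> _) chi : rep v chi -> rep v' chi -> rep (fun n => comb_diff (v n) (v' n)) (fun=> 0).
  move=> rv rv'; have := repD rv (repZ (-1) rv').
  by congr rep; apply/funext => i; rewrite mulN1r subrr.
have h1 := rep0_form (r0 _ _ _ ru' ru) rw'.
have h2 := scvg_conj (rep0_form (r0 _ _ _ rw' rw) ru).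
rewrite rmorph0 in h2.
have := scvgD (scvgD h1 h2) ul; rewrite !add0r; congr scvg; apply/funext => n.
by rewrite -psd_formC form_diffl form_diffr; ring.
Qed.

End PsdForm.

(** * The reproducing kernel Hilbert space *)

Section RKHS.
Variables (R : realType) (I : Type) (K : psd_kernel R I).
Local Notation form := (psd_form K).

(* The completion of the finitely supported functions under the form of [K],
   realised as the functions represented by Cauchy sequences of them. *)
Definition rkhs_pred : {pred I -> R[i]} := fun phi => `[< exists u, rep K u phi >].

Let rkhs_submod : submod_closed rkhs_pred.
Proof.
split.
  apply/asboolP; exists (fun=> [::]).
  have := rep_cst K [::]; congr rep; apply/funext => i.
  by rewrite /psd_form big_nil.
move=> /= a phi psi /asboolP[u ru] /asboolP[v rv]; apply/asboolP.
by exists (fun n => comb_scale a (u n) ++ v n); exact: repD (repZ a ru) rv.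
Qed.
HB.instance Definition _ := GRing.isSubmodClosed.Build R[i] (I -> R[i]) rkhs_pred rkhs_submod.

Record rkhs : Type := Rkhs { rkhs_val : I -> R[i]; rkhs_valP : rkhs_val \in rkhs_pred }.
HB.instance Definition _ := [isSub for rkhs_val].
HB.instance Definition _ := [Choice of rkhs by <:].
HB.instance Definition _ := [SubChoice_isSubLmodule of rkhs by <:].

Lemma rkhs_rep (x : rkhs) : exists u, rep K u (rkhs_val x).
Proof. by have /asboolP := rkhs_valP x. Qed.

Let rinner (x y : rkhs) : R[i] := limform K (rkhs_val x) (rkhs_val y).

Let rinnerDl x y z : rinner (x + y) z = rinner x z + rinner y z.
Proof.
have [u ru] := rkhs_rep x; have [v rv] := rkhs_rep y; have [w rw] := rkhs_rep z.
apply: scvg_unique (limformP (repD ru rv) rw) _.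
have := scvgD (limformP ru rw) (limformP rv rw); congr scvg.
by apply/funext => n; rewrite form_catl.
Qed.

Let rinnerZl a x z : rinner (a *: x) z = a * rinner x z.
Proof.
have [u ru] := rkhs_rep x; have [w rw] := rkhs_rep z.
apply: scvg_unique (limformP (repZ a ru) rw) _.
have := scvgZ a (limformP ru rw); congr scvg.
by apply/funext => n; rewrite form_scalel.
Qed.

Let rinnerC x y : rinner y x = (rinner x y)^*.
Proof.
have [u ru] := rkhs_rep x; have [w rw] := rkhs_rep y.
apply: scvg_unique (limformP rw ru) _.
have := scvg_conj (limformP ru rw); congr scvg.
by apply/funext => n; rewrite -psd_formC.
Qed.

Let rinner_gt0 x : x != 0 -> 0 < rinner x x.
Proof.
move=> x0; have [u ru] := rkhs_rep x; have uu := limformP ru ru.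
rewrite lt_def (scvg_ge0 uu) ?andbT; last by move=> n; exact: psdP.
apply: contra x0 => /eqP xx0; apply/eqP/val_inj/funext => i.
change (rkhs_val x i = 0).
apply: scvg_unique (ru.2 i) _ => e e0.
pose M := snorm K [:: (1, i)] + 1.
have M0 : 0 < M by rewrite ltr_wpDl ?snorm_ge0.
have [|N hN] := uu ((e / M) ^+ 2); first by rewrite exprn_gt0// divr_gt0.
exists N => n /hN; rewrite -/(rinner x x) xx0 !sub0r !rnormN.
rewrite (_ : rnorm (form (u n) (u n)) = snorm K (u n) ^+ 2); last first.
  apply: (@complexI R); rewrite rnormE snormK ger0_norm//; exact: psdP.
rewrite ltr_pXn2r ?nnegrE ?snorm_ge0 ?divr_ge0 ?ltW//.
rewrite ltr_pdivlMr// => h; apply: le_lt_trans h.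
by rewrite (le_trans (form_le _ _ _))// ler_wpM2l ?snorm_ge0// lerDl.
Qed.

HB.instance Definition _ :=
  Lmodule_isPreHilbert.Build R rkhs rinnerDl rinnerZl rinnerC rinner_gt0.

Let emb_subproof s : (fun i => form s [:: (1, i)]) \in rkhs_pred.
Proof. by apply/asboolP; exists (fun=> s); exact: rep_cst. Qed.
Definition rkhs_emb s : rkhs := Rkhs (emb_subproof s).

Lemma inner_emb s t : inner (rkhs_emb s) (rkhs_emb t) = form s t.
Proof. exact: scvg_unique (limformP (rep_cst K s) (rep_cst K t)) (scvg_cst _). Qed.

Lemma emb_diff s t : rkhs_emb (comb_diff s t) = rkhs_emb s - rkhs_emb t.
Proof. by apply/val_inj/funext => i; exact: form_diffl. Qed.

Lemma rnorm_emb s : rnorm (rkhs_emb s) = snorm K s.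
Proof.
apply/eqP; rewrite -(@eqrXn2 _ 2) ?rnorm_ge0 ?snorm_ge0//; apply/eqP.
by apply: (@complexI R); rewrite rnorm_sqr -inner_norm inner_emb snormK.
Qed.

(** The squared norm of x minus the n-th term is a limit over m of squared seminorms of [u m] minus
    [u n]. The Cauchy property bounds these, and [scvg_ge0] passes the bound to the limit. *)
Lemma rep_emb_cvg u (x : rkhs) : rep K u (rkhs_val x) -> scvg (fun n => rkhs_emb (u n)) x.
Proof.
move=> ru e e0; have [N hN] := ru.1 (e / 2) (divr_gt0 e0 (ltr0Sn _ 1)).
exists N => n Nn.
have rd : rep K (fun m => comb_diff (u m) (u n)) (rkhs_val (x - rkhs_emb (u n))).
  have := repD ru (repZ (-1) (rep_cst K (u n))); congr rep; apply/funext => i.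
  by rewrite mulN1r.
have lim := limformP rd rd.
have : 0 <= ((e / 2) ^+ 2)%:C%C - inner (x - rkhs_emb (u n)) (x - rkhs_emb (u n)).
  pose a m := ((e / 2) ^+ 2)%:C%C - form (comb_diff (u (m + N)%N) (u n)) (comb_diff (u (m + N)%N) (u n)).
  apply: (@scvg_ge0 _ a) => [|m].
    apply: scvgD; first exact: scvg_cst.
    have := scvgZ (-1) lim; rewrite !scaleN1r => h d d0; have [M hM] := h d d0.
    exists M => m Mm; have := hM (m + N)%N (leq_trans Mm (leq_addr _ _)).
    by rewrite scaleN1r.
  rewrite subr_ge0 -snormK lecR ler_pXn2r ?nnegrE ?snorm_ge0 ?divr_ge0 ?ltW//.
  by apply: hN; rewrite ?leq_addl.
rewrite subr_ge0 inner_norm -rnorm_sqr lecR ler_pXn2r ?nnegrE ?rnorm_ge0 ?divr_ge0 ?(ltW e0)//.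
by move/le_lt_trans; apply; rewrite ltr_pdivrMr// ltr_pMr// ltr1n.
Qed.

Lemma rkhs_approx (x : rkhs) (e : R) : 0 < e -> exists s, rnorm (x - rkhs_emb s) < e.
Proof.
move=> e0; have [u ru] := rkhs_rep x; have [N hN] := rep_emb_cvg ru e0.
by exists (u N); exact: hN.
Qed.

Let inv_small (e : R) : 0 < e -> exists N, forall n, (N <= n)%N -> n.+1%:R^-1 < e.
Proof.
move=> e0; have /cvgrPdist_lt/(_ e e0)[N _ hN] := @cvg_harmonic R.
exists N => n /hN; rewrite sub0r normrN ger0_norm ?invr_ge0//.
Qed.

Let rkhs_complete (F : set_system rkhs) : ProperFilter F -> cauchy F -> cvg F.
Proof.
move=> FF /cauchyP Fc.
have pos n : 0 < (n.+1%:R^-1 : R)%:C%C by rewrite ltr0c invr_gt0.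
(* Diagonal choice: [x n] is the centre of a ball of radius 1 / (n + 1) belonging to F, and [s n]
   below is a finite combination that close to it. The sequence [s] is Cauchy and represents the
   limit. *)
have /choice[x hx] n := Fc _ (pos n).
have pos' n : 0 < n.+1%:R^-1 :> R by rewrite invr_gt0.
have /choice[s hs] n := rkhs_approx (x n) (pos' n).
have ball_lt (y z : rkhs) (d : R) : ball y d%:C%C z -> rnorm (y - z) < d.
  by rewrite -ball_normE/= -rnormE ltcR.
have dx m n : rnorm (x m - x n) < m.+1%:R^-1 + n.+1%:R^-1.
  have [y [/ball_lt ym /ball_lt yn]] := filter_ex (filterI (hx m) (hx n)).
  rewrite -(subrKA y) (le_lt_trans (rnormD _ _))// ltrD// rdistC//.
have ds m n : rnorm (rkhs_emb (s m) - rkhs_emb (s n)) < 2 * m.+1%:R^-1 + 2 * n.+1%:R^-1.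
  rewrite -(subrKA (x m)) -[X in _ + X](subrKA (x n)).
  have := rnormD (rkhs_emb (s m) - x m) (x m - x n + (x n - rkhs_emb (s n))).
  have := rnormD (x m - x n) (x n - rkhs_emb (s n)).
  have := dx m n; have := hs n; have := hs m; rewrite rdistC.
  by move: (m.+1%:R^-1) (n.+1%:R^-1) => p q; lra.
have small (e : R) : 0 < e -> exists N, forall m n, (N <= m)%N -> (N <= n)%N ->
    snorm K (comb_diff (s m) (s n)) < e.
  move=> e0; have [|N hN] := inv_small (e := e / 4); first by rewrite divr_gt0.
  exists N => m n /hN hm /hN hn; rewrite -rnorm_emb emb_diff.
  by move: (ds m n) hm hn; move: (m.+1%:R^-1) (n.+1%:R^-1) => p q; lra.
have pt i : exists l, scvg (fun n => form (s n) [:: (1, i)]) l.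
  apply: rcauchy_limit => e e0.
  pose M := snorm K [:: (1, i)] + 1.
  have M0 : 0 < M by rewrite ltr_wpDl ?snorm_ge0.
  have [|N hN] := small (e / M); first by rewrite divr_gt0.
  exists N => m n mN nN; rewrite -form_diffl.
  have := hN m n mN nN; rewrite ltr_pdivlMr// => h; apply: le_lt_trans h.
  by rewrite (le_trans (form_le _ _ _))// ler_wpM2l ?snorm_ge0// lerDl.
have /choice[phi hphi] := pt.
have rphi : rep K s phi by [].
have Pphi : phi \in rkhs_pred by apply/asboolP; exists s.
have sphi : scvg (fun n => rkhs_emb (s n)) (Rkhs Pphi) by exact: rep_emb_cvg.
apply/cvg_ex; exists (Rkhs Pphi); apply/cvgrPdist_lt => e e0.
pose d := complex.Re e.
have d0 : 0 < d by rewrite -ltr0c ReK// ltW.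
have [|N hN] := inv_small (e := d / 3); first by rewrite divr_gt0.
have [|M hM] := sphi (d / 3); first by rewrite divr_gt0.
pose n := maxn N M.
apply: filterS (hx n) => y /ball_lt xy.
rewrite -rnormE -(ReK (ltW e0)) ltcR -/d.
rewrite -(subrKA (rkhs_emb (s n))) -[X in _ + X](subrKA (x n)).
have := rnormD (Rkhs Pphi - rkhs_emb (s n)) (rkhs_emb (s n) - x n + (x n - y)).
have := rnormD (rkhs_emb (s n) - x n) (x n - y).
have := hs n; have := hN n (leq_maxl _ _); have := hM n (leq_maxr _ _); rewrite [rnorm (x n - _)]rdistC.
by move: xy; move: (n.+1%:R^-1) => p; lra.
Qed.

HB.instance Definition _ := Uniform_isComplete.Build rkhs rkhs_complete.

End RKHS.

(** Restricting to the closed span of the kernel vectors makes them total by construction. *)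
Lemma psd_kernel_factorization (R : realType) (I : Type) (K : psd_kernel R I) :
  exists (H : hilbertType R) (k : I -> H),
    total_family k /\ forall i j, inner (k i) (k j) = K i j.
Proof.
pose H := rkhs K : hilbertType R; pose k i : H := rkhs_emb K [:: (1, i)].
have kE i j : inner (k i) (k j) = K i j.
  by rewrite inner_emb /psd_form !big_seq1 rmorph1 !mul1r.
pose A := [set x | exists i, x = k i].
have Ak i : cs_set (closed_span A) (k i) by apply: mem_closed_span; exists i.
exists (csub (closed_span A)), (fun i => CSub (mem_set (Ak i))); split; last exact: kE.
by apply: total_closed_span => _ [i ->]; exists i.
Qed.

(** * From completely positive kernels to representations of C_b *)

Section CbMore.
Variables (R : realType) (K : topologicalType).
Implicit Types (a b d : Cb R K).

Lemma cb_eqP a b : (forall x, a x = b x) -> a = b.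
Proof. by move=> ab; apply/val_inj/funext. Qed.

Lemma cb_norm_ub a x : `|a x| <= `|a|.
Proof. by apply: supnorm_ub => //; exact: cb_bounded. Qed.

Lemma cb_norm_le a (M : R[i]) : 0 <= M -> (forall x, `|a x| <= M) -> `|a| <= M.
Proof. by move=> M0 aM; apply: supnorm_le. Qed.

Lemma cb_conjK a : cb_conj (cb_conj a) = a.
Proof. by apply: cb_eqP => x; exact: conjCK. Qed.

Lemma cb_conjM a b : cb_conj (a * b) = cb_conj a * cb_conj b.
Proof. by apply: cb_eqP => x; exact: rmorphM. Qed.

Lemma cb_conj1 : cb_conj 1 = 1 :> Cb R K.
Proof. by apply: cb_eqP => x; exact: rmorph1. Qed.

Lemma continuous_real_complex : continuous (fun x : R => x%:C%C).
Proof.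
move=> x; apply/cvgrPdist_lt => e e0.
have d0 : 0 < complex.Re e by rewrite -ltr0c ReK// ltW.
have /cvgrPdist_lt/(_ _ d0) : (fun y : R => y) @ x --> x by exact: cvg_id.
apply: filterS => y; rewrite -ltcR (ReK (ltW e0)); apply: le_lt_trans.
by rewrite -rmorphB/= normc_def/= expr0n/= addr0 sqrtr_sqr.
Qed.

Lemma continuous_rnorm (V : normedModType R[i]) : continuous (fun x : V => rnorm x).
Proof.
move=> x; apply/cvgrPdist_lt => e e0.
have e0' : 0 < e%:C%C by rewrite ltr0c.
have /cvgrPdist_lt/(_ _ e0') : (fun y : V => y) @ x --> x by exact: cvg_id.
apply: filterS => y; rewrite -rnormE ltcR; apply: le_lt_trans.
have := rnormD (x - y) y; have := rnormD (y - x) x; rewrite !subrK [rnorm (y - x)]rdistC.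
by rewrite ler_norml => *; apply/andP; split; lra.
Qed.

(** The nonnegative function |d|^2 - |d(x)|^2 has a continuous square root. Inserted in a positive
    form, it shows that multiplication by d acts with norm at most |d|. *)
Lemma cb_defect d : exists g : Cb R K, cb_conj g * g = (`|d| ^+ 2) *: (1 : Cb R K) - cb_conj d * d.
Proof.
pose g x := (Num.sqrt (rnorm d ^+ 2 - rnorm (d x) ^+ 2))%:C%C : R[i].
have d2 x : 0 <= rnorm d ^+ 2 - rnorm (d x) ^+ 2.
  by rewrite subr_ge0 ler_pXn2r ?nnegrE ?rnorm_ge0// rnorm_le cb_norm_ub.
have gP : g \in @cb_pred R K.
  apply/asboolP; split.
    move=> x; apply: (@continuous_comp _ _ _ (fun x => Num.sqrt (rnorm d ^+ 2 - rnorm (d x) ^+ 2))).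
      apply: (@continuous_comp _ _ _ (fun x => rnorm d ^+ 2 - rnorm (d x) ^+ 2)); last first.
        exact: sqrt_continuous.
      apply: cvgB; first exact: cvg_cst.
      apply: (@cvgM _ _ _ _ (fun x => rnorm (d x)) (fun x => rnorm (d x)));
        by apply: (@continuous_comp _ _ _ d); [exact: cb_continuous|exact: continuous_rnorm].
    exact: continuous_real_complex.
  exists `|d| => x _; rewrite /g ger0_norm ?ler0c ?sqrtr_ge0// -rnormE lecR.
  rewrite -(@ler_pXn2r _ 2) ?nnegrE ?rnorm_ge0 ?sqrtr_ge0// sqr_sqrtr//.
  by rewrite gerBl exprn_ge0// rnorm_ge0.
exists (mkCb gP); apply: cb_eqP => x.
change ((g x)^* * g x = `|d| ^+ 2 * 1 - (d x)^* * d x).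
rewrite mulr1 [_^* * d x]mulrC -normCK -!rnorm_sqr -rmorphB/=.
rewrite geC0_conj ?ler0c ?sqrtr_ge0// -rmorphM/= -expr2 sqr_sqrtr//.
Qed.

End CbMore.

Section RankOne.
Variables (R : realType) (H : hilbertType R).

(** [cp_kernel] tests positivity against operators on Y, a Gram kernel against vectors of Y.
    Operators sending one fixed v to prescribed vectors pass from the first to the second. *)
Lemma rank_one (v w : H) : v != 0 -> exists T : bop H H, T v = w.
Proof.
move=> v0; have vv : inner v v != 0 by rewrite inner_norm expf_eq0/= normr_eq0.
pose T x := (inner x v / inner v v) *: w.
have Tb : T \in @bop_pred R H H.
  apply: (@mkbop_subproof _ _ _ _ (`|v| / `|inner v v| * `|w|)) => [a x y|x].
    by rewrite /T innerDl innerZl mulrDl scalerDl -mulrA scalerA.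
  rewrite /T normrZ normrM normfV [leRHS]mulrAC ler_wpM2r// [leRHS]mulrAC ler_wpM2r ?invr_ge0//.
  by rewrite mulrC cauchy_schwarz.
by exists (Bop Tb); rewrite /= /T divff// scale1r.
Qed.

End RankOne.

Section Kolmogorov.
Variables (R : realType) (T : Type) (K : topologicalType) (Y : hilbertType R).
Variable D : T -> T -> bop (Cb R K) (bop Y Y).
Hypothesis cpD : cp_kernel setT D.
Local Notation J := (Cb R K * T * Y)%type.

(** The vector indexed by (a, x, y) stands for mu(a) h(x)^* y; hence the reversed order of the two
    points and the conjugate on the second index. *)
Let ker (i j : J) : R[i] := inner (D j.1.2 i.1.2 (cb_conj j.1.1 * i.1.1) i.2) j.2.

Let ker_psd (s : seq (R[i] * J)) :
  0 <= \sum_(p <- s) \sum_(r <- s) p.1 * r.1^* * ker p.2 r.2.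
Proof.
(* With Y = 0 there is no v to test against, but then the kernel vanishes. *)
have [[v v0]|triv] := pselect (exists v : Y, v != 0); last first.
  rewrite big1// => p _; rewrite big1// => r _.
  rewrite /ker; have -> : r.2.2 = 0 by apply: contrapT => r0; apply: triv; exists r.2.2; apply/eqP.
  by rewrite inner0r mulr0.
case: s => [|p0 s']; first by rewrite big_nil.
set s := p0 :: s'.
pose p (i : 'I_(size s)) := nth p0 s i.
have /choice[b bE] (i : 'I_(size s)) := rank_one ((p i).1 *: (p i).2.2) v0.
have sumE n (F : 'I_n -> bop Y Y) x : (\sum_j F j) x = \sum_j F j x.
  by elim/big_rec2: _ => // j u w _ <-.
have := cpD (n := size s) (x := fun i => (p i).2.1.2) (fun i => (p i).2.1.1) b (fun=> I) v.
rewrite sumE inner_suml [X in _ -> 0 <= X]exchange_big/= [X in _ -> 0 <= X](big_nth p0) big_mkord.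
congr (0 <= _); apply: eq_bigr => i _.
rewrite sumE inner_suml (big_nth p0) big_mkord; apply: eq_bigr => j _.
have -> : inner ((adj (b i) \oc D (p i).2.1.2 (p j).2.1.2 (cb_conj (p i).2.1.1 * (p j).2.1.1) \oc b j) v) v =
   inner (D (p i).2.1.2 (p j).2.1.2 (cb_conj (p i).2.1.1 * (p j).2.1.1) (b j v)) (b i v) by rewrite -adjPr.
by rewrite !bE linearZ/= innerZl innerZr mulrA.
Qed.

Lemma cp_kernel_kolmogorov : exists (H : hilbertType R) (k : J -> H) (mu : Cb R K -> bop H H),
  [/\ total_family k,
      forall i j, inner (k i) (k j) = inner (D j.1.2 i.1.2 (cb_conj j.1.1 * i.1.1) i.2) j.2,
      forall d i, mu d (k i) = k (d * i.1.1, i.1.2, i.2),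
      forall d, `|mu d| <= `|d| &
      forall (c : R[i]) d e, mu (c *: d + e) = c *: mu d + mu e] /\
  forall d, mu (cb_conj d) = adj (mu d).
Proof.
have [H [k [kt kk]]] := psd_kernel_factorization (PsdKernel ker_psd).
pose act d i : J := (d * i.1.1, i.1.2, i.2).
(* [F e s] is <mu(e) xi, xi> for the combination xi given by s. It is linear in e, so its
   nonnegativity at g^* g, with g from [cb_defect], says that |mu(d) xi| <= |d| |xi|. *)
pose F e (s : seq (R[i] * J)) := \sum_(p <- s) \sum_(r <- s)
  p.1 * r.1^* * inner (D r.2.1.2 p.2.1.2 (cb_conj r.2.1.1 * (e * p.2.1.1)) p.2.2) r.2.2.
have FE d s : inner (\sum_(p <- s) p.1 *: k (act d p.2)) (\sum_(p <- s) p.1 *: k (act d p.2)) =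
    F (cb_conj d * d) s.
  rewrite inner_suml; apply: eq_bigr => p _; rewrite inner_sumr; apply: eq_bigr => r _.
  rewrite innerZl innerZr kk /= /ker /= [LHS]mulrA; congr (_ * inner (D _ _ _ _) _).
  by rewrite cb_conjM; move: (cb_conj _) (cb_conj _) => u v; ring.
have act1 i : act 1 i = i by case: i => -[a x] y; rewrite /act/= mul1r.
have bound d s : `|\sum_(p <- s) p.1 *: k (act d p.2)| <= `|d| * `|\sum_(p <- s) p.1 *: k p.2|.
  rewrite norm_leM_inner//.
  have -> : \sum_(p <- s) p.1 *: k p.2 = \sum_(p <- s) p.1 *: k (act 1 p.2).
    by apply: eq_bigr => p _; rewrite act1.
  have [g gE] := cb_defect d.
  rewrite !FE -subr_ge0.
  have : 0 <= F (cb_conj g * g) s by rewrite -FE inner_ge0.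
  rewrite gE; congr (0 <= _).
  rewrite /F mulr_sumr -sumrB; apply: eq_bigr => p _.
  rewrite mulr_sumr -sumrB; apply: eq_bigr => r _.
  rewrite [in LHS]mulrBl [in LHS]mulrBr.
  have -> : cb_conj r.2.1.1 * ((`|d| ^+ 2) *: (1 : Cb R K) * p.2.1.1) =
      (`|d| ^+ 2) *: (cb_conj r.2.1.1 * (cb_conj 1 * 1 * p.2.1.1)).
    rewrite cb_conj1; apply: cb_eqP => x.
    change ((r.2.1.1 x)^* * (`|d| ^+ 2 * 1 * p.2.1.1 x) = `|d| ^+ 2 * ((r.2.1.1 x)^* * (1 * 1 * p.2.1.1 x))).
    by ring.
  rewrite linearB linearZ.
  set U := D _ _ (cb_conj _ * (cb_conj 1 * _ * _)); set W := D _ _ _.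
  change (p.1 * (r.1)^* * inner (`|d| ^+ 2 *: U p.2.2 - W p.2.2) r.2.2 =
    `|d| ^+ 2 * (p.1 * (r.1)^* * inner (U p.2.2) r.2.2) - p.1 * (r.1)^* * inner (W p.2.2) r.2.2).
  by rewrite innerBl innerZl; ring.
have /choice[mu hmu] d := @extend_bounded _ H H J k (fun i => k (act d i)) _ (normr_ge0 d) (bound d).
have muE d i : mu d (k i) = k (act d i) by have [h _] := hmu d.
have kI x y : (forall j, inner (k j) x = inner (k j) y) -> x = y.
  move=> xy; apply/eqP; rewrite -subr_eq0; apply/eqP/kt => j.
  by rewrite innerBr xy subrr.
exists H, k, mu; split; last first.
  move=> d; apply: (total_eq kt) => i; apply: kI => j.
  rewrite -adjP !muE !kk /= /ker /=; congr (inner (D _ _ _ _) _).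
  by rewrite cb_conjM cb_conjK; move: (cb_conj _) => u; ring.
split; [exact: kt|exact: kk|by move=> d i; rewrite muE| |].
  by move=> d; apply: bop_norm_bound => // x; have [_] := hmu d.
move=> c d e; apply: (total_eq kt) => i.
change (mu (c *: d + e) (k i) = c *: mu d (k i) + mu e (k i)); rewrite !muE.
apply: kI => j; rewrite innerC [RHS]innerC; congr (_^*).
rewrite innerDl innerZl !kk /= /ker /=.
have -> : cb_conj j.1.1 * ((c *: d + e) * i.1.1) =
    c *: (cb_conj j.1.1 * (d * i.1.1)) + cb_conj j.1.1 * (e * i.1.1).
  apply: cb_eqP => x.
  change ((j.1.1 x)^* * ((c * d x + e x) * i.1.1 x) =
    c * ((j.1.1 x)^* * (d x * i.1.1 x)) + (j.1.1 x)^* * (e x * i.1.1 x)).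
  by ring.
rewrite linearP -innerZl -innerDl; congr (inner _ _).
Qed.

End Kolmogorov.

(** * Transfer functions *)

Lemma comp_opE (R : realType) (V W Z : normedModType R[i]) (S : bop W Z) (T : bop V W) x :
  (S \oc T) x = S (T x).
Proof. by []. Qed.

Section DsumMore.
Variables (R : realType).
Implicit Types H K : hilbertType R.

Lemma dsum_eta H K (w : dsum H K) : w = (w.1, w.2).
Proof. by case: w. Qed.

Lemma dsum_rnorm H K (w : dsum H K) : rnorm w ^+ 2 = rnorm w.1 ^+ 2 + rnorm w.2 ^+ 2.
Proof. by apply: (@complexI R); rewrite rmorphD/= !rnorm_sqr dsum_normE. Qed.

Lemma dsum_split H K (x : H) (y : K) : ((x, y) : dsum H K) = (x, 0) + (0, y).
Proof. by change (((x, y) : dsum H K) = (x + 0, 0 + y)); rewrite addr0 add0r. Qed.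

(** The operator S (+) I, with the identity of L. *)
Definition ampl H K (L : hilbertType R) (S : bop H K) : bop (dsum H L) (dsum K L) :=
  dinl K L \oc S \oc dfst H L + dinr K L \oc dsnd H L.

Lemma amplE H K (L : hilbertType R) (S : bop H K) (w : dsum H L) : ampl L S w = (S w.1, w.2).
Proof. by rewrite [RHS]dsum_split. Qed.

Lemma adj_ampl H K (L : hilbertType R) (S : bop H K) : adj (ampl L S) = ampl L (adj S).
Proof. by rewrite adjD !adj_comp adj_dinl adj_dinr adj_dfst adj_dsnd comp_opA. Qed.

Variables H1 H2 K1 K2 : hilbertType R.
Variable T : bop (dsum H1 H2) (dsum K1 K2).

Lemma blockE1 x y : (T (x, y)).1 = block11 T x + block12 T y.
Proof. by rewrite dsum_split linearD. Qed.

Lemma blockE2 x y : (T (x, y)).2 = block21 T x + block22 T y.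
Proof. by rewrite dsum_split linearD. Qed.

Lemma adj_blockE1 x y : (adj T (x, y)).1 = adj (block11 T) x + adj (block21 T) y.
Proof.
rewrite /block11 /block21 !adj_comp adj_dinl adj_dfst adj_dsnd.
by rewrite dsum_split linearD.
Qed.

Lemma adj_blockE2 x y : (adj T (x, y)).2 = adj (block12 T) x + adj (block22 T) y.
Proof.
rewrite /block12 /block22 !adj_comp adj_dinr adj_dfst adj_dsnd.
by rewrite dsum_split linearD.
Qed.

Lemma block11_le x : `|block11 T x| <= `|T (x, 0)|.
Proof. exact: dsum_norm1. Qed.

End DsumMore.

Lemma adj_rbound (R : realType) (H K : hilbertType R) (T : bop H K) (c : R) : 0 <= c ->
  (forall x, rnorm (T x) <= c * rnorm x) -> forall y, rnorm (adj T y) <= c * rnorm y.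
Proof.
move=> c0 Tc y; rewrite -lecR rmorphM/= !rnormE; apply: adj_bound.
  by rewrite ler0c.
by move=> x; rewrite -!rnormE -rmorphM/= lecR.
Qed.

(** * Contractive transfer functions and their state equation *)

Section Transfer.
Variables (R : realType) (H P O : hilbertType R).
Variables (Q : bop (dsum H P) (dsum H O)) (F : bop H H).

Definition transfer : bop O P :=
  adj (block22 Q) + adj (block12 Q) \oc op_inv (id_op H - F \oc adj (block11 Q))
    \oc F \oc adj (block21 Q).

Hypothesis Qc : forall w, `|Q w| <= `|w|.
Variable c : R.
Hypothesis c01 : 0 <= c < 1.
Hypothesis Fc : forall x, rnorm (F x) <= c * rnorm x.

Let c0 : 0 <= c. Proof. by case/andP: c01. Qed.

Let b11_le x : rnorm (block11 Q x) <= rnorm x.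
Proof.
rewrite rnorm_le; apply: (le_trans (block11_le Q x)); apply: (le_trans (Qc _)).
by rewrite (le_trans (dsum_norm_le _))//= normr0 addr0.
Qed.

Let adj_b11_le x : rnorm (adj (block11 Q) x) <= rnorm x.
Proof. by rewrite -[leRHS]mul1r; apply: adj_rbound => // y; rewrite mul1r. Qed.

Lemma transfer_invertible : op_invertible (id_op H - F \oc adj (block11 Q)).
Proof.
apply: (invertible_1B c01) => x; apply: (le_trans (Fc _)).
by rewrite ler_wpM2l.
Qed.

(** Taking adjoints turns the formula into a system, with state equation h = Q11 F^* h + Q12 p and
    output o = Q21 F^* h + Q22 p. Values can then be read off a state without computing the
    resolvent. *)
Lemma transfer_adj h p o : Q (adj F h, p) = (h, o) -> adj transfer p = o.
Proof.
move=> Qh; have [l r] := op_invP transfer_invertible.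
apply: inner_injr => o'; rewrite -adjP.
set g := op_inv (id_op H - F \oc adj (block11 Q)) (F (adj (block21 Q) o')).
have gE : g - F (adj (block11 Q) g) = F (adj (block21 Q) o').
  exact: (congr1 (fun S : bop _ _ => S (F (adj (block21 Q) o'))) r).
change (inner (adj (block22 Q) o' + adj (block12 Q) g) p = inner o' o).
have e1 := congr1 fst Qh; have e2 := congr1 snd Qh; rewrite /= in e1 e2.
rewrite blockE1 in e1; rewrite blockE2 in e2.
rewrite -e2 innerDr innerDl -!adjPr addrC; congr (_ + _).
rewrite -[block12 Q p](addKr (block11 Q (adj F h))) e1 addrC innerBr.
rewrite adjPr -adjP; rewrite [in RHS]adjPr -adjP -gE innerBl; congr (_ - _).
Qed.

Lemma transfer_state p : exists h o, Q (adj F h, p) = (h, o).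
Proof.
have Tc x : rnorm ((block11 Q \oc adj F) x) <= c * rnorm x.
  by apply: (le_trans (b11_le _)); apply: adj_rbound.
have [h hE] := contraction_solve (block12 Q p) c01 Tc.
exists h, (Q (adj F h, p)).2; rewrite [LHS]dsum_eta blockE1 -hE.
by rewrite addrC subrK.
Qed.

(** Energy balance: |h|^2 + |o|^2 <= |F^* h|^2 + |p|^2 because [Q] contracts, and |F^* h| <= |h|. *)
Lemma transfer_le1 : `|transfer| <= 1.
Proof.
rewrite -adj_norm; apply: bop_norm_bound => // p; rewrite mul1r.
have [h [q hq]] := transfer_state p; rewrite (transfer_adj hq) -rnorm_le.
have := Qc (adj F h, p); rewrite hq -rnorm_le -(@ler_pXn2r _ 2) ?nnegrE ?rnorm_ge0//.
rewrite !dsum_rnorm/= => le1.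
have le2 : rnorm (adj F h) <= c * rnorm h by exact: adj_rbound.
rewrite -(@ler_pXn2r _ 2) ?nnegrE ?rnorm_ge0//.
have : rnorm (adj F h) ^+ 2 <= rnorm h ^+ 2.
  rewrite ler_pXn2r ?nnegrE ?rnorm_ge0//; apply: (le_trans le2).
  by rewrite ler_piMl ?rnorm_ge0// ltW//; case/andP: c01.
lra.
Qed.

End Transfer.

Lemma adj_lft (R : realType) (H1 H2 H3 H4 : hilbertType R) (D : bop H1 H4)
    (C : bop H3 H4) (S : bop H3 H3) (t : bop H2 H3) (B : bop H1 H2) y :
  adj (D + C \oc S \oc t \oc B) y = adj D y + adj B (adj t (adj S (adj C y))).
Proof. by rewrite adjD !adj_comp. Qed.

Lemma adj_inv_solve (R : realType) (H K : hilbertType R) (t : bop H K) (g : bop K H) m b :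
  op_invertible (id_op K - t \oc g) -> m = adj g (adj t m) + b ->
  adj (op_inv (id_op K - t \oc g)) b = m.
Proof.
move=> /op_invP[_ r] mE.
have -> : b = adj (id_op K - t \oc g) m.
  rewrite adjB adj_id adj_comp.
  change (b = m - adj g (adj t m)).
  by rewrite {1}mE addrC addKr.
by rewrite -comp_opE -adj_comp r adj_id.
Qed.

(** The counterpart of [transfer_adj] for the outer loop: m2 solves m2 = G11^* t^* m2 + G21^* y, so
    the adjoint of the inverse is evaluated at a vector where the answer is known. *)
Lemma lft_formula (R : realType) (U Y M1 M2 : hilbertType R)
    (G : bop (dsum M2 U) (dsum M1 Y)) (t : bop M1 M2) (f : bop U Y) :
  op_invertible (id_op M2 - t \oc block11 G) ->
  (forall y, exists m1 m2, adj G (m1, y) = (m2, adj f y) /\ adj t m2 = m1) ->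
  f = block22 G + block21 G \oc op_inv (id_op M2 - t \oc block11 G) \oc t \oc block12 G.
Proof.
move=> Ti h; apply: adj_inj; apply: bopE => y; have [m1 [m2 [GE tE]]] := h y.
have := congr1 fst GE; rewrite adj_blockE1 => m2E.
have := congr1 snd GE; rewrite adj_blockE2 -[RHS]/(adj f y) => yE.
have mE : m2 = adj (block11 G) (adj t m2) + adj (block21 G) y by rewrite tE m2E.
by rewrite adj_lft (adj_inv_solve Ti mE) tE addrC -yE.
Qed.

Lemma pythagoras (R : realType) (H : hilbertType R) (x y : H) : inner x y = 0 ->
  `|x + y| ^+ 2 = `|x| ^+ 2 + `|y| ^+ 2.
Proof.
move=> xy; have yx : inner y x = 0 by rewrite innerC xy rmorph0.
by rewrite -!inner_norm innerDl !innerDr xy yx addr0 add0r.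
Qed.

Lemma regroup_norm (R : realType) (H K M : hilbertType R) (w : dsum H K) (m : M) :
  `|regroup w m| ^+ 2 = `|w| ^+ 2 + `|m| ^+ 2.
Proof.
rewrite -!inner_norm.
change (inner w.1 w.1 + (inner m m + inner w.2 w.2) = inner w.1 w.1 + inner w.2 w.2 + inner m m).
by rewrite addrA addrAC.
Qed.

(** H is the orthogonal sum of N and M, given by isometric embeddings: the feedback argument then
    runs over arbitrary Hilbert spaces instead of subspaces of direct sums. *)
Definition orth_sum (R : realType) (H N M : hilbertType R) (s : bop N H) (j : bop M H) :=
  [/\ forall x y, inner (s x) (s y) = inner x y, forall x y, inner (j x) (j y) = inner x y,
      forall x y, inner (s x) (j y) = 0 & forall w, exists x y, w = s x + j y].

Section OrthSum.
Variables (R : realType) (H N M : hilbertType R) (s : bop N H) (j : bop M H).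
Hypothesis sj : orth_sum s j.

Lemma orth_sum_norm x y : `|s x + j y| ^+ 2 = `|x| ^+ 2 + `|y| ^+ 2.
Proof.
by have [ss jj o _] := sj; rewrite pythagoras// -!inner_norm ss jj.
Qed.

Lemma orth_sum_adjK y : adj j (j y) = y.
Proof. by have [_ jj _ _] := sj; apply: inner_injr => x; rewrite -adjP jj. Qed.

Lemma orth_sum_adj_le w : `|adj j w| <= `|w|.
Proof.
have [_ _ o d] := sj; have [x [y ->]] := d w.
have -> : adj j (s x + j y) = y.
  rewrite linearD/= orth_sum_adjK (_ : adj j (s x) = 0) ?add0r//.
  by apply: inner_injr => u; rewrite inner0r -adjP innerC o rmorph0.
by rewrite -(@ler_pXn2r _ 2) ?nnegrE// orth_sum_norm lerDr exprn_ge0.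
Qed.

Lemma orth_sum_range w : (forall x, inner w (s x) = 0) -> exists y, w = j y.
Proof.
have [ss _ o d] := sj; have [x [y ->]] := d w => /(_ x).
rewrite innerDl ss innerC (_ : inner (j y) (s x) = 0); last by rewrite innerC o rmorph0.
rewrite addr0 => x0; exists y; have -> : x = 0 by apply: inner_eq0; rewrite innerC.
by rewrite linear0 add0r.
Qed.

End OrthSum.

(** * Closing the loop between Q and the rest of A *)

Section Feedback.
Variables (R : realType) (L Y U H N2 N1 M2 M1 : hilbertType R).
Variables (s2 : bop N2 (dsum L Y)) (j2 : bop M2 (dsum L Y)) (sj2 : orth_sum s2 j2).
Variables (s1 : bop N1 (dsum L U)) (j1 : bop M1 (dsum L U)) (sj1 : orth_sum s1 j1).
Variables (V : bop N2 N1) (Vu : unitary V).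
Variable Q : bop (dsum L (dsum M1 Y)) (dsum L (dsum M2 U)).
Hypothesis QE : forall n2 m2 m1,
  Q (regroup (s2 n2 + j2 m2) m1) = regroup (s1 (V n2) + j1 m1) m2.
Variables (i : bop L H) (iK : adj i \oc i = id_op L).
Variable A : bop (dsum H Y) (dsum H U).
Hypothesis Ac : forall w, `|A w| <= `|w|.
Hypothesis AE : forall n2, A (ampl Y i (s2 n2)) = ampl U i (s1 (V n2)).

Let sj2_dec w : exists x y, w = s2 x + j2 y.
Proof. by case: sj2. Qed.

Let iKx x : adj i (i x) = x.
Proof. exact: (congr1 (fun S : bop _ _ => S x) iK). Qed.

Let i_inner x y : inner (i x) (i y) = inner x y.
Proof. by rewrite adjP iKx. Qed.

Let i_norm x : `|i x| = `|x|.
Proof. by apply/eqP; rewrite -(@eqrXn2 _ 2)// -!inner_norm i_inner. Qed.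

Let V_norm x : `|V x| = `|x|.
Proof.
have e : adj V (V x) = x by exact: (congr1 (fun S : bop _ _ => S x) Vu.1).
by apply/eqP; rewrite -(@eqrXn2 _ 2)// -!inner_norm adjP e.
Qed.

Let Qnorm w : `|Q w| = `|w|.
Proof.
case: w => l [m1 y].
have [n2 [m2 ly]] := sj2_dec (l, y).
have -> : (l, (m1, y)) = regroup (s2 n2 + j2 m2) m1 by rewrite -ly.
apply/eqP; rewrite -(@eqrXn2 _ 2)// QE !regroup_norm !(orth_sum_norm sj2) (orth_sum_norm sj1) V_norm.
by rewrite addrAC.
Qed.

Lemma feedback_contraction w : `|Q w| <= `|w|.
Proof. by rewrite Qnorm. Qed.

Definition corange : bop H H := id_op H - i \oc adj i.

Let corangeE x : corange x = x - i (adj i x).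
Proof. by []. Qed.

(* What remains of [A] once its part on the range of [ampl Y i \o s2], which [Q]
   already carries, is removed; its state space is the orthogonal complement of
   the range of [i]. *)
Definition feedback_op : bop (dsum H M2) (dsum H M1) :=
  (dinl H M1 \oc corange \oc dfst H U + dinr H M1 \oc adj j1 \oc ampl U (adj i))
    \oc A \oc (ampl Y i \oc j2 \oc dsnd H M2 + dinl H Y \oc corange \oc dfst H M2).

Let feedback_opE k (m2 : M2) : feedback_op (k, m2) =
  let w := A (ampl Y i (j2 m2) + (corange k, 0)) in
  (corange w.1, adj j1 (ampl U (adj i) w)).
Proof. by rewrite /= [RHS]dsum_split. Qed.

Let i_adj x : adj i (corange x) = 0.
Proof. by rewrite corangeE linearB/= iKx subrr. Qed.

Let corange_orth x y : inner (corange x) (i y) = 0.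
Proof. by rewrite adjPr i_adj inner0l. Qed.

Let corange_norm x : `|x| ^+ 2 = `|corange x| ^+ 2 + `|adj i x| ^+ 2.
Proof.
rewrite -(i_norm (adj i x)) -(pythagoras (corange_orth _ _)).
by rewrite corangeE subrK.
Qed.

(** On input, the image of m2 under [i] and [corange k] are orthogonal. On output, [corange] and
    [adj i] split the first component of [A v] orthogonally, and [adj j1] contracts. Between the
    two, [A] contracts. *)
Lemma feedback_op_contraction w : `|feedback_op w| <= `|w|.
Proof.
case: w => k m2; rewrite feedback_opE.
set v := _ + _; set w := A v.
rewrite -(@ler_pXn2r _ 2) ?nnegrE// dsum_normE/=.
apply: (@le_trans _ _ (`|w| ^+ 2)).
  rewrite [leRHS]dsum_normE [`|w.1| ^+ 2]corange_norm -addrA lerD2l.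
  have -> : `|adj i w.1| ^+ 2 + `|w.2| ^+ 2 = `|ampl U (adj i) w| ^+ 2.
    by rewrite amplE dsum_normE.
  by rewrite ler_pXn2r ?nnegrE// (orth_sum_adj_le sj1).
apply: (@le_trans _ _ (`|v| ^+ 2)); first by rewrite ler_pXn2r ?nnegrE//; exact: Ac.
rewrite dsum_normE [leRHS]dsum_normE /v amplE.
change (`|i (j2 m2).1 + corange k| ^+ 2 + `|(j2 m2).2 + 0| ^+ 2 <= `|k| ^+ 2 + `|m2| ^+ 2).
rewrite addr0 addrC [i _ + _]addrC (pythagoras (corange_orth _ _)) i_norm.
have -> : `|m2| ^+ 2 = `|j2 m2| ^+ 2 by have [_ jj _ _] := sj2; rewrite -!inner_norm jj.
rewrite [X in _ <= _ + X]dsum_normE addrC -addrA [_ ^+ 2 + `|(j2 m2).2| ^+ 2]addrC.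
by rewrite lerD2r [leRHS]corange_norm lerDl exprn_ge0.
Qed.

Variables (F : bop H H) (F1 : bop L L).
Hypothesis Fi : forall x, F (i x) = i (F1 x).
Hypothesis Fi' : forall x, adj F (i x) = i (adj F1 x).
Variable c : R.
Hypothesis c01 : 0 <= c < 1.
Hypothesis Fc : forall x, rnorm (F x) <= c * rnorm x.

Let c0 : 0 <= c. Proof. by case/andP: c01. Qed.

Let F1c x : rnorm (F1 x) <= c * rnorm x.
Proof. by rewrite /rnorm -(i_norm (F1 x)) -Fi -(i_norm x); exact: Fc. Qed.

Let G := transfer Q F1.
Let t := transfer feedback_op F.

(** [Q] has no direct path from M1 to M2: its output in M2 is the M2-component of (F1^* l, 0), hence
    at most c |l|. Together with the energy balance of [Q] this gives the strict bound that makes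
    the loop with a mere contraction invertible. *)
Lemma block11_transfer_le m2 : rnorm (block11 G m2) <= c * rnorm m2.
Proof.
rewrite -[block11 G]adjK; apply: adj_rbound => // m1.
have [l [[m2' u] Ql]] := transfer_state feedback_contraction c01 F1c (m1, 0).
have Gm : adj G (m1, 0) = (m2', u) := transfer_adj feedback_contraction c01 F1c Ql.
have -> : adj (block11 G) m1 = m2'.
  have := congr1 fst Gm; rewrite adj_blockE1 => /=.
  by rewrite linear0 addr0.
have [n2 [m lm]] := sj2_dec (adj F1 l, 0).
have mE : m2' = m.
  have := QE n2 m m1; rewrite -lm /regroup/= Ql => /(congr1 snd)/(congr1 fst)/=.
  exact.
have h1 : rnorm m <= c * rnorm l.
  apply: (@le_trans _ _ (rnorm (adj F1 l))); last exact: adj_rbound.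
  rewrite rnorm_le.
  apply: (@le_trans _ _ (`|(adj F1 l, 0) : dsum L Y|)); last first.
    by rewrite (le_trans (dsum_norm_le _))//= normr0 addr0.
  by rewrite -(@ler_pXn2r _ 2) ?nnegrE// lm (orth_sum_norm sj2) lerDr exprn_ge0.
have := feedback_contraction (adj F1 l, (m1, 0)).
have e1 : rnorm ((l, (m2', u)) : dsum L (dsum M2 U)) ^+ 2 =
    rnorm l ^+ 2 + (rnorm m2' ^+ 2 + rnorm u ^+ 2).
  by rewrite dsum_rnorm (dsum_rnorm (m2', u)).
have e2 : rnorm ((adj F1 l, (m1, 0)) : dsum L (dsum M1 Y)) ^+ 2 =
    rnorm (adj F1 l) ^+ 2 + rnorm m1 ^+ 2.
  by rewrite dsum_rnorm (dsum_rnorm (m1, 0))/= rnorm0 expr0n/= addr0.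
rewrite Ql -rnorm_le -(@ler_pXn2r _ 2) ?nnegrE ?rnorm_ge0// e1 e2.
have h2 : rnorm (adj F1 l) <= c * rnorm l by exact: adj_rbound.
rewrite mE => h3; rewrite -(@ler_pXn2r _ 2) ?nnegrE ?mulr_ge0 ?rnorm_ge0//.
have h4 : rnorm (adj F1 l) ^+ 2 <= (c * rnorm l) ^+ 2.
  by rewrite ler_pXn2r ?nnegrE ?mulr_ge0 ?rnorm_ge0.
have h5 : rnorm m ^+ 2 <= (c * rnorm l) ^+ 2.
  by rewrite ler_pXn2r ?nnegrE ?mulr_ge0 ?rnorm_ge0.
have [_ c1] := andP c01.
have u0 := sqr_ge0 (rnorm u); rewrite !exprMn in h4 h5 *.
have C0 : 0 <= c ^+ 2 by rewrite exprn_ge0.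
have C1 : 0 <= 1 - c ^+ 2 by rewrite subr_ge0 expr_le1// ltW.
(* The balance times c^2, added to (1 - c^2) |m|^2 <= (1 - c^2) c^2 |l|^2, cancels |l| and leaves
   |m|^2 <= c^2 |m1|^2. *)
have p : c ^+ 2 * (rnorm l ^+ 2 * (1 - c ^+ 2) + rnorm m ^+ 2 + rnorm u ^+ 2) <=
    c ^+ 2 * rnorm m1 ^+ 2 by apply: ler_wpM2l => //; lra.
have q : (1 - c ^+ 2) * rnorm m ^+ 2 <= (1 - c ^+ 2) * (c ^+ 2 * rnorm l ^+ 2) by apply: ler_wpM2l.
have := mulr_ge0 C0 u0; lra.
Qed.

Lemma feedback_invertible : op_invertible (id_op M2 - t \oc block11 G).
Proof.
apply: (invertible_1B c01) => x.
have t1 : `|t| <= 1 := transfer_le1 feedback_op_contraction c01 Fc.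
have h (m : M1) : rnorm (t m) <= rnorm m.
  by rewrite rnorm_le; apply: (le_trans (bop_norm_le t m)); rewrite ler_piMl.
have h1 := h (block11 G x); have h2 := block11_transfer_le x.
rewrite comp_opE; exact: le_trans h1 h2.
Qed.

(** [A] is isometric on the range of [ampl Y i \o s2], so [adj A] inverts it there. Therefore [A]
    sends vectors orthogonal to this range to vectors orthogonal to its image, which is the range of
    [ampl U i \o s1] since V is onto. *)
Let A_orth w : (forall n2, inner w (ampl Y i (s2 n2)) = 0) ->
  exists m1, ampl U (adj i) (A w) = j1 m1.
Proof.
move=> w0; apply: (orth_sum_range sj1) => n.
have VV : V (adj V n) = n by exact: (congr1 (fun S : bop _ _ => S n) Vu.2).
rewrite -VV -[i in ampl U (adj i)]adjK adjK -adj_ampl -adjPr -AE adjP.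
rewrite contraction_isometric ?w0//.
rewrite AE amplE amplE; set n2 := adj V n.
have [ss2 _ _ _] := sj2; have [ss1 _ _ _] := sj1.
apply/eqP; rewrite -(@eqrXn2 _ 2)// !dsum_normE/= !i_norm.
by rewrite -!dsum_normE -!inner_norm ss1 ss2 !inner_norm V_norm.
Qed.

(** The state k of [A] splits into [l1], a state of [Q], and [l2], orthogonal to the range of [i]
    and a state of [feedback_op]. The signals m2 and m1 exchanged by the two systems are the
    components in M2 and M1 of the input and output of [A], compressed by [adj i]. *)
Lemma feedback_realization (f : bop U Y) :
  (forall y, exists k, A (adj F k, y) = (k, adj f y)) ->
  f = block22 G + block21 G \oc op_inv (id_op M2 - t \oc block11 G) \oc t \oc block12 G.
Proof.
move=> fA; apply: (lft_formula feedback_invertible) => y; have [k kE] := fA y.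
set l1 := adj i k; set l2 := corange k.
have kD : k = i l1 + l2 by rewrite /l2 corangeE addrC subrK.
have FkD : adj F k = i (adj F1 l1) + adj F l2 by rewrite {1}kD linearD/= Fi'.
have l2E : adj i l2 = 0 by exact: i_adj.
have Fl2 : corange (adj F l2) = adj F l2.
  have e : adj i (adj F l2) = 0.
    apply: inner_injr => x.
    have -> : inner x (adj i (adj F l2)) = inner (F1 x) (adj i l2) by rewrite -!adjP Fi.
    by rewrite l2E !inner0r.
  by rewrite corangeE e linear0 subr0.
have [n2 [m2 nm]] := sj2_dec (adj F1 l1, y).
have [v vE] : exists v : dsum H Y, v = ampl Y i (j2 m2) + (adj F l2, 0) by eexists.
have wE : (adj F k, y) = ampl Y i (s2 n2) + v.
  have e : ampl Y i (s2 n2) + ampl Y i (j2 m2) = (i (adj F1 l1), y).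
    by rewrite -(amplE i (adj F1 l1, y)) nm linearD.
  rewrite vE addrA e FkD.
  by change ((i (adj F1 l1) + adj F l2, y) = (i (adj F1 l1) + adj F l2, y + 0)); rewrite addr0.
have Av : A v = (k, adj f y) - ampl U i (s1 (V n2)).
  have e : A (ampl Y i (s2 n2) + v) = A (ampl Y i (s2 n2)) + A v by exact: linearD.
  by rewrite -kE wE e AE addrC addKr.
have v0 (n : N2) : inner v (ampl Y i (s2 n)) = 0.
  have e1 : inner (ampl Y i (j2 m2)) (ampl Y i (s2 n)) = 0.
    have e2 : inner (j2 m2) (s2 n) = 0 by have [_ _ o _] := sj2; rewrite innerC o rmorph0.
    rewrite !amplE.
    change (inner (i (j2 m2).1) (i (s2 n).1) + inner (j2 m2).2 (s2 n).2 = 0).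
    by rewrite i_inner; exact: e2.
  rewrite vE innerDl e1 add0r amplE.
  change (inner (adj F l2) (i (s2 n).1) + inner 0 (s2 n).2 = 0).
  by rewrite inner0l addr0 -adjPr Fi adjPr l2E inner0l.
have [m1 /esym m1E] := A_orth v0.
have lu : (l1, adj f y) = s1 (V n2) + j1 m1.
  have e : ampl U (adj i) ((k, adj f y) - ampl U i (s1 (V n2))) = (l1, adj f y) - s1 (V n2).
    have e0 (a b : dsum H U) : ampl U (adj i) (a - b) = ampl U (adj i) a - ampl U (adj i) b.
      exact: linearB.
    by rewrite e0 !amplE iKx -dsum_eta.
  by rewrite m1E Av e addrC subrK.
have QG : Q (adj F1 l1, (m1, y)) = (l1, (m2, adj f y)).
  by have := QE n2 m2 m1; rewrite -nm -lu.
have GE : adj G (m1, y) = (m2, adj f y) := transfer_adj feedback_contraction c01 F1c QG.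
have tE : adj t m2 = m1.
  apply: (transfer_adj feedback_op_contraction c01 Fc (h := l2)).
  rewrite feedback_opE Fl2 -vE; cbv zeta; rewrite -m1E (orth_sum_adjK sj1) Av.
  change ((corange (k - (ampl U i (s1 (V n2))).1), m1) = (l2, m1)).
  have e (a b : H) : corange (a - b) = corange a - corange b by exact: linearB.
  rewrite amplE e [corange (i _)]corangeE iKx subrr subr0.
  by [].
by exists m1, m2.
Qed.

End Feedback.

(** Guarantees that [unitaryQ] satisfies its defining condition instead of being the default 0. *)
Lemma regroup_op_exists (R : realType) (L Y U N2 N1 M2 M1 : hilbertType R)
    (s2 : bop N2 (dsum L Y)) (j2 : bop M2 (dsum L Y)) (s1 : bop N1 (dsum L U))
    (j1 : bop M1 (dsum L U)) (V : bop N2 N1) : orth_sum s2 j2 ->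
  exists Q : bop (dsum L (dsum M1 Y)) (dsum L (dsum M2 U)),
  forall n2 m2 m1, Q (regroup (s2 n2 + j2 m2) m1) = regroup (s1 (V n2) + j1 m1) m2.
Proof.
move=> sj2; have [ss2 _ o2 _] := sj2.
pose ly : bop (dsum L (dsum M1 Y)) (dsum L Y) :=
  dinl L Y \oc dfst L (dsum M1 Y) + dinr L Y \oc (dsnd M1 Y \oc dsnd L (dsum M1 Y)).
pose w := s1 \oc V \oc adj s2 \oc ly + j1 \oc (dfst M1 Y \oc dsnd L (dsum M1 Y)).
pose m := adj j2 \oc ly.
exists (dinl L (dsum M2 U) \oc (dfst L U \oc w) +
  dinr L (dsum M2 U) \oc (dinl M2 U \oc m + dinr M2 U \oc (dsnd L U \oc w))).
move=> n2 m2 m1; set v := regroup _ _.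
have lyE : ly v = s2 n2 + j2 m2 by rewrite [RHS]dsum_eta [RHS]dsum_split.
have p2 : adj s2 (s2 n2 + j2 m2) = n2.
  by apply: inner_injr => x; rewrite -adjP innerDr ss2 o2 addr0.
have pm : adj j2 (s2 n2 + j2 m2) = m2.
  apply: inner_injr => x; rewrite -adjP innerDr [X in X + _]innerC o2 rmorph0 add0r adjP.
  by rewrite (orth_sum_adjK sj2).
have wE : w v = s1 (V n2) + j1 m1.
  by change (s1 (V (adj s2 (ly v))) + j1 m1 = s1 (V n2) + j1 m1); rewrite lyE p2.
have mE : m v = m2 by rewrite /m comp_opE lyE.
change ((((w v).1, 0) : dsum L (dsum M2 U)) + (0, ((m v, 0) : dsum M2 U) + (0, (w v).2)) =
  regroup (s1 (V n2) + j1 m1) m2).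
by rewrite wE mE -!dsum_split.
Qed.

Lemma orth_sum_ocompl (R : realType) (H : hilbertType R) (S : csubspace H) :
  orth_sum (cs_incl S) (cs_incl (ocompl S)).
Proof. by split=> //; [exact: inner_ocompl|exact: decomp_ocompl]. Qed.

(** * Holomorphy through quadratic remainders *)

Section Differentiability.
Variables (R : realType) (V W : normedModType R[i]).
Implicit Types (f : V -> W) (x : V) (L : bop V W).

(** Quadratic remainders keep the estimates plain inequalities with explicit constants; [D] confines
    them to the domain, off which the functions carry no information. *)
Definition quad_expansion (D : set V) f x L := exists (C d : R), 0 < d /\
  forall v, D v -> rnorm (v - x) < d -> rnorm (f v - f x - L (v - x)) <= C * rnorm (v - x) ^+ 2.

Lemma quad_differentiable f x L : quad_expansion setT f x L -> differentiable f x.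
Proof.
move=> [C [d [d0 h]]].
have Lc : continuous L.
  move=> y; apply/cvgrPdist_lt => e e0.
  have L0 : 0 < `|L| + 1 by rewrite ltr_wpDl.
  have eL : 0 < e / (`|L| + 1) by rewrite divr_gt0.
  have /cvgrPdist_lt/(_ _ eL) : (fun z : V => z) @ y --> y by exact: cvg_id.
  apply: filterS => z; rewrite ltr_pdivlMr// => yz.
  rewrite -linearB (le_lt_trans (bop_norm_le _ _))//; apply: le_lt_trans yz.
  by rewrite mulrC ler_wpM2l// lerDl.
apply/diffP.
apply: (@getPex _ (fun (df : {linear V -> W}) => continuous df /\
  forall y, f y = f (lim (nbhs x)) + df (y - lim (nbhs x))
                  +o_(y \near x) (y - lim (nbhs x)))).
exists (GRing.Linear.clone _ _ _ _ (bop_fun L) _); split; first exact: Lc.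
rewrite lim_id//.
have E : f = (fun y => f x + L (y - x)) +o_x (fun y => y - x).
  apply/eqaddoP => e e0.
  have C0 : 0 < `|C| + 1 by rewrite ltr_wpDl.
  pose r := Num.min d (complex.Re e / (`|C| + 1)).
  have e0' : 0 < complex.Re e by rewrite -ltr0c ReK// ltW.
  have r0 : 0 < r by rewrite lt_min d0 divr_gt0.
  have r0' : 0 < r%:C%C by rewrite ltr0c.
  have /cvgrPdist_lt/(_ _ r0') : (fun z : V => z) @ x --> x by exact: cvg_id.
  apply: filterS => z /= xz.
  have : rnorm (z - x) < r by rewrite rdistC -ltcR rnormE.
  rewrite lt_min => /andP[zd ze].
  change (`|f z - (f x + L (z - x))| <= e * `|z - x|).
  rewrite opprD addrA -!rnormE -(ReK (ltW e0)) -rmorphM/= lecR.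
  apply: (le_trans (h z I zd)); rewrite expr2 mulrA ler_wpM2r ?rnorm_ge0//.
  rewrite ltr_pdivlMr// in ze; apply: le_trans (ltW ze).
  rewrite mulrC ler_wpM2l ?rnorm_ge0// (le_trans (ler_norm _))// lerDl//.
by move=> y; exact: (congr1 (fun g => g y) E).
Qed.

Lemma quad_open (D : set V) f x L : (exists d : R, 0 < d /\ forall v, rnorm (v - x) < d -> D v) ->
  quad_expansion D f x L -> quad_expansion setT f x L.
Proof.
move=> [r [r0 hr]] [C [d [d0 h]]]; exists C, (Num.min d r); split; first by rewrite lt_min d0.
by move=> v _; rewrite lt_min => /andP[vd vr]; apply: h => //; exact: hr.
Qed.

End Differentiability.

Section TransferExpansion.
Variables (R : realType) (V : normedModType R[i]) (H P O : hilbertType R).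
Variables (Q : bop (dsum H P) (dsum H O)) (D : set V) (F : V -> bop H H) (x : V) (L : bop V (bop H H)).
Hypothesis Qc : forall w, `|Q w| <= `|w|.
Hypothesis Dx : D x.
Hypothesis Fq : quad_expansion D F x L.
Variable c : R.
Hypothesis c01 : 0 <= c < 1.
Hypothesis Fxc : forall h, rnorm (F x h) <= c * rnorm h.

Lemma resolvent_bound (T : bop H H) (b : R) : 0 <= b < 1 -> (forall h, rnorm (T h) <= b * rnorm h) ->
  rnorm (op_inv (id_op H - T)) <= (1 - b)^-1.
Proof.
move=> /[dup] b01 /andP[b0 b1] Tb; have [_ r] := op_invP (invertible_1B b01 Tb).
have b1' : 0 < 1 - b by rewrite subr_gt0.
rewrite -lecR rnormE; apply: bop_norm_bound; first by rewrite ler0c invr_ge0 ltW.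
move=> y; rewrite -!rnormE -rmorphM/= lecR mulrC ler_pdivlMr//.
set s := op_inv _ y.
have sE : s - T s = y by exact: (congr1 (fun S : bop _ _ => S y) r).
have := rnormD y (T s); rewrite -{1}sE subrK; have := Tb s; lra.
Qed.

Lemma comp_rnorm_le (V1 V2 V3 : normedModType R[i]) (S : bop V2 V3) (T : bop V1 V2) :
  rnorm (S \oc T) <= rnorm S * rnorm T.
Proof. by rewrite -lecR rmorphM/= !rnormE comp_norm_le. Qed.

Lemma bop_rnorm_le (V1 V2 : normedModType R[i]) (S : bop V1 V2) v :
  rnorm (S v) <= rnorm S * rnorm v.
Proof. by rewrite -lecR rmorphM/= !rnormE bop_norm_le. Qed.

Lemma sandwich_bop (V1 V2 V3 V4 V5 : normedModType R[i]) (A : bop V3 V4) (M : bop V1 (bop V2 V3))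
    (B : bop V5 V2) : exists N : bop V1 (bop V5 V4), forall w, N w = A \oc M w \oc B.
Proof.
have Nb : (fun w => A \oc M w \oc B) \in @bop_pred R V1 (bop V5 V4).
  apply: (@mkbop_subproof _ _ _ _ (`|A| * `|M| * `|B|)) => [a w w'|w].
    apply: bopE => y; change (A (M (a *: w + w') (B y)) = a *: A (M w (B y)) + A (M w' (B y))).
    rewrite linearP -[RHS]linearP; congr (A _).
  rewrite (le_trans (comp_norm_le _ _))// [leRHS]mulrAC ler_wpM2r//.
  by rewrite (le_trans (comp_norm_le _ _))// -mulrA ler_wpM2l// bop_norm_le.
by exists (Bop Nb).
Qed.

(* [(I - A'K)^-1 A' - (I - AK)^-1 A = (I - A'K)^-1 (A' - A) (I + K (I - AK)^-1 A)] *)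
Lemma resolvent_diff (A A' K T T' : bop H H) :
  (id_op H - A \oc K) \oc T = id_op H -> T' \oc (id_op H - A' \oc K) = id_op H ->
  T' \oc A' - T \oc A = T' \oc (A' - A) \oc (id_op H + K \oc (T \oc A)).
Proof.
move=> r l; apply: bopE => v.
have u1 : T (A v) = A v + A (K (T (A v))).
  have : T (A v) - A (K (T (A v))) = A v := congr1 (fun S : bop _ _ => S (A v)) r.
  by move=> /eqP; rewrite subr_eq => /eqP.
set u := T (A v) in u1.
have u2 : u = T' u - T' (A' (K u)).
  by rewrite -linearB; exact: esym (congr1 (fun S : bop _ _ => S u) l).
change (T' (A' v) - u = T' (A' (v + K u) - A (v + K u))).
by rewrite [A (v + K u)]linearD -u1 linearB !linearD/= {1}u2 opprB addrA addrAC.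
Qed.

Lemma resolvent_sub (A A' K T T' : bop H H) :
  (id_op H - A \oc K) \oc T = id_op H -> T' \oc (id_op H - A' \oc K) = id_op H ->
  T' - T = T' \oc (A' - A) \oc (K \oc T).
Proof.
move=> r l; apply: bopE => v.
have u1 : v = T v - A (K (T v)) by exact: esym (congr1 (fun S : bop _ _ => S v) r).
have u2 : T v = T' (T v) - T' (A' (K (T v))).
  by rewrite -linearB; exact: esym (congr1 (fun S : bop _ _ => S (T v)) l).
change (T' v - T v = T' (A' (K (T v)) - A (K (T v)))).
have e1 : T' v = T' (T v) - T' (A (K (T v))) by rewrite {1}u1 linearB.
have e2 (a X' Y' : H) : a = X' - Y' -> X' - a = Y' by move=> ->; rewrite subKr.
by rewrite linearB e1 addrAC (e2 _ _ _ u2).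
Qed.

Let C := adj (block11 Q).

Let Cb1 h : rnorm (C h) <= rnorm h.
Proof.
rewrite -[leRHS]mul1r; apply: adj_rbound => // y; rewrite mul1r.
rewrite rnorm_le; apply: (le_trans (block11_le Q y)); apply: (le_trans (Qc _)).
by rewrite (le_trans (dsum_norm_le _))//= normr0 addr0.
Qed.

Let CN : rnorm C <= 1.
Proof.
rewrite -lecR rnormE; apply: bop_norm_bound => // h.
by rewrite mul1r -!rnormE lecR.
Qed.

Lemma transfer_expansion : exists Lt : bop V (bop O P),
  quad_expansion D (fun v => transfer Q (F v)) x Lt.
Proof.
have [c0 c1] := andP c01.
have [Cq [d [d0 Fd]]] := Fq.
(* Midway between c and 1: operators within (1 - c) / 2 of [F x] contract by b, so that one bound s
   serves all their resolvents. *)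
pose b := (1 + c) / 2.
have b01 : 0 <= b < 1 by rewrite /b; lra.
pose s := (1 - b)^-1.
have s0 : 0 < s by rewrite invr_gt0; case/andP: b01; lra.
have Sb (T : bop H H) : (forall h, rnorm (T h) <= b * rnorm h) ->
    op_invertible (id_op H - T \oc C) /\ rnorm (op_inv (id_op H - T \oc C)) <= s.
  move=> Tb; have TCb h : rnorm ((T \oc C) h) <= b * rnorm h.
    rewrite comp_opE; apply: (le_trans (Tb _)); apply: ler_wpM2l => //.
    by case/andP: b01.
  by split; [exact: (invertible_1B b01 TCb)|exact: (resolvent_bound b01 TCb)].
have [Ti Ts] : op_invertible (id_op H - F x \oc C) /\ rnorm (op_inv (id_op H - F x \oc C)) <= s.
  apply: Sb => h; apply: (le_trans (Fxc h)).
  by rewrite ler_wpM2r ?rnorm_ge0// /b; lra.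
have [_ Tr] := op_invP Ti.
have [T TE] : exists T, T = op_inv (id_op H - F x \oc C) by eexists.
rewrite -TE in Ts Tr.
(* [W] is the right factor in [resolvent_diff]. With T' replaced by T there, the derivative is w |->
   Q12^* T (L w) W Q21^*. *)
pose W := id_op H + C \oc (T \oc F x).
have [Lt LtE] := sandwich_bop (adj (block12 Q) \oc T) L (W \oc adj (block21 Q)).
pose l := rnorm L + `|Cq|.
have l0 : 0 <= l by rewrite addr_ge0 ?rnorm_ge0.
pose a1 := rnorm (adj (block12 Q)); pose a2 := rnorm (adj (block21 Q)).
pose d' := Num.min d (Num.min 1 ((1 - c) / 2 / (l + 1))).
have l1 : 0 < l + 1 by rewrite ltr_wpDl.
exists Lt, (a1 * (s * l * l * s * rnorm W + s * `|Cq| * rnorm W) * a2), d'; split.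
  by rewrite !lt_min d0 ltr01 !divr_gt0// subr_gt0.
move=> v Dv; rewrite !lt_min => /and3P[vd v1 vl].
have Fv := Fd v Dv vd.
set w := v - x in vd v1 vl Fv *; set r := F v - F x - L w in Fv.
have w0 := rnorm_ge0 w.
have rB : rnorm r <= `|Cq| * rnorm w ^+ 2.
  by apply: (le_trans Fv); rewrite ler_wpM2r ?sqr_ge0// ler_norm.
have FB : rnorm (F v - F x) <= l * rnorm w.
  have -> : F v - F x = L w + r by rewrite /r [RHS]addrC subrK.
  apply: (le_trans (rnormD _ _)); rewrite mulrDl lerD ?bop_rnorm_le//.
  apply: (le_trans rB); rewrite ler_wpM2l// expr2 ler_piMr// ltW//.
have Fvb h : rnorm (F v h) <= b * rnorm h.
  have -> : F v h = F x h + (F v - F x) h.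
    by change (F v h = F x h + (F v h - F x h)); rewrite addrC subrK.
  apply: (le_trans (rnormD _ _)).
  have := Fxc h; have := bop_rnorm_le (F v - F x) h.
  have : rnorm (F v - F x) * rnorm h <= (1 - c) / 2 * rnorm h.
    rewrite ler_wpM2r ?rnorm_ge0//; apply: (le_trans FB).
    rewrite ltr_pdivlMr// in vl; apply: le_trans (ltW vl).
    by rewrite mulrC ler_wpM2l// lerDl.
  rewrite /b; lra.
have [Ti' Ts'] := Sb _ Fvb.
have [Tl' _] := op_invP Ti'.
have [T' TE'] : exists T', T' = op_inv (id_op H - F v \oc C) by eexists.
rewrite -TE' in Ts' Tl'.
(* Two second-order terms: replacing T' by T costs another factor F v - F x, and T r W carries the
   remainder r of F. *)
have e1 : transfer Q (F v) - transfer Q (F x) - Lt w =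
    adj (block12 Q) \oc ((T' \oc (F v - F x) \oc (C \oc T)) \oc (F v - F x) \oc W + T \oc r \oc W)
      \oc adj (block21 Q).
  rewrite -(resolvent_sub Tr Tl') LtE /transfer -/C -TE -TE' opprD addrACA subrr add0r.
  rewrite -!comp_opA -comp_opBr !comp_opA -comp_opBl.
  have e2 := resolvent_diff Tr Tl'; rewrite -/W in e2.
  apply: bopE => y; set z := adj (block21 Q) y.
  have e3 : T' (F v z) - T (F x z) = T' ((F v - F x) (W z)) := congr1 (fun S : bop _ _ => S z) e2.
  change (adj (block12 Q) (T' (F v z) - T (F x z)) - adj (block12 Q) (T (L w (W z))) =
    adj (block12 Q) (T' ((F v - F x) (W z)) - T ((F v - F x) (W z)) + T ((F v - F x) (W z) - L w (W z)))).
  by rewrite e3 -linearB [T (_ - L w _)]linearB addrA subrK.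
rewrite e1.
have W0 := rnorm_ge0 W.
have n1 : rnorm ((T' \oc (F v - F x) \oc (C \oc T)) \oc (F v - F x) \oc W) <=
    s * l * l * s * rnorm W * rnorm w ^+ 2.
  apply: (@le_trans _ _ (s * (l * rnorm w) * (1 * s) * (l * rnorm w) * rnorm W)).
    apply: (le_trans (comp_rnorm_le _ _)); apply: ler_pM; rewrite ?rnorm_ge0//.
    apply: (le_trans (comp_rnorm_le _ _)); apply: ler_pM; rewrite ?rnorm_ge0//.
    apply: (le_trans (comp_rnorm_le _ _)); apply: ler_pM; rewrite ?rnorm_ge0//.
      by apply: (le_trans (comp_rnorm_le _ _)); apply: ler_pM; rewrite ?rnorm_ge0//.
    by apply: (le_trans (comp_rnorm_le _ _)); apply: ler_pM; rewrite ?rnorm_ge0//.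
  by rewrite le_eqVlt; apply/orP; left; apply/eqP; ring.
have n2 : rnorm (T \oc r \oc W) <= s * `|Cq| * rnorm W * rnorm w ^+ 2.
  apply: (@le_trans _ _ (s * (`|Cq| * rnorm w ^+ 2) * rnorm W)).
    apply: (le_trans (comp_rnorm_le _ _)); apply: ler_pM; rewrite ?rnorm_ge0//.
    by apply: (le_trans (comp_rnorm_le _ _)); apply: ler_pM; rewrite ?rnorm_ge0//.
  by rewrite le_eqVlt; apply/orP; left; apply/eqP; ring.
apply: (le_trans (comp_rnorm_le _ _)).
rewrite [leRHS]mulrAC ler_wpM2r ?rnorm_ge0//; apply: (le_trans (comp_rnorm_le _ _)).
rewrite -[leRHS]mulrA ler_wpM2l ?rnorm_ge0//.
by rewrite mulrDl (le_trans (rnormD _ _))// lerD.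
Qed.

End TransferExpansion.

(** * Operators obtained from equal Gram matrices *)

Section Gram.
Variable R : realType.
Implicit Types H : hilbertType R.

Lemma gram_extend H H' (I : Type) (k : I -> H) (k' : I -> H') :
  (forall i j, inner (k' i) (k' j) = inner (k i) (k j)) ->
  exists T : bop H H', (forall i, T (k i) = k' i) /\ forall x, `|T x| <= `|x|.
Proof.
move=> kk.
have b (s : seq (R[i] * I)) : `|\sum_(p <- s) p.1 *: k' p.2| <= 1 * `|\sum_(p <- s) p.1 *: k p.2|.
  rewrite mul1r norm_le_inner !inner_suml le_eqVlt; apply/orP; left; apply/eqP.
  apply: eq_bigr => p _; rewrite !inner_sumr; apply: eq_bigr => r _.
  by rewrite !innerZl !innerZr kk.
have [T [Tk Tb]] := extend_bounded ler01 b.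
by exists T; split=> // x; rewrite -[leRHS]mul1r.
Qed.

Lemma total_isometry H H' (I : Type) (k : I -> H) (T : bop H H') : total_family k ->
  (forall x, `|T x| <= `|x|) -> (forall i, `|T (k i)| = `|k i|) -> adj T \oc T = id_op H.
Proof.
move=> kt Tb Tk; apply: (total_eq kt) => i; rewrite comp_opE.
exact: contraction_isometric.
Qed.

Lemma gram_isometry H H' (I : Type) (k : I -> H) (k' : I -> H') : total_family k ->
  (forall i j, inner (k' i) (k' j) = inner (k i) (k j)) ->
  exists T : bop H H', (forall i, T (k i) = k' i) /\ adj T \oc T = id_op H.
Proof.
move=> kt kk; have [T [Tk Tb]] := gram_extend kk; exists T; split=> //.
apply: (total_isometry kt) => // i; rewrite Tk.
by apply/eqP; rewrite -(@eqrXn2 _ 2)// -!inner_norm kk.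
Qed.

(** The isometry W for the exchanged families is a right inverse of V, and V^* V = I then forces V^*
    = W. *)
Lemma gram_unitary H H' (I : Type) (k : I -> H) (k' : I -> H') : total_family k ->
  total_family k' -> (forall i j, inner (k' i) (k' j) = inner (k i) (k j)) ->
  exists V : bop H H', (forall i, V (k i) = k' i) /\ unitary V.
Proof.
move=> kt kt' kk; have [V [Vk VV]] := gram_isometry kt kk.
have [W [Wk _]] := gram_isometry kt' (fun i j => esym (kk i j)).
have VW : V \oc W = id_op H' by apply: (total_eq kt') => i; rewrite comp_opE Wk Vk.
exists V; split=> //; split=> //.
have -> : adj V = W by rewrite -[LHS]comp_op1 -VW comp_opA VV comp_1op.
exact: VW.
Qed.

(** The component w of T x orthogonal to the span satisfies <w, w> = <x, Ta w>, and Ta w is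
    orthogonal to every generator because T maps generators into the span. *)
Lemma closed_span_fixed H (A : set H) (T Ta : bop H H) :
  (forall x y, inner (T x) y = inner x (Ta y)) ->
  (forall a, A a -> cs_set (closed_span A) (T a)) ->
  forall x, cs_set (closed_span A) x -> cs_set (closed_span A) (T x).
Proof.
move=> TTa TA x Ax; set S := closed_span A in TA Ax *.
set w := T x - cs_val (orth_proj S (T x)).
have wS : cs_set (ocompl S) w := @sub_orth_proj _ _ S (T x).
suff -> : T x = cs_val (orth_proj S (T x)) by exact: cs_in.
apply/eqP; rewrite -subr_eq0; apply/eqP/inner_eq0; rewrite -/w.
have -> : inner w w = inner (T x) w.
  rewrite {1}/w innerBl [X in _ - X]innerC (wS _ (cs_in _)).
  by rewrite rmorph0 subr0.
rewrite TTa; apply: (closed_span_orth _ Ax) => a Aa.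
by rewrite -TTa innerC (wS _ (TA _ Aa)) rmorph0.
Qed.

Lemma orth_projE H (S : csubspace H) x : cs_set S x -> cs_val (orth_proj S x) = x.
Proof. by move=> Sx; have [s <-] := cs_sub Sx; rewrite orth_projK. Qed.

End Gram.

(** Rearranged so that all terms are positive, the hypothesis reads G(1) + b b^* = I + G(e
    cb_conj(e)), and each side is one of the two Gram matrices. *)
Lemma lurking_gram (R : realType) (K : topologicalType) (T : Type) (H U Y : hilbertType R)
    (k : Cb R K * T * Y -> H) (G : T -> T -> bop (Cb R K) (bop Y Y)) (e : T -> Cb R K)
    (b : T -> bop U Y) :
  (forall p q, inner (k p) (k q) = inner (G q.1.2 p.1.2 (cb_conj q.1.1 * p.1.1) p.2) q.2) ->
  (forall x y, id_op Y - b x \oc adj (b y) = G x y (1 - e x * cb_conj (e y))) ->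
  forall p q : T * Y,
  inner ((k (1, p.1, p.2), adj (b p.1) p.2) : dsum H U) (k (1, q.1, q.2), adj (b q.1) q.2) =
  inner ((k (cb_conj (e p.1), p.1, p.2), p.2) : dsum H Y) (k (cb_conj (e q.1), q.1, q.2), q.2).
Proof.
move=> kk Gb p q.
change (inner (k (1, p.1, p.2)) (k (1, q.1, q.2)) + inner (adj (b p.1) p.2) (adj (b q.1) q.2) =
  inner (k (cb_conj (e p.1), p.1, p.2)) (k (cb_conj (e q.1), q.1, q.2)) + inner p.2 q.2).
rewrite !kk/= cb_conj1 cb_conjK mulr1 [X in _ + X = _]adjPr adjK.
set d := e _ * _.
have := congr1 (fun S : bop Y Y => inner (S p.2) q.2) (Gb q.1 p.1).
have gB : G q.1 p.1 (1 - d) = G q.1 p.1 1 - G q.1 p.1 d by exact: linearB.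
rewrite -/d gB.
change (inner (p.2 - b q.1 (adj (b p.1) p.2)) q.2 =
  inner (G q.1 p.1 1 p.2 - G q.1 p.1 d p.2) q.2 ->
  inner (G q.1 p.1 1 p.2) q.2 + inner (b q.1 (adj (b p.1) p.2)) q.2 =
  inner (G q.1 p.1 d p.2) q.2 + inner p.2 q.2).
rewrite !innerBl => /eqP; rewrite subr_eq => /eqP ->.
by rewrite addrA [X in _ = X + _]addrC subrK.
Qed.

(** * The lurking isometry over abstract data *)

Section AbstractRealization.
Variables (R : realType) (K : topologicalType) (T : Type) (L U Y : hilbertType R).
Variables (E : T -> Cb R K) (n : nat) (z : 'I_n -> T) (B : 'I_n -> bop U Y) (f : T -> bop U Y).
Hypothesis E_lt1 : forall x, exists c : R, 0 <= c < 1 /\ rnorm (E x) <= c.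
Hypothesis fB : forall i, f (z i) = B i.
Variables (g : Cb R K * 'I_n * Y -> L) (mL : Cb R K -> bop L L).
Variables (N2 N1 M2 M1 : hilbertType R).
Variables (s2 : bop N2 (dsum L Y)) (j2 : bop M2 (dsum L Y)) (sj2 : orth_sum s2 j2).
Variables (s1 : bop N1 (dsum L U)) (j1 : bop M1 (dsum L U)) (sj1 : orth_sum s1 j1).
Variables (k2 : 'I_n * Y -> N2) (k1 : 'I_n * Y -> N1) (V : bop N2 N1).
Variable Q : bop (dsum L (dsum M1 Y)) (dsum L (dsum M2 U)).
Variable D : T -> T -> bop (Cb R K) (bop Y Y).
Hypothesis cpD : cp_kernel setT D.
Hypothesis fD : forall x w, id_op Y - f x \oc adj (f w) = D x w (1 - E x * cb_conj (E w)).
Hypothesis g_total : total_family g.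
Hypothesis g_gram : forall p q,
  inner (g p) (g q) = inner (D (z q.1.2) (z p.1.2) (cb_conj q.1.1 * p.1.1) p.2) q.2.
Hypothesis mLg : forall d p, mL d (g p) = g (d * p.1.1, p.1.2, p.2).
Hypothesis mL_adj : forall d, adj (mL d) = mL (cb_conj d).
Hypothesis k2_total : total_family k2.
Hypothesis k2E : forall p, s2 (k2 p) = (g (cb_conj (E (z p.1)), p.1, p.2), p.2).
Hypothesis k1E : forall p, s1 (k1 p) = (g (1, p.1, p.2), adj (B p.1) p.2).
Hypothesis Vu : unitary V.
Hypothesis Vk : forall p, V (k2 p) = k1 p.
Hypothesis QE : forall n2 m2 m1,
  Q (regroup (s2 n2 + j2 m2) m1) = regroup (s1 (V n2) + j1 m1) m2.

(** [A] and [m] are independent of x: t depends on x through [m (E x)] alone, and its holomorphy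
    will be read off from that. *)
Lemma abstract_realization :
  exists (H : hilbertType R) (A : bop (dsum H M2) (dsum H M1)) (m : bop (Cb R K) (bop H H)),
  [/\ forall w, `|A w| <= `|w|, forall d, `|m d| <= `|d| &
  forall x, let t := transfer A (m (E x)) in let G := transfer Q (mL (E x)) in
    op_invertible (id_op M2 - t \oc block11 G) /\
    f x = block22 G + block21 G \oc op_inv (id_op M2 - t \oc block11 G) \oc t \oc block12 G].
Proof.
have [H [k [m [[kt kk mk mb ml] ma]]]] := cp_kernel_kolmogorov cpD.
have gk p q : inner (k (p.1.1, z p.1.2, p.2)) (k (q.1.1, z q.1.2, q.2)) = inner (g p) (g q).
  by rewrite kk g_gram.
(* The embedding of L1 in H: the vectors g and those of H over the points z_i have the same Gram
   matrix. *)
have [i [ig iK]] := gram_isometry (k' := fun p => k (p.1.1, z p.1.2, p.2)) g_total gk.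
pose k2' (p : T * Y) : dsum H Y := (k (cb_conj (E p.1), p.1, p.2), p.2).
pose k1' (p : T * Y) : dsum H U := (k (1, p.1, p.2), adj (f p.1) p.2).
(* The lurking isometry, extended by zero off the closed span of its domain. *)
have [A [Ak Ac]] : exists A : bop (dsum H Y) (dsum H U),
    (forall p, A (k2' p) = k1' p) /\ forall w : dsum H Y, `|A w| <= `|w|.
  exact: gram_extend (lurking_gram (b := f) kk fD).
have AE n2 : A (ampl Y i (s2 n2)) = ampl U i (s1 (V n2)).
  have e : A \oc ampl Y i \oc s2 = ampl U i \oc s1 \oc V.
    apply: (total_eq k2_total) => p; rewrite !comp_opE Vk k2E k1E !amplE !ig; have := Ak (z p.1, p.2); rewrite /k2' /k1' fB.
    exact.
  by rewrite -!comp_opE e.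
have mmu d x : m d (i x) = i (mL d x).
  have e : m d \oc i = i \oc mL d.
    by apply: (total_eq g_total) => p; rewrite !comp_opE mLg !ig mk.
  by rewrite -comp_opE e.
have mP : m \in @bop_pred R (Cb R K) (bop H H).
  by apply: (@mkbop_subproof _ _ _ _ 1) => [c a b|a]; [exact: ml|rewrite mul1r].
have [mm mmE] : exists mm : bop (Cb R K) (bop H H), forall d, mm d = m d by exists (Bop mP).
exists H, (feedback_op j2 j1 i A), mm; split; first exact: (feedback_op_contraction sj2 sj1 iK Ac).
  by move=> d; rewrite mmE.
move=> x; have [c [c01 Ec]] := E_lt1 x.
move: (mm (E x)) (mmE (E x)) => F FE.
have Fc y : rnorm (F y) <= c * rnorm y.
  apply: (le_trans (bop_rnorm_le _ _)); rewrite ler_wpM2r ?rnorm_ge0//.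
  by apply: le_trans Ec; rewrite FE rnorm_le.
have Fi y : F (i y) = i (mL (E x) y) by rewrite FE mmu.
have Fi' y : adj F (i y) = i (adj (mL (E x)) y) by rewrite FE -ma mL_adj mmu.
have r1 := feedback_invertible sj2 sj1 Vu QE iK Ac Fi c01 Fc.
have r2 : f x = _ := feedback_realization sj2 sj1 Vu QE iK Ac AE Fi Fi' c01 Fc (f := f x) _.
cbv zeta; split; first exact: r1.
apply: r2 => y; exists (k (1, x, y)); rewrite FE -ma mk/= mulr1; exact: (Ak (x, y)).
Qed.

End AbstractRealization.

(** * The spaces and operators of the construction *)

Section Realization.
Variables (R : realType) (D : test_domain R) (U Y : hilbertType R).
Local Notation CPsi := (Cb R (td_fun D)).
Local Notation E := (@td_eval R D).

Hypothesis eval_lt1 : forall x : td_point D, exists c : R, 0 <= c < 1 /\ rnorm (E x) <= c.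

Variables (n : nat) (z : 'I_n -> td_point D) (B : 'I_n -> bop U Y).
Variable Gamma : td_point D -> td_point D -> bop CPsi (bop Y Y).
Hypothesis GammaB : forall i j, id_op Y - B i \oc adj (B j) =
  Gamma (z i) (z j) (1 - E (z i) * cb_conj (E (z j))).
Variable f : td_space D -> bop U Y.
Hypothesis fB : forall i, f (set_val (z i)) = B i.
Variables (X : hilbertType R) (mu : CPsi -> bop X X) (h : td_point D -> bop X Y).
Hypothesis hkol : kolmogorov (range z) Gamma mu h.

Local Notation L1 := (spaceL1 z mu h).
Local Notation N1 := (spaceN1 z B mu h).
Local Notation N2 := (spaceN2 z mu h).

Let mu_rep : star_rep mu. Proof. by case: hkol. Qed.

Let mu1 : mu 1 = id_op X. Proof. by case: mu_rep. Qed.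

Let muM a b x : mu (a * b) x = mu a (mu b x).
Proof. by case: mu_rep => _ _ -> _. Qed.

Let mu_adj a : adj (mu a) = mu (cb_conj a).
Proof. by case: mu_rep => _ _ _ ->. Qed.

Let Gamma_mu i j delta : Gamma (z i) (z j) delta = h (z i) \oc mu delta \oc adj (h (z j)).
Proof. by case: hkol => _; apply; [exists i|exists j]. Qed.

Local Notation I1 := (CPsi * 'I_n * Y)%type.

Let g0 (p : I1) : X := mu p.1.1 (adj (h (z p.1.2)) p.2).

Let g0_L1 p : cs_set L1 (g0 p).
Proof. by apply: mem_closed_span; exists p.1.2, p.1.1, p.2. Qed.

Let g (p : I1) : csub L1 := CSub (mem_set (@g0_L1 p)).

Let g_total : total_family g.
Proof.
by apply: total_closed_span => _ [i [delta [y ->]]]; exists (delta, i, y).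
Qed.

Let g_gram p q : inner (g p) (g q) =
  inner (Gamma (z q.1.2) (z p.1.2) (cb_conj q.1.1 * p.1.1) p.2) q.2.
Proof.
rewrite Gamma_mu.
change (inner (mu p.1.1 (adj (h (z p.1.2)) p.2)) (mu q.1.1 (adj (h (z q.1.2)) q.2)) =
  inner (h (z q.1.2) (mu (cb_conj q.1.1 * p.1.1) (adj (h (z p.1.2)) p.2))) q.2).
by rewrite [RHS]adjP muM -mu_adj -[RHS]adjPr.
Qed.

(** [restr] takes its intended value because L1 is invariant: mu(delta) maps generators to
    generators and has an adjoint, as [closed_span_fixed] requires. *)
Let muLE delta x : cs_val (muL z mu h delta x) = mu delta (cs_val x).
Proof.
have inv x' : cs_set L1 x' -> cs_set L1 (mu delta x').
  apply: (@closed_span_fixed _ _ _ _ (mu (cb_conj delta))) => [u v|_ [i [a [y ->]]]].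
    by rewrite adjP mu_adj.
  by apply: mem_closed_span; exists i, (delta * a), y; rewrite muM.
have ex : exists T : bop (csub L1) (csub L1), forall x, cs_val (T x) = mu delta (cs_val x).
  exists (orth_proj L1 \oc mu delta \oc cs_incl L1) => u.
  by rewrite !comp_opE orth_projE//; apply: inv; exact: cs_in.
exact: (@xgetPex _ 0 [set T : bop (csub L1) (csub L1) |
  forall x, cs_val (T x) = mu delta (cs_val x)] ex).
Qed.

Let muLg delta p : muL z mu h delta (g p) = g (delta * p.1.1, p.1.2, p.2).
Proof. by apply: val_inj; rewrite /= muLE /g0/= muM. Qed.

Let muL_adj delta : adj (muL z mu h delta) = muL z mu h (cb_conj delta).
Proof.
apply: adj_unique => x y.
change (inner (cs_val (muL z mu h delta x)) (cs_val y) =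
  inner (cs_val x) (cs_val (muL z mu h (cb_conj delta) y))).
by rewrite !muLE adjP mu_adj.
Qed.

Let a2 (p : 'I_n * Y) : dsum (csub L1) Y := (g (cb_conj (E (z p.1)), p.1, p.2), p.2).
Let a1 (p : 'I_n * Y) : dsum (csub L1) U := (g (1, p.1, p.2), adj (B p.1) p.2).

Let a2_gen i y w : N2_gen i y w <-> w = a2 (i, y).
Proof.
split=> [[w1 w2]|->].
  rewrite [w]dsum_eta w2 /a2; congr pair; apply: val_inj.
  by rewrite /= w1 mu_adj.
by split=> //; rewrite /= mu_adj.
Qed.

Let a1_gen i y w : N1_gen B i y w <-> w = a1 (i, y).
Proof.
split=> [[w1 w2]|->].
  rewrite [w]dsum_eta w2 /a1; congr pair; apply: val_inj.
  by rewrite /= w1 /g0/= mu1.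
by split=> //; rewrite /= /g0/= mu1.
Qed.

Let a_gram p q : inner (a1 p) (a1 q) = inner (a2 p) (a2 q).
Proof.
exact: (@lurking_gram _ _ _ _ _ _ g (fun i j => Gamma (z i) (z j)) (fun i => E (z i)) B g_gram GammaB).
Qed.

Let a2_N2 p : cs_set N2 (a2 p).
Proof. by apply: mem_closed_span; exists p.1, p.2; apply/a2_gen; case: p. Qed.
Let a1_N1 p : cs_set N1 (a1 p).
Proof. by apply: mem_closed_span; exists p.1, p.2; apply/a1_gen; case: p. Qed.
Let k2 p : csub N2 := CSub (mem_set (@a2_N2 p)).
Let k1 p : csub N1 := CSub (mem_set (@a1_N1 p)).

Let k2_total : total_family k2.
Proof. by apply: total_closed_span => w [i [y /a2_gen ->]]; exists (i, y). Qed.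
Let k1_total : total_family k1.
Proof. by apply: total_closed_span => w [i [y /a1_gen ->]]; exists (i, y). Qed.

Local Notation V := (unitaryV z B mu h).

Lemma unitaryV_spec : unitary V /\
  forall i y w, N2_gen i y (cs_val w) -> N1_gen B i y (cs_val (V w)).
Proof.
have [T [Tk Tu]] := @gram_unitary _ _ _ _ k2 k1 k2_total k1_total a_gram.
have ex : exists T : bop (csub N2) (csub N1), unitary T /\
    forall i y w, N2_gen i y (cs_val w) -> N1_gen B i y (cs_val (T w)).
  exists T; split=> // i y w /a2_gen wE; apply/a1_gen.
  have -> : w = k2 (i, y) by apply: val_inj.
  by rewrite Tk.
exact: (@xgetPex _ 0 [set T : bop (csub N2) (csub N1) | unitary T /\
    forall i y w, N2_gen i y (cs_val w) -> N1_gen B i y (cs_val (T w))] ex).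
Qed.

Let Vk p : V (k2 p) = k1 p.
Proof.
case: p => i y; apply: val_inj; apply/a1_gen.
by apply: unitaryV_spec.2; apply/a2_gen.
Qed.

Local Notation M1 := (spaceM1 z B mu h).
Local Notation M2 := (spaceM2 z mu h).

Lemma unitaryQ_spec (n2 : csub N2) (m2 : csub M2) (m1 : csub M1) :
  unitaryQ z B mu h (regroup (cs_val n2 + cs_val m2) m1) =
  regroup (cs_val (V n2) + cs_val m1) m2.
Proof.
exact: (@xgetPex _ 0 [set Q : bop (dsum (csub L1) (dsum (csub M1) Y))
    (dsum (csub L1) (dsum (csub M2) U)) |
  forall (n2 : csub N2) (m2 : csub M2) (m1 : csub M1),
  Q (regroup (cs_val n2 + cs_val m2) m1) = regroup (cs_val (V n2) + cs_val m1) m2]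
  (regroup_op_exists (cs_incl N1) (cs_incl M1) V (orth_sum_ocompl N2))).
Qed.

Variable Delta : td_point D -> td_point D -> bop CPsi (bop Y Y).
Hypothesis cpD : cp_kernel setT Delta.
Hypothesis Df : forall x w, id_op Y - f (set_val x) \oc adj (f (set_val w)) =
  Delta x w (1 - E x * cb_conj (E w)).
Hypothesis DG : forall i j, Delta (z i) (z j) = Gamma (z i) (z j).

Local Notation Q := (unitaryQ z B mu h).

Let k2E p : cs_val (k2 p) = (g (cb_conj (E (z p.1)), p.1, p.2), p.2).
Proof. by []. Qed.

Let k1E p : cs_val (k1 p) = (g (1, p.1, p.2), adj (B p.1) p.2).
Proof. by []. Qed.

Let gD p q : inner (g p) (g q) =
  inner (Delta (z q.1.2) (z p.1.2) (cb_conj q.1.1 * p.1.1) p.2) q.2.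
Proof. by rewrite g_gram DG. Qed.

Definition schur_realization :=
  @abstract_realization R (td_fun D) (td_point D) (csub L1) U Y E n z B (fun x => f (set_val x))
  eval_lt1 fB g (muL z mu h) (csub N2) (csub N1) (csub M2) (csub M1)
  (cs_incl N2) (cs_incl M2) (orth_sum_ocompl N2) (cs_incl N1) (cs_incl M1) (orth_sum_ocompl N1)
  k2 k1 V Q Delta cpD Df g_total gD muLg muL_adj k2_total k2E k1E
  unitaryV_spec.1 Vk unitaryQ_spec.

End Realization.

(** The norm on the left is a supremum over all test functions, so K and d are uniform in Psi; and
    the derivative L takes values in continuous functions of the test function. *)
Definition eval_expands (R : realType) (D : test_domain R) : Prop :=
  forall x : td_point D, exists (L : bop (td_space D) (Cb R (td_fun D))) (K d : R),
  0 < d /\ forall w : td_point D, rnorm (set_val w - set_val x) < d ->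
    rnorm (td_eval w - td_eval x - L (set_val w - set_val x)) <=
      K * rnorm (set_val w - set_val x) ^+ 2.

(** * The theorem on a domain where E is strictly bounded and expands *)

Section Conclusion.
Variables (R : realType) (D : test_domain R) (U Y : hilbertType R).
Local Notation E := (@td_eval R D).
Hypothesis dom_open : forall x, @td_dom R D x ->
  exists d : R, 0 < d /\ forall v, rnorm (v - x) < d -> @td_dom R D v.
Hypothesis eval_lt1 : forall x : td_point D, exists c : R, 0 <= c < 1 /\ rnorm (E x) <= c.
Hypothesis eval_expansion : eval_expands D.

(** Since m is linear and contractive, v |-> m (E v) inherits the expansion and the strict bound of
    E; [transfer_expansion] and [transfer_le1] hand them on to the transfer function. *)
Lemma schur_class_transfer (H P O : hilbertType R) (A : bop (dsum H P) (dsum H O))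
    (m : bop (Cb R (td_fun D)) (bop H H)) :
  (forall w, `|A w| <= `|w|) -> (forall d, `|m d| <= `|d|) ->
  exists2 t : td_space D -> bop O P, schur_class t &
    forall x : td_point D, t (set_val x) = transfer A (m (E x)).
Proof.
move=> Ac mc.
pose F v : bop H H := if pselect (@td_dom R D v) is left dv then
  m (E (SigSub (mem_set dv) : td_point D)) else 0.
have FE (x : td_point D) : F (set_val x) = m (E x).
  rewrite /F; case: pselect => [dv|]; last by have := set_valP x.
  by congr (m (E _)); apply: val_inj.
have Fc (x : td_point D) c : rnorm (E x) <= c -> forall y, rnorm (F (set_val x) y) <= c * rnorm y.
  move=> Ec y; apply: (le_trans (bop_rnorm_le _ _)); rewrite ler_wpM2r ?rnorm_ge0// FE.
  by apply: le_trans Ec; rewrite rnorm_le.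
have t1 v : @td_dom R D v -> `|transfer A (F v)| <= 1.
  move=> dv; pose x : td_point D := SigSub (mem_set dv).
  have [c [c01 Ec]] := eval_lt1 x.
  exact: (transfer_le1 Ac c01 (Fc x c Ec)).
exists (fun v => transfer A (F v)) => [|x]; last by rewrite FE.
split.
- move=> v dv; pose x : td_point D := SigSub (mem_set dv).
  have [L [C [d [d0 Ld]]]] := eval_expansion x.
  have [c [c01 Ec]] := eval_lt1 x.
  have Fq : quad_expansion (@td_dom R D) F v (m \oc L).
    exists `|C|, d; split=> // w dw wv; pose u : td_point D := SigSub (mem_set dw).
    have := Ld u wv; change (set_val u) with w; change (set_val x) with v => h.
    have -> : F w - F v - (m \oc L) (w - v) = m (E u - E x - L (w - v)).
      have lin a b l : m (a - b - l) = m a - m b - m l by rewrite !linearB.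
      by rewrite lin -(FE u) -(FE x).
    apply: (@le_trans _ _ (rnorm (E u - E x - L (w - v)))); first by rewrite rnorm_le.
    by apply: (le_trans h); rewrite ler_wpM2r ?sqr_ge0// ler_norm.
  have [Lt Ltq] := transfer_expansion Ac Fq c01 (Fc x c Ec).
  exact: quad_differentiable (quad_open (dom_open dv) Ltq).
- by exists 1.
- exact: supnorm_le.
Qed.

Lemma theorem7_of_domain (n : nat) (z : 'I_n -> td_point D) (B : 'I_n -> bop U Y)
    (Gamma : td_point D -> td_point D -> bop (Cb R (td_fun D)) (bop Y Y)) :
  (forall i j, id_op Y - B i \oc adj (B j) =
     Gamma (z i) (z j) (1 - E (z i) * cb_conj (E (z j)))) ->
  forall (f : td_space D -> bop U Y), (forall i, f (set_val (z i)) = B i) ->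
  affiliated z f Gamma ->
  forall (X : hilbertType R) (mu : Cb R (td_fun D) -> bop X X) (h : td_point D -> bop X Y),
  kolmogorov (range z) Gamma mu h ->
  exists2 t : td_space D -> bop (csub (spaceM1 z B mu h)) (csub (spaceM2 z mu h)),
    schur_class t &
    forall x : td_point D,
      let G := transferG z B mu h x in
      let T := id_op (csub (spaceM2 z mu h)) - t (set_val x) \oc block11 G in
      op_invertible T /\
      f (set_val x) =
        block22 G + block21 G \oc op_inv T \oc t (set_val x) \oc block12 G.
Proof.
move=> GB f fB [Delta [cpD fD DG]] X mu h hkol.
have [H [A [m [Ac mc real]]]] := schur_realization eval_lt1 GB fB hkol cpD fD DG.
have [t ts tE] := schur_class_transfer Ac mc.
exists t; first exact: ts.
by move=> x; cbv zeta; rewrite tE; exact: real.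
Qed.

End Conclusion.

(** * Cauchy estimates *)

Section RealIntegral.
Variable R : realType.
Implicit Types (f g F G : R -> R) (a b : R).

Definition con_on f a b := forall x, a <= x <= b -> forall e, 0 < e ->
  exists2 d, 0 < d & forall y, a <= y <= b -> `|x - y| < d -> `|f x - f y| < e.

Definition rprim F f a b := forall x, a <= x <= b -> is_derive x 1 F (f x).

(* The integral of [f] over [a, b] as the increment of an antiderivative. *)
Definition rint f a b : R := xget 0 [set v | exists F, rprim F f a b /\ v = F b - F a].

Lemma rprim_MVT F f a b : a <= b -> rprim F f a b ->
  exists2 c, a <= c <= b & F b - F a = f c * (b - a).
Proof.
move=> ab Ff; have [||c cab E] := @MVT_segment R F f a b ab.
- by move=> x; rewrite in_itv/= => /andP[ax xb]; apply: Ff; rewrite !ltW.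
- apply: derivable_within_continuous => x; rewrite in_itv/= => xab.
  by have [] := Ff _ xab.
by exists c => //; move: cab; rewrite in_itv.
Qed.

Lemma rint_prim F f a b : a <= b -> rprim F f a b -> rint f a b = F b - F a.
Proof.
move=> ab Ff.
have [G [Gf ->]] : exists F', rprim F' f a b /\ rint f a b = F' b - F' a.
  apply: (@xgetPex _ 0 [set v | exists F, rprim F f a b /\ v = F b - F a]).
  by exists (F b - F a), F.
have FG : rprim (F - G) (fun=> 0) a b.
  move=> x xab; rewrite -(subrr (f x)).
  by apply: is_deriveB; [exact: Ff|exact: Gf].
have [c _] := rprim_MVT ab FG; rewrite mul0r.
change (F b - G b - (F a - G a) = 0 -> G b - G a = F b - F a); lra.
Qed.

Lemma continuous_rprim f a b : continuous f -> exists F, rprim F f a b.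
Proof.
(* Integrating from a - 1 makes every point of [a, b] interior, so that the derivative at a is
   two-sided as [rprim] asks. *)
move=> fc; exists (fun x => (\int[lebesgue_measure]_(t in `[(a - 1)%R, x]) f t)%R) => x /andP[ax xb].
have [||||d e] := @continuous_FTC1 R f (BLeft (a - 1)) x (x + 1).
- by rewrite ltrDl.
- apply: continuous_compact_integrable; first exact: segment_compact.
  by apply: continuous_subspaceT => y; exact: fc.
- have h : a - 1 < x by lra.
  exact: h.
- exact: fc.
apply: DeriveDef; first exact: d.
by rewrite -derive1E; exact: e.
Qed.

(** Retraction of the line onto [a, b]; composing with it extends a function continuous on the
    segment to the whole line. *)
Definition clamp a b (x : R) : R := Num.min (Num.max a x) b.

Lemma clamp_in a b x : a <= b -> a <= clamp a b x <= b.
Proof. by move=> ab; rewrite /clamp le_min ge_min lexx orbT ab le_max lexx. Qed.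

Lemma clamp_id a b x : a <= x <= b -> clamp a b x = x.
Proof.
by move=> /andP[ax xb]; rewrite /clamp (max_idPr ax) (min_idPl xb).
Qed.

Lemma clamp_lip a b x y : `|clamp a b x - clamp a b y| <= `|x - y|.
Proof.
have h1 := ler_norm (x - y); have h2 := ler_norm (y - x); rewrite distrC in h2.
rewrite ler_norml /clamp /Num.max /Num.min.
by case: (ltP a x) => ?; case: (ltP a y) => ?; case: ltP => ?; case: ltP => ?;
  apply/andP; split; lra.
Qed.

Lemma con_on_prim f a b : a <= b -> con_on f a b -> exists F, rprim F f a b.
Proof.
move=> ab fc; have [|F Ff] := @continuous_rprim (f \o clamp a b) a b.
  move=> x; apply/cvgrPdist_lt => e e0.
  have [d d0 fd] := fc _ (clamp_in x ab) e e0.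
  have /cvgrPdist_lt/(_ _ d0) : (fun y : R => y) @ x --> x by exact: cvg_id.
  apply: filterS => y xy; apply: fd; first exact: clamp_in.
  exact: le_lt_trans (clamp_lip _ _ _ _) xy.
by exists F => x xab; have := Ff x xab; rewrite /= clamp_id.
Qed.

Lemma rint_ext f g a b : (forall x, a <= x <= b -> f x = g x) -> rint f a b = rint g a b.
Proof.
move=> fg; congr (xget 0 _); apply/seteqP; split=> v [F [Ff ->]]; exists F; split=> // x xab.
  by rewrite -fg//; exact: Ff.
by rewrite fg//; exact: Ff.
Qed.

Lemma rint_split f a m b : a <= m <= b -> con_on f a b -> rint f a b = rint f a m + rint f m b.
Proof.
move=> /andP[am mb] fc; have ab := le_trans am mb.
have [F Ff] := con_on_prim ab fc.
rewrite (rint_prim ab Ff) (@rint_prim F f a m)//; last first.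
  by move=> x /andP[ax xm]; apply: Ff; rewrite ax (le_trans xm).
rewrite (@rint_prim F f m b)//; last first.
  by move=> x /andP[mx xb]; apply: Ff; rewrite xb (le_trans am).
by rewrite [RHS]addrC addrA subrK.
Qed.

Lemma rint_lin f g (k l : R) a b : a <= b -> con_on f a b -> con_on g a b ->
  rint (fun x => k * f x + l * g x) a b = k * rint f a b + l * rint g a b.
Proof.
move=> ab fc gc; have [F Ff] := con_on_prim ab fc; have [G Gg] := con_on_prim ab gc.
rewrite (rint_prim ab Ff) (rint_prim ab Gg).
rewrite (@rint_prim (k *: F + l *: G) _ a b ab).
  change (k * F b + l * G b - (k * F a + l * G a) = k * (F b - F a) + l * (G b - G a)); ring.
move=> x xab; have d1 := Ff x xab; have d2 := Gg x xab.
exact: is_deriveD.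
Qed.

Lemma rint_ge f a b (m : R) : a <= b -> con_on f a b -> (forall x, a <= x <= b -> m <= f x) ->
  m * (b - a) <= rint f a b.
Proof.
move=> ab fc fm; have [F Ff] := con_on_prim ab fc; rewrite (rint_prim ab Ff).
by have [c cab ->] := rprim_MVT ab Ff; rewrite ler_wpM2r ?subr_ge0// fm.
Qed.

Lemma rint_cst (k : R) a b : a <= b -> rint (fun=> k) a b = k * (b - a).
Proof.
move=> ab; rewrite (@rint_prim (k *: id) _ a b ab); first by rewrite /= mulrBr.
move=> x _; rewrite -[X in is_derive _ _ _ X]mulr1; exact: is_deriveZ.
Qed.

Lemma rint_id a b : a <= b -> rint id a b = (b ^+ 2 - a ^+ 2) / 2.
Proof.
move=> ab; rewrite (@rint_prim (2^-1 *: (id * id)) _ a b ab).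
  by change (2^-1 * (b * b) - 2^-1 * (a * a) = (b ^+ 2 - a ^+ 2) / 2); field.
move=> x _; apply: is_derive_eq.
by rewrite /GRing.scale/=; field.
Qed.

End RealIntegral.

(** * Contour integrals over rectangles *)

Section ComplexIntegral.
Variable R : realType.
Local Notation C := R[i].
Local Notation re := (@complex.Re R).
Local Notation im := (@complex.Im R).
Implicit Types (f g : R -> C) (a b : R) (z w : C).

Lemma rnormM z w : rnorm (z * w) = rnorm z * rnorm w.
Proof. by apply: (@complexI R); rewrite rmorphM/= !rnormE normrM. Qed.

Lemma rnormV z : rnorm z^-1 = (rnorm z)^-1.
Proof. by apply: (@complexI R); rewrite fmorphV/= !rnormE normfV. Qed.

Lemma rnorm_conj z : rnorm z^* = rnorm z.
Proof. by rewrite /rnorm norm_conjC. Qed.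

Lemma rnorm_real (r : R) : 0 <= r -> rnorm (r%:C%C : C) = r.
Proof. by move=> r0; rewrite /rnorm ger0_norm ?ler0c. Qed.

Lemma rnorm_sqrE z : rnorm z ^+ 2 = re z ^+ 2 + im z ^+ 2.
Proof.
apply: (@complexI R); rewrite rnorm_sqr normc_def -rmorphXn/= sqr_sqrtr//.
by rewrite addr_ge0 ?sqr_ge0.
Qed.

Lemma re_le z : `|re z| <= rnorm z.
Proof.
rewrite -(@ler_pXn2r _ 2) ?nnegrE ?rnorm_ge0// real_normK ?num_real// rnorm_sqrE.
by rewrite lerDl sqr_ge0.
Qed.

Lemma im_le z : `|im z| <= rnorm z.
Proof.
rewrite -(@ler_pXn2r _ 2) ?nnegrE ?rnorm_ge0// real_normK ?num_real// rnorm_sqrE.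
by rewrite lerDr sqr_ge0.
Qed.

Lemma rnorm_le_reim z : rnorm z <= `|re z| + `|im z|.
Proof.
rewrite -(@ler_pXn2r _ 2) ?nnegrE ?rnorm_ge0 ?addr_ge0// rnorm_sqrE sqrrD.
rewrite !real_normK ?num_real// addrAC lerDl mulrn_wge0// mulr_ge0//.
Qed.

Lemma reD z w : re (z + w) = re z + re w. Proof. by case: z w => [? ?] [? ?]. Qed.
Lemma reB z w : re (z - w) = re z - re w. Proof. by case: z w => [? ?] [? ?]. Qed.
Lemma imD z w : im (z + w) = im z + im w. Proof. by case: z w => [? ?] [? ?]. Qed.
Lemma imB z w : im (z - w) = im z - im w. Proof. by case: z w => [? ?] [? ?]. Qed.
Lemma reM z w : re (z * w) = re z * re w - im z * im w. Proof. by case: z w => [? ?] [? ?]. Qed.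
Lemma imM z w : im (z * w) = re z * im w + im z * re w. Proof. by case: z w => [? ?] [? ?]. Qed.

Lemma complexP z w : re z = re w -> im z = im w -> z = w.
Proof. by case: z w => [a b] [c d] /= -> ->. Qed.

Lemma con_on_lin (u v : R -> R) (k l : R) a b : con_on u a b -> con_on v a b ->
  con_on (fun x => k * u x + l * v x) a b.
Proof.
move=> uc vc x xab e e0.
have k0 : 0 < `|k| + 1 by rewrite ltr_wpDl.
have l0 : 0 < `|l| + 1 by rewrite ltr_wpDl.
have [d d0 hd] := uc x xab (e / 2 / (`|k| + 1)) (divr_gt0 (divr_gt0 e0 (ltr0Sn _ 1)) k0).
have [r r0 hr] := vc x xab (e / 2 / (`|l| + 1)) (divr_gt0 (divr_gt0 e0 (ltr0Sn _ 1)) l0).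
exists (Num.min d r); first by rewrite lt_min d0.
move=> y yab; rewrite lt_min => /andP[xd xr].
have := hd y yab xd; have := hr y yab xr; rewrite (ltr_pdivlMr _ _ k0) (ltr_pdivlMr _ _ l0) => h1 h2.
have -> : k * u x + l * v x - (k * u y + l * v y) = k * (u x - u y) + l * (v x - v y) by ring.
apply: (le_lt_trans (ler_normD _ _)); rewrite !normrM (splitr e); apply: ltrD.
  by apply: le_lt_trans h2; rewrite mulrC ler_wpM2l// lerDl.
by apply: le_lt_trans h1; rewrite mulrC ler_wpM2l// lerDl.
Qed.

Definition ccon_on f a b := con_on (re \o f) a b /\ con_on (im \o f) a b.

Definition cint f a b : C := Complex (rint (re \o f) a b) (rint (im \o f) a b).

Lemma cint_lin f g (k : C) a b : a <= b -> ccon_on f a b -> ccon_on g a b ->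
  cint (fun x => k * f x + g x) a b = k * cint f a b + cint g a b.
Proof.
move=> ab [fr fi] [gr gi]; apply: complexP.
  rewrite reD reM /=.
  have -> : re \o (fun x => k * f x + g x) =
      (fun x => 1 * (re k * re (f x) + - im k * im (f x)) + 1 * re (g x)).
    by apply/funext => x /=; rewrite reD reM; ring.
  by rewrite !rint_lin//; [ring|exact: con_on_lin].
rewrite imD imM /=.
have -> : im \o (fun x => k * f x + g x) =
    (fun x => 1 * (re k * im (f x) + im k * re (f x)) + 1 * im (g x)).
  by apply/funext => x /=; rewrite imD imM; ring.
by rewrite !rint_lin//; [ring|exact: con_on_lin].
Qed.

Lemma cint_split f a m b : a <= m <= b -> ccon_on f a b ->
  cint f a b = cint f a m + cint f m b.
Proof.
by move=> amb [fr fi]; apply: complexP; rewrite ?reD ?imD /=; exact: rint_split.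
Qed.

Lemma cint_re_ge f a b (u : C) (m : R) : a <= b -> ccon_on f a b ->
  (forall x, a <= x <= b -> m <= re (u * f x)) -> m * (b - a) <= re (u * cint f a b).
Proof.
move=> ab [fr fi] fm; rewrite reM /= -mulNr -rint_lin//.
apply: rint_ge => //; first exact: con_on_lin.
by move=> x xab; have := fm x xab; rewrite reM -mulNr.
Qed.

Lemma cint_bound f a b (M : R) : a <= b -> ccon_on f a b ->
  (forall x, a <= x <= b -> rnorm (f x) <= M) -> rnorm (cint f a b) <= M * (b - a).
Proof.
move=> ab fc fM; have [w0|w0] := eqVneq (cint f a b) 0.
  rewrite w0 rnorm0 mulr_ge0 ?subr_ge0//.
  by apply: le_trans (fM a _); rewrite ?rnorm_ge0// lexx.
set w := cint f a b in w0 *.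
have n0 : rnorm w != 0 by apply: contra w0 => /eqP/rnorm0_eq0/eqP.
(* This rotation gives u w = - |w|, so the lower bound of [cint_re_ge] becomes the upper bound
   wanted. *)
pose u := - (w^* / (rnorm w)%:C%C).
have uw : u * w = (- rnorm w)%:C%C.
  rewrite /u mulNr mulrAC [w^* * w]mulrC -normCK -rnorm_sqr rmorphXn/= expr2 mulfK.
    by rewrite rmorphN.
  by rewrite (inj_eq (@complexI R) _ 0).
have nu : rnorm u = 1.
  rewrite /u rnormN rnormM rnormV rnorm_conj.
  have -> : rnorm (rnorm w)%:C%C = rnorm w.
    by rewrite rnorm_real ?rnorm_ge0.
  by rewrite divff.
have := @cint_re_ge f a b u (- M) ab fc; rewrite -/w uw /= mulNr lerN2; apply=> x xab.
have h := le_trans (re_le (u * f x)) _; have := h (rnorm (f x)); rewrite rnormM nu mul1r lexx.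
by move=> /(_ isT); rewrite ler_norml => /andP[+ _]; apply: le_trans; rewrite lerN2 fM.
Qed.

Definition econt (k : C -> C) z := forall e : R, 0 < e -> exists2 d : R, 0 < d &
  forall w, rnorm (w - z) < d -> rnorm (k w - k z) < e.

Lemma econt_edge (k : C -> C) (p : R -> C) a b :
  (forall x y, rnorm (p x - p y) <= `|x - y|) ->
  (forall x, a <= x <= b -> econt k (p x)) -> ccon_on (k \o p) a b.
Proof.
move=> pl kp; split=> x xab e e0; have [d d0 h] := kp x xab e e0; exists d => // y yab xy.
  rewrite distrC /= -reB (le_lt_trans (re_le _))// h// rdistC.
  exact: le_lt_trans (pl _ _) xy.
rewrite distrC /= -imB (le_lt_trans (im_le _))// h// rdistC.
exact: le_lt_trans (pl _ _) xy.
Qed.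

Lemma horiz_lip (c : R) x y : rnorm (Complex x c - Complex y c) <= `|x - y|.
Proof.
by rewrite (le_trans (rnorm_le_reim _))// reB imB /= subrr normr0 addr0.
Qed.

Lemma vert_lip (c : R) x y : rnorm (Complex c x - Complex c y) <= `|x - y|.
Proof.
by rewrite (le_trans (rnorm_le_reim _))// reB imB /= subrr normr0 add0r.
Qed.

(** The integral of k along the boundary of [a, b] x [c, d], counterclockwise, with dz = i dy on the
    vertical edges. *)
Definition rect (k : C -> C) a b c d : C :=
  cint (fun x => k (Complex x c)) a b + Complex 0 1 * cint (fun y => k (Complex b y)) c d
  - cint (fun x => k (Complex x d)) a b - Complex 0 1 * cint (fun y => k (Complex a y)) c d.

Definition hedge (k : C -> C) a b c := forall x, a <= x <= b -> econt k (Complex x c).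
Definition vedge (k : C -> C) c d a := forall y, c <= y <= d -> econt k (Complex a y).

Lemma hedge_con k a b c : hedge k a b c -> ccon_on (fun x => k (Complex x c)) a b.
Proof. by move=> h; exact: (econt_edge (horiz_lip c)). Qed.

Lemma vedge_con k a c d : vedge k c d a -> ccon_on (fun y => k (Complex a y)) c d.
Proof. by move=> h; exact: (econt_edge (vert_lip a)). Qed.

Lemma rect_splitx k a m b c d : a <= m <= b -> hedge k a b c -> hedge k a b d ->
  rect k a b c d = rect k a m c d + rect k m b c d.
Proof.
move=> amb /hedge_con h1 /hedge_con h2; rewrite /rect.
by rewrite (cint_split amb h1) (cint_split amb h2); ring.
Qed.

Lemma rect_splity k a b c m d : c <= m <= d -> vedge k c d a -> vedge k c d b ->
  rect k a b c d = rect k a b c m + rect k a b m d.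
Proof.
move=> cmd /vedge_con h1 /vedge_con h2; rewrite /rect.
by rewrite (cint_split cmd h1) (cint_split cmd h2); ring.
Qed.

Definition border (k : C -> C) a b c d :=
  [/\ hedge k a b c, hedge k a b d, vedge k c d a & vedge k c d b].

Lemma rect_lin (k l : C -> C) (u : C) a b c d : a <= b -> c <= d ->
  border k a b c d -> border l a b c d ->
  rect (fun z => u * k z + l z) a b c d = u * rect k a b c d + rect l a b c d.
Proof.
move=> ab cd [/hedge_con k1 /hedge_con k2 /vedge_con k3 /vedge_con k4].
move=> [/hedge_con l1 /hedge_con l2 /vedge_con l3 /vedge_con l4].
by rewrite /rect !cint_lin//; ring.
Qed.

Lemma rnorm_i : rnorm (Complex 0 1 : C) = 1.
Proof.
apply/eqP; rewrite -(@eqrXn2 _ 2) ?rnorm_ge0// rnorm_sqrE /=.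
by rewrite expr0n add0r.
Qed.

Lemma rect_bound (k : C -> C) (M : R) a b c d : a <= b -> c <= d -> border k a b c d ->
  (forall x y, a <= x <= b -> c <= y <= d ->
    (x == a) || (x == b) || (y == c) || (y == d) -> rnorm (k (Complex x y)) <= M) ->
  rnorm (rect k a b c d) <= M * (2 * ((b - a) + (d - c))).
Proof.
move=> ab cd [/hedge_con k1 /hedge_con k2 /vedge_con k3 /vedge_con k4] kM.
have aa : a <= a <= b by rewrite lexx.
have bb : a <= b <= b by rewrite lexx ab.
have cc : c <= c <= d by rewrite lexx.
have dd : c <= d <= d by rewrite lexx cd.
have h1 := cint_bound ab k1 (fun x hx => kM x c hx cc ltac:(by rewrite eqxx ?orbT)).
have h2 := cint_bound ab k2 (fun x hx => kM x d hx dd ltac:(by rewrite eqxx ?orbT)).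
have h3 := cint_bound cd k3 (fun y hy => kM a y aa hy ltac:(by rewrite eqxx ?orbT)).
have h4 := cint_bound cd k4 (fun y hy => kM b y bb hy ltac:(by rewrite eqxx ?orbT)).
rewrite /rect; set A1 := cint _ _ _ in h1 *; set A4 := cint _ _ _ in h4 *.
set A2 := cint _ _ _ in h2 *; set A3 := cint _ _ _ in h3 *.
have := rnormD (A1 + Complex 0 1 * A4 - A2) (- (Complex 0 1 * A3)).
have := rnormD (A1 + Complex 0 1 * A4) (- A2); have := rnormD A1 (Complex 0 1 * A4).
rewrite !rnormN !rnormM rnorm_i !mul1r; lra.
Qed.

Lemma econt_id z : econt id z.
Proof. by move=> e e0; exists e. Qed.

Lemma econt_cst (u : C) z : econt (fun=> u) z.
Proof. by move=> e e0; exists e => // w _; rewrite subrr rnorm0. Qed.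

Lemma rect_cst (u : C) a b c d : a <= b -> c <= d -> rect (fun=> u) a b c d = 0.
Proof. by move=> ab cd; rewrite /rect; ring. Qed.

Lemma rect_id a b c d : a <= b -> c <= d -> rect id a b c d = 0.
Proof.
move=> ab cd; rewrite /rect /cint.
have e1 : re \o (fun x => id (Complex x c)) = id by [].
have e2 (t : R) : (fun x => re (id (Complex x t))) = id by [].
apply: complexP; rewrite !(reB, reD, imB, imD, reM, imM) /=.
  rewrite !(@rint_ext _ (re \o (fun x => id (Complex x _))) id)//.
  rewrite !(@rint_ext _ (im \o (fun y => id (Complex _ y))) id)//.
  rewrite !rint_id//; ring.
rewrite [rint (im \o (fun x => id (Complex x c))) _ _](rint_cst c ab).
rewrite [rint (im \o (fun x => id (Complex x d))) _ _](rint_cst d ab).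
rewrite [rint (re \o (fun x => id (Complex a x))) _ _](rint_cst a cd).
rewrite [rint (re \o (fun x => id (Complex b x))) _ _](rint_cst b cd).
ring.
Qed.

End ComplexIntegral.

Lemma itv_widen (R : realType) (a b c d x : R) : a <= c -> d <= b -> c <= x <= d -> a <= x <= b.
Proof. by move=> ac db /andP[cx xd]; rewrite (le_trans ac cx) (le_trans xd db). Qed.

Lemma itv_dist (R : realType) (c d x y : R) : c <= x <= d -> c <= y <= d -> `|x - y| <= d - c.
Proof. by move=> hx hy; rewrite ler_norml; apply/andP; split; lra. Qed.

(** * Goursat's theorem for rectangles *)

Section Goursat.
Variable R : realType.
Local Notation C := R[i].
Implicit Types (k : C -> C) (z w : C).

Definition cdiff_at k z (u : C) := forall e : R, 0 < e -> exists2 d : R, 0 < d &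
  forall w, rnorm (w - z) < d -> rnorm (k w - k z - u * (w - z)) <= e * rnorm (w - z).

Lemma cdiff_econt k z u : cdiff_at k z u -> econt k z.
Proof.
move=> kz e e0; have [d d0 h] := kz 1 ltr01.
have u0 : 0 < 1 + rnorm u by rewrite ltr_pwDl ?rnorm_ge0.
exists (Num.min d (e / (1 + rnorm u))); first by rewrite lt_min d0 divr_gt0.
move=> w; rewrite lt_min => /andP[/h wd]; rewrite ltr_pdivlMr// => we.
have -> : k w - k z = (k w - k z - u * (w - z)) + u * (w - z) by rewrite subrK.
apply: (le_lt_trans (rnormD _ _)); apply: le_lt_trans we.
rewrite rnormM [leRHS]mulrDr mulr1 [rnorm u * _]mulrC lerD//.
by move: wd; rewrite mul1r.
Qed.

Variables (k : C -> C) (a b c d : R).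
Hypothesis ab : a <= b.
Hypothesis cd : c <= d.
Hypothesis kd : forall x y, a <= x <= b -> c <= y <= d -> exists u, cdiff_at k (Complex x y) u.

Let sub (r : R * R * R * R) := [/\ a <= r.1.1.1, r.1.1.1 <= r.1.1.2, r.1.1.2 <= b &
  [/\ c <= r.1.2, r.1.2 <= r.2 & r.2 <= d]].

Let rct (r : R * R * R * R) := rect k r.1.1.1 r.1.1.2 r.1.2 r.2.

Let kc x y : a <= x <= b -> c <= y <= d -> econt k (Complex x y).
Proof. by move=> hx hy; have [u] := kd hx hy; exact: cdiff_econt. Qed.

Let half (r s : R * R * R * R) :=
  [/\ sub s, r.1.1.1 <= s.1.1.1, s.1.1.2 <= r.1.1.2 /\ s.1.1.2 - s.1.1.1 = (r.1.1.2 - r.1.1.1) / 2,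
      r.1.2 <= s.1.2 & s.2 <= r.2 /\ s.2 - s.1.2 = (r.2 - r.1.2) / 2] /\
  rnorm (rct r) <= 4 * rnorm (rct s).

(** One of the four quarters carries at least a fourth of the integral, since the four add up to it.
    The hypothesis [sub r] stands under the existential so that [choice] yields a total function to
    iterate. *)
Let halve r : exists s, sub r -> half r s.
Proof.
case: r => [[[x1 x2] y1] y2].
have [|ns] := pselect (sub (x1, x2, y1, y2)); last by exists (x1, x2, y1, y2).
move=> /[dup] sr [/= ax x12 xb [cy y12 yd]].
have [p p0 x2E] : exists2 p, 0 <= p & x2 = x1 + p + p by exists ((x2 - x1) / 2); lra.
have [t t0 y2E] : exists2 t, 0 <= t & y2 = y1 + t + t by exists ((y2 - y1) / 2); lra.
subst x2 y2; set r := (x1, x1 + p + p, y1, y1 + t + t).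
pose s u v := (u, u + p, v, v + t).
have hh u v l : a <= u -> v <= b -> c <= l <= d -> hedge k u v l.
  by move=> au vb lcd x hx; apply: kc => //; exact: itv_widen hx.
have hv u v l : c <= u -> v <= d -> a <= l <= b -> vedge k u v l.
  by move=> au vb lcd x hx; apply: kc => //; exact: itv_widen hx.
have E : rct r = rct (s x1 y1) + rct (s x1 (y1 + t)) + (rct (s (x1 + p) y1) + rct (s (x1 + p) (y1 + t))).
  rewrite /rct/= (@rect_splitx _ k x1 (x1 + p)); last 3 first.
  - by rewrite !lerDl p0.
  - by apply: hh; lra.
  - by apply: hh; lra.
  rewrite (@rect_splity _ k x1 (x1 + p) y1 (y1 + t)); last 3 first.
  - by rewrite !lerDl t0.
  - by apply: hv; lra.
  - by apply: hv; lra.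
  rewrite (@rect_splity _ k (x1 + p) _ y1 (y1 + t))//.
  - by rewrite !lerDl t0.
  - by apply: hv; lra.
  - by apply: hv; lra.
apply: contrapT => H.
have no u v : x1 <= u <= x1 + p -> y1 <= v <= y1 + t -> 4 * rnorm (rct (s u v)) < rnorm (rct r).
  move=> /andP[u1 u2] /andP[v1 v2]; rewrite ltNge; apply/negP => h; apply: H; exists (s u v) => _.
  by split=> //; clear E hh hv h; do ?split; rewrite /=; lra.
have px : x1 <= x1 <= x1 + p by rewrite lexx lerDl.
have pp : x1 <= x1 + p <= x1 + p by rewrite lexx lerDl p0.
have py : y1 <= y1 <= y1 + t by rewrite lexx lerDl.
have pt : y1 <= y1 + t <= y1 + t by rewrite lexx lerDl t0.
have h1 := no _ _ px py; have h2 := no _ _ px pt; have h3 := no _ _ pp py; have h4 := no _ _ pp pt.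
have := rnormD (rct (s x1 y1) + rct (s x1 (y1 + t)))
  (rct (s (x1 + p) y1) + rct (s (x1 + p) (y1 + t))).
have := rnormD (rct (s x1 y1)) (rct (s x1 (y1 + t))).
have := rnormD (rct (s (x1 + p) y1)) (rct (s (x1 + p) (y1 + t))).
rewrite -E; lra.
Qed.

Lemma goursat : rect k a b c d = 0.
Proof.
have [s hs] := choice halve.
pose u n := iter n s (a, b, c, d).
have su n : sub (u n).
  elim: n => [|n IH]; first by split=> //; split.
  by have [[]] := hs _ IH.
have hu n : half (u n) (u n.+1) by exact: hs (su n).
have mono n m : (n <= m)%N -> [/\ (u n).1.1.1 <= (u m).1.1.1, (u m).1.1.2 <= (u n).1.1.2,
    (u n).1.2 <= (u m).1.2 & (u m).2 <= (u n).2].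
  move=> /subnKC <-; elim: (m - n)%N => [|q [h1 h2 h3 h4]]; first by rewrite addn0.
  rewrite addnS; have [[_ i1 [i2 _] i3 [i4 _]] _] := hu (n + q)%N.
  by split; [exact: le_trans i1|exact: le_trans h2|exact: le_trans i3|exact: le_trans h4].
have len n : (u n).1.1.2 - (u n).1.1.1 = (b - a) / 2 ^+ n /\ (u n).2 - (u n).1.2 = (d - c) / 2 ^+ n.
  elim: n => [|n [IH1 IH2]]; first by rewrite expr0 !divr1.
  have [[_ _ [_ e1] _ [_ e2]] _] := hu n.
  by rewrite e1 e2 IH1 IH2 exprS; split; field; rewrite expf_neq0.
have big n : rnorm (rect k a b c d) <= 4 ^+ n * rnorm (rct (u n)).
  elim: n => [|n IH]; first by rewrite expr0 mul1r.
  apply: (le_trans IH); rewrite exprSr -mulrA ler_wpM2l ?exprn_ge0//.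
  by have [] := hu n.
pose xs := sup (range (fun n => (u n).1.1.1)); pose ys := sup (range (fun n => (u n).1.2)).
have ubx m n : (u n).1.1.1 <= (u m).1.1.2.
  have [h1 _ _ _] := mono _ _ (leq_maxl n m); have [_ h2 _ _] := mono _ _ (leq_maxr n m).
  by have [_ h3 _ _] := su (maxn n m); exact: le_trans h1 (le_trans h3 h2).
have uby m n : (u n).1.2 <= (u m).2.
  have [_ _ h1 _] := mono _ _ (leq_maxl n m); have [_ _ _ h2] := mono _ _ (leq_maxr n m).
  by have [_ _ _ [_ h3 _]] := su (maxn n m); exact: le_trans h1 (le_trans h3 h2).
have xin n : (u n).1.1.1 <= xs <= (u n).1.1.2.
  apply/andP; split.
    by apply: ub_le_sup; [exists (u 0%N).1.1.2 => _ [m _ <-]; exact: ubx|exists n].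
  by apply: ge_sup; [exists (u 0%N).1.1.1, 0%N|move=> _ [m _ <-]; exact: ubx].
have yin n : (u n).1.2 <= ys <= (u n).2.
  apply/andP; split.
    by apply: ub_le_sup; [exists (u 0%N).2 => _ [m _ <-]; exact: uby|exists n].
  by apply: ge_sup; [exists (u 0%N).1.2, 0%N|move=> _ [m _ <-]; exact: uby].
pose zs := Complex xs ys.
have [v kv] := kd (xin 0%N) (yin 0%N).
pose L := (b - a) + (d - c).
have L0 : 0 <= L by rewrite addr_ge0 ?subr_ge0.
apply: rnorm0_eq0; apply/eqP; rewrite eq_le rnorm_ge0 andbT; apply/ler_addgt0Pr => e e0; rewrite add0r.
(* After N bisections the half-perimeter is q = L / 2^N, and the affine remainder contributes at
   most e' q * 2 q. As 4^N q^2 = L^2, the total is 2 e' L^2 <= e; the summand 1 avoids division by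
   0. *)
pose e' := e / (2 * L ^+ 2 + 1).
have D0 : 0 < 2 * L ^+ 2 + 1 by rewrite ltr_wpDl// mulr_ge0// sqr_ge0.
have [r r0 kr] := kv e' (divr_gt0 e0 D0).
have e'0 : 0 < e' by rewrite divr_gt0.
have [||N hN] := @expr_small R (1 / 2) (r / (L + 1)).
- by apply/andP; split; lra.
- by rewrite divr_gt0// ltr_wpDl.
have := hN N (leqnn N); rewrite ltr_pdivlMr ?ltr_wpDl// expr_div_n expr1n mul1r => NL.
have [e1 e2] := len N.
have [a1 a2 a3 [a4 a5 a6]] := su N.
move: (xin N) (yin N) (big N) e1 e2 a1 a2 a3 a4 a5 a6; rewrite /rct.
move: ((u N).1.1.1) ((u N).1.1.2) ((u N).1.2) ((u N).2) => x1 x2 y1 y2 xz yz bg e1 e2 a1 a2 a3 a4 a5 a6.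
have h2 : 0 < 2 ^+ N :> R by rewrite exprn_gt0.
pose q := L / 2 ^+ N.
have q0 : 0 <= q by rewrite divr_ge0// ltW.
have qE : (x2 - x1) + (y2 - y1) = q by rewrite e1 e2 -mulrDl.
have qr : q < r.
  apply: le_lt_trans NL; rewrite /q mulrC ler_wpM2l ?invr_ge0 ?ltW//; lra.
(* [E] is k minus its affine approximation at the point common to all the rectangles; affine
   functions integrate to 0 over a rectangle. *)
pose E z := k z - k zs - v * (z - zs).
have kin x y : x1 <= x <= x2 -> y1 <= y <= y2 -> econt k (Complex x y).
  by move=> hx hy; apply: kc; [exact: itv_widen hx|exact: itv_widen hy].
have bk : border k x1 x2 y1 y2.
  by split=> t ht; apply: kin => //; apply/andP; split.
have baff (α β : C) : border (fun z => α * id z + β) x1 x2 y1 y2.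
  have ea z : econt (fun z => α * id z + β) z.
    apply: (@cdiff_econt _ _ α) => f f0; exists 1 => // w _.
    by rewrite (_ : _ - _ = 0) ?rnorm0 ?mulr_ge0 ?rnorm_ge0 ?ltW//; ring.
  by split=> t ht; exact: ea.
have bid : border id x1 x2 y1 y2 by split=> t ht; exact: econt_id.
have bcst (β : C) : border (fun=> β) x1 x2 y1 y2 by split=> t ht; exact: econt_cst.
have x12 : x1 <= x2 by [].
have raff (α β : C) : rect (fun z => α * id z + β) x1 x2 y1 y2 = 0.
  by rewrite rect_lin// rect_id// rect_cst// mulr0 addr0.
have EE : E = (fun z => 1 * k z + (- v * id z + (v * zs - k zs))).
  by apply/funext => z; rewrite /E /=; ring.
have rE : rect k x1 x2 y1 y2 = rect E x1 x2 y1 y2.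
  by rewrite EE rect_lin// raff addr0 mul1r.
have bE : border E x1 x2 y1 y2.
  have eE x y : x1 <= x <= x2 -> y1 <= y <= y2 -> econt E (Complex x y).
    move=> hx hy; have [w kw] := kd (itv_widen a1 a3 hx) (itv_widen a4 a6 hy).
    apply: (@cdiff_econt _ _ (w - v)) => f f0; have [t t0 ht] := kw f f0; exists t => // z zt.
    have := ht z zt; congr (rnorm _ <= _); rewrite /E; ring.
  by split=> t ht; apply: eE => //; apply/andP; split.
have := rect_bound x12 a5 bE (M := e' * q) _.
rewrite -rE qE => hb.
have {}hb : rnorm (rect k x1 x2 y1 y2) <= e' * q * (2 * q).
  apply: hb => x y hx hy _.
  have nz : rnorm (Complex x y - zs) <= q.
    by apply: (le_trans (rnorm_le_reim _)); rewrite reB imB /= -qE; apply: lerD; exact: itv_dist.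
  apply: (le_trans (kr _ (le_lt_trans nz qr))); rewrite ler_wpM2l// ltW//.
apply: (le_trans bg); apply: (@le_trans _ _ (4 ^+ N * (e' * q * (2 * q)))).
  by rewrite ler_wpM2l ?exprn_ge0.
have -> : 4 ^+ N * (e' * q * (2 * q)) = e' * (2 * L ^+ 2).
  rewrite /q (_ : 4 = 2 ^+ 2 :> R); last by rewrite expr2; lra.
  by rewrite -exprM mulnC exprM; field; rewrite gt_eqF.
by rewrite /e' mulrAC ler_pdivrMr// ler_wpM2l ?ltW// ?ltrDl.
Qed.

End Goursat.

(** * Cauchy's estimate for the derivative *)

Section CauchyEstimate.
Variable R : realType.
Local Notation C := R[i].
Local Notation re := (@complex.Re R).
Local Notation im := (@complex.Im R).
Implicit Types (k l g : C -> C) (z w : C).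

Lemma cdiff_lin k l z u v (a : C) : cdiff_at k z u -> cdiff_at l z v ->
  cdiff_at (fun w => a * k w + l w) z (a * u + v).
Proof.
move=> kz lz e e0.
have a0 : 0 < rnorm a + 1 by rewrite ltr_wpDl ?rnorm_ge0.
have [d d0 hd] := kz (e / 2 / (rnorm a + 1)) (divr_gt0 (divr_gt0 e0 (ltr0Sn _ 1)) a0).
have [r r0 hr] := lz (e / 2) (divr_gt0 e0 (ltr0Sn _ 1)).
exists (Num.min d r); first by rewrite lt_min d0.
move=> w; rewrite lt_min => /andP[/hd h1 /hr h2].
have -> : a * k w + l w - (a * k z + l z) - (a * u + v) * (w - z) =
   a * (k w - k z - u * (w - z)) + (l w - l z - v * (w - z)) by ring.
apply: (le_trans (rnormD _ _)); rewrite (splitr e) mulrDl lerD// rnormM.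
apply: (@le_trans _ _ (rnorm a * (e / 2 / (rnorm a + 1) * rnorm (w - z)))).
  by rewrite ler_wpM2l ?rnorm_ge0.
rewrite mulrA ler_wpM2r ?rnorm_ge0// mulrCA ler_piMr ?divr_ge0 ?ltW//.
by rewrite ltr_pdivrMr// mul1r ltrDl.
Qed.

Lemma cdiff_cst (c : C) z : cdiff_at (fun=> c) z 0.
Proof.
by move=> e e0; exists 1 => // w _; rewrite mul0r !subrr rnorm0 mulr_ge0 ?rnorm_ge0// ltW.
Qed.

Lemma cdiff_mul k l z u v : cdiff_at k z u -> cdiff_at l z v ->
  cdiff_at (fun w => k w * l w) z (u * l z + k z * v).
Proof.
move=> kz lz e e0.
pose A := rnorm (l z) + 1; pose B := rnorm (k z) + 1; pose D := rnorm u + 1.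
have A0 : 0 < A by rewrite ltr_wpDl ?rnorm_ge0.
have B0 : 0 < B by rewrite ltr_wpDl ?rnorm_ge0.
have D0 : 0 < D by rewrite ltr_wpDl ?rnorm_ge0.
have e3 : 0 < e / 3 by rewrite divr_gt0.
have [d1 d10 h1] := kz (e / 3 / A) (divr_gt0 e3 A0).
have [d2 d20 h2] := lz (e / 3 / B) (divr_gt0 e3 B0).
have [d3 d30 h3] := cdiff_econt lz (divr_gt0 e3 D0).
have [d4 d40 h4] := cdiff_econt lz ltr01.
exists (Num.min (Num.min d1 d2) (Num.min d3 d4)).
  by rewrite !lt_min d10 d20 d30.
move=> w; rewrite !lt_min => /andP[/andP[/h1 w1 /h2 w2] /andP[/h3 w3 /h4 w4]].
have -> : k w * l w - k z * l z - (u * l z + k z * v) * (w - z) =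
  (k w - k z - u * (w - z)) * l w + k z * (l w - l z - v * (w - z)) + u * (w - z) * (l w - l z).
  by ring.
have n0 := rnorm_ge0 (w - z).
have lw : rnorm (l w) <= A.
  have -> : l w = l z + (l w - l z) by rewrite addrC subrK.
  by rewrite (le_trans (rnormD _ _))// lerD2l ltW.
have t1 : rnorm ((k w - k z - u * (w - z)) * l w) <= e / 3 * rnorm (w - z).
  rewrite rnormM (_ : e / 3 * rnorm (w - z) = e / 3 / A * rnorm (w - z) * A).
    by rewrite ler_pM ?rnorm_ge0.
  by field; rewrite gt_eqF.
have t2 : rnorm (k z * (l w - l z - v * (w - z))) <= e / 3 * rnorm (w - z).
  rewrite rnormM (_ : e / 3 * rnorm (w - z) = B * (e / 3 / B * rnorm (w - z))).
    by rewrite ler_pM ?rnorm_ge0// lerDl.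
  by field; rewrite gt_eqF.
have t3 : rnorm (u * (w - z) * (l w - l z)) <= e / 3 * rnorm (w - z).
  rewrite !rnormM (_ : e / 3 * rnorm (w - z) = D * rnorm (w - z) * (e / 3 / D)).
    by rewrite ler_pM ?mulr_ge0 ?rnorm_ge0// ?(ltW w3)// ler_wpM2r// lerDl.
  by field; rewrite gt_eqF.
apply: (le_trans (rnormD _ _)).
have := rnormD ((k w - k z - u * (w - z)) * l w) (k z * (l w - l z - v * (w - z))).
lra.
Qed.

Lemma cdiff_inv z : z != 0 -> cdiff_at (fun w => w^-1) z (- (z^-1 * z^-1)).
Proof.
move=> z0 e e0; have n0 : 0 < rnorm z.
  by rewrite lt_def rnorm_ge0 andbT; apply: contra z0 => /eqP/rnorm0_eq0/eqP.
pose B := 2 / rnorm z ^+ 3.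
have B0 : 0 < B by rewrite divr_gt0// exprn_gt0.
exists (Num.min (rnorm z / 2) (e / B)); first by rewrite lt_min; apply/andP; split; apply: divr_gt0.
move=> w; rewrite lt_min => /andP[wz we].
have wn : rnorm z / 2 <= rnorm w.
  by have := rnormD (z - w) w; rewrite subrK rdistC; lra.
have w0 : w != 0 by apply/negP => /eqP w0; move: wn; rewrite w0 rnorm0; lra.
have -> : w^-1 - z^-1 - - (z^-1 * z^-1) * (w - z) = (w - z) * (w - z) * (w^-1 * (z^-1 * z^-1)).
  by field; rewrite z0.
rewrite !rnormM !rnormV.
have wi : (rnorm w)^-1 <= 2 / rnorm z.
  by rewrite -[2 / _]invf_div lef_pV2 ?posrE//; lra.
have h : (rnorm w)^-1 * ((rnorm z)^-1 * (rnorm z)^-1) <= B.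
  apply: (@le_trans _ _ (2 / rnorm z * ((rnorm z)^-1 * (rnorm z)^-1))).
    by rewrite ler_wpM2r// mulr_ge0// invr_ge0 ltW.
  by rewrite /B le_eqVlt; apply/orP; left; apply/eqP; field; rewrite gt_eqF.
rewrite ltr_pdivlMr// in we.
rewrite -mulrA mulrC; apply: ler_wpM2r; first exact: rnorm_ge0.
by apply: le_trans (ltW we); rewrite ler_wpM2l ?rnorm_ge0.
Qed.

Lemma econt_cdiff_border k a b c d :
  (forall x y, a <= x <= b -> c <= y <= d -> (x == a) || (x == b) || (y == c) || (y == d) ->
    exists u, cdiff_at k (Complex x y) u) -> a <= b -> c <= d -> border k a b c d.
Proof.
move=> h ab cd; have hc : c <= c <= d by rewrite lexx.
have hd : c <= d <= d by rewrite lexx cd.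
have ha : a <= a <= b by rewrite lexx.
have hb : a <= b <= b by rewrite lexx ab.
split=> t ht.
- by have [|u /cdiff_econt] := h t c ht hc; rewrite ?eqxx ?orbT.
- by have [|u /cdiff_econt] := h t d ht hd; rewrite ?eqxx ?orbT.
- by have [|u /cdiff_econt] := h a t ha ht; rewrite ?eqxx ?orbT.
- by have [|u /cdiff_econt] := h b t hb ht; rewrite ?eqxx ?orbT.
Qed.

Lemma rnorm_square_ge (s x y : R) : 0 <= s ->
  (x == - s) || (x == s) || (y == - s) || (y == s) -> s <= rnorm (Complex x y : C).
Proof.
move=> s0; have nx := re_le (Complex x y); have ny := im_le (Complex x y).
case/orP => [/orP[/orP[]|]|] /eqP e1.
- by apply: le_trans nx; rewrite e1 normrN ger0_norm.
- by apply: le_trans nx; rewrite e1 ger0_norm.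
- by apply: le_trans ny; rewrite e1 normrN ger0_norm.
- by apply: le_trans ny; rewrite e1 ger0_norm.
Qed.

(* [rect (1/z)] is [2 pi i]; only its size matters. *)
Lemma rect_inv_ge (s : R) : 0 < s -> 4 <= im (rect (fun z : C => z^-1) (- s) s (- s) s).
Proof.
move=> s0; have ss : - s <= s by lra.
have hb : border (fun z : C => z^-1) (- s) s (- s) s.
  apply: econt_cdiff_border => // x y _ _ hxy; exists (- ((Complex x y)^-1 * (Complex x y)^-1)).
  apply: cdiff_inv; apply/eqP => -[x0 y0].
  by move: hxy; rewrite x0 y0 => /orP[/orP[/orP[]|]|] /eqP; lra.
have [/hedge_con h1 /hedge_con h2 /vedge_con h3 /vedge_con h4] := hb.
(* The real part met on each edge below is s / (x^2 + s^2), at least 1 / (2 s); over the length 2 s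
   each edge contributes at least 1. *)
have sq x : - s <= x <= s -> (2 * s)^-1 <= s / (x ^+ 2 + s ^+ 2).
  move=> hx; have p : 0 < x ^+ 2 + s ^+ 2 by rewrite ltr_wpDl ?sqr_ge0// exprn_gt0.
  rewrite ler_pdivlMr// mulrC ler_pdivrMr ?mulr_gt0//.
  have : x ^+ 2 <= s ^+ 2 by case/andP: hx => ? ?; nra.
  by nra.
have E : (2 * s)^-1 * (s - - s) = 1 by field; rewrite gt_eqF.
have iE (p q x y : R) : re (Complex p q * (Complex x y : C)^-1) = (p * x + q * y) / (x ^+ 2 + y ^+ 2).
  rewrite reM; change (p * (x / (x ^+ 2 + y ^+ 2)) - q * (- (y / (x ^+ 2 + y ^+ 2))) =
    (p * x + q * y) / (x ^+ 2 + y ^+ 2)); ring.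
have b1 : 1 <= re (Complex 0 (-1) * cint (fun x => (Complex x (- s) : C)^-1) (- s) s).
  rewrite -[leLHS]E; apply: cint_re_ge => // x hx; apply: (le_trans (sq x hx)).
  by rewrite iE ?sqrrN ?(addrC (s ^+ 2)) !(mul0r, mul1r, mulN1r, opprK, add0r, addr0, lexx).
have b2 : 1 <= re (Complex 0 1 * cint (fun x => (Complex x s : C)^-1) (- s) s).
  rewrite -[leLHS]E; apply: cint_re_ge => // x hx; apply: (le_trans (sq x hx)).
  by rewrite iE ?sqrrN ?(addrC (s ^+ 2)) !(mul0r, mul1r, mulN1r, opprK, add0r, addr0, lexx).
have b3 : 1 <= re (Complex (-1) 0 * cint (fun y => (Complex (- s) y : C)^-1) (- s) s).
  rewrite -[leLHS]E; apply: cint_re_ge => // x hx; apply: (le_trans (sq x hx)).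
  by rewrite iE ?sqrrN ?(addrC (s ^+ 2)) !(mul0r, mul1r, mulN1r, opprK, add0r, addr0, lexx).
have b4 : 1 <= re (Complex 1 0 * cint (fun y => (Complex s y : C)^-1) (- s) s).
  rewrite -[leLHS]E; apply: cint_re_ge => // x hx; apply: (le_trans (sq x hx)).
  by rewrite iE ?sqrrN ?(addrC (s ^+ 2)) !(mul0r, mul1r, mulN1r, opprK, add0r, addr0, lexx).
move: b1 b2 b3 b4; rewrite /rect.
move: (cint _ _ _) (cint _ _ _) (cint _ _ _) (cint _ _ _) => [? ?] [? ?] [? ?] [? ?].
by rewrite !(reM, imD, imB, imM) /=; lra.
Qed.

Lemma cdiff_ext k l z u v : cdiff_at k z u -> (forall w, k w = l w) -> u = v -> cdiff_at l z v.
Proof. by move=> kz kl <-; rewrite -(funext kl). Qed.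

Lemma cdiff_shift k a z u : cdiff_at k (a + z) u -> cdiff_at (fun w => k (a + w)) z u.
Proof.
move=> kz e e0; have [d d0 h] := kz e e0; exists d => // w wz.
by have := h (a + w); rewrite opprD addrACA subrr add0r; exact.
Qed.

Lemma econt_cdiff_pt k z : (exists u, cdiff_at k z u) -> econt k z.
Proof. by case=> u; exact: cdiff_econt. Qed.

(* A singularity weaker than [1/z] does not contribute. *)
Lemma rect_punctured k (s : R) : 0 < s ->
  (forall x y, - s <= x <= s -> - s <= y <= s -> (Complex x y : C) != 0 ->
     exists u, cdiff_at k (Complex x y) u) ->
  (forall e : R, 0 < e -> exists2 d : R, 0 < d & forall z, z != 0 -> rnorm z < d ->
     rnorm (k z) * rnorm z <= e) ->
  rect k (- s) s (- s) s = 0.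
Proof.
move=> s0 kd ks.
have nz x y : (x != 0) || (y != 0) -> (Complex x y : C) != 0.
  by rewrite -negb_and; apply: contra => /eqP[-> ->]; rewrite eqxx.
suff small e : 0 < e -> rnorm (rect k (- s) s (- s) s) <= 8 * e.
  apply: rnorm0_eq0; apply/eqP; rewrite eq_le rnorm_ge0 andbT; apply/ler_addgt0Pr => e e0.
  have := small (e / 8); rewrite add0r mulrCA divff ?mulr1//; apply.
  by rewrite divr_gt0.
move=> e0; have [d d0 kz] := ks e e0.
(* The points of the square of half-side t have norm at most 2 t < d, so [kz] applies to them. The
   four rectangles around this square vanish by [goursat]. *)
pose t := Num.min (d / 3) (s / 2).
have t0 : 0 < t by rewrite lt_min; apply/andP; split; apply: divr_gt0.
have td : t <= d / 3 by rewrite ge_min lexx.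
have ts : t <= s / 2 by rewrite ge_min lexx orbT.
have ed a b c : - s <= a -> b <= s -> - s <= c <= s -> c != 0 -> hedge k a b c.
  move=> ha hb hc c0 x hx; apply: econt_cdiff_pt; apply: kd => //; first exact: itv_widen hx.
  by apply: nz; rewrite c0 orbT.
have ve a b c : - s <= a -> b <= s -> - s <= c <= s -> c != 0 -> vedge k a b c.
  move=> ha hb hc c0 x hx; apply: econt_cdiff_pt; apply: kd => //; first exact: itv_widen hx.
  by apply: nz; rewrite c0.
have g0 a b c c' : - s <= a -> a <= b -> b <= s -> - s <= c -> c <= c' -> c' <= s ->
    (0 < a) || (b < 0) || (0 < c) || (c' < 0) -> rect k a b c c' = 0.
  move=> h1 h2 h3 h4 h5 h6 h7; apply: goursat => // x y hx hy.
  apply: kd; [exact: itv_widen hx|exact: itv_widen hy|]; move: hx hy => /andP[h8 h9] /andP[h10 h11].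
  apply: nz; rewrite -negb_and; apply/negP => /andP[/eqP x0 /eqP y0].
  by move: h7; rewrite -orbA => /orP[/orP[]|/orP[]]; lra.
have t1 : - s <= - t by lra.
have t2 : t <= s by lra.
have t3 : - t <= s by lra.
have t4 : - s <= t by lra.
have tt : - t <= t by lra.
have ss : - s <= s by lra.
have nt0 : - t < 0 by rewrite oppr_lt0.
have st : - s <= - t <= s by rewrite t1.
have st' : - s <= t <= s by rewrite t4.
have hs : - s <= - s <= s by rewrite lexx.
have hs' : - s <= s <= s by rewrite ss lexx.
have ns : - s != 0 by rewrite oppr_eq0 gt_eqF.
have ps : s != 0 by rewrite gt_eqF.
have nt : - t != 0 by rewrite oppr_eq0 gt_eqF.
have pt : t != 0 by rewrite gt_eqF.
rewrite (@rect_splitx _ k (- s) (- t) s (- s) s); last 3 first.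
- by rewrite ?t1 ?t2 ?tt ?t3.
- exact: ed.
- exact: ed.
rewrite (_ : rect k (- s) (- t) (- s) s = 0) ?add0r; last by apply: g0; rewrite ?t0 ?nt0 ?orbT.
rewrite (@rect_splitx _ k (- t) t s (- s) s); last 3 first.
- by rewrite ?t1 ?t2 ?tt ?t3.
- exact: ed.
- exact: ed.
rewrite (_ : rect k t s (- s) s = 0) ?addr0; last by apply: g0; rewrite ?t0 ?nt0 ?orbT.
rewrite (@rect_splity _ k (- t) t (- s) (- t) s); last 3 first.
- by rewrite ?t1 ?t2 ?tt ?t3.
- exact: ve.
- exact: ve.
rewrite (_ : rect k (- t) t (- s) (- t) = 0) ?add0r; last by apply: g0; rewrite ?t0 ?nt0 ?orbT.
rewrite (@rect_splity _ k (- t) t (- t) t s); last 3 first.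
- by rewrite ?t1 ?t2 ?tt ?t3.
- exact: ve.
- exact: ve.
rewrite (_ : rect k (- t) t t s = 0) ?addr0; last by apply: g0; rewrite ?t0 ?nt0 ?orbT.
have bt : border k (- t) t (- t) t.
  by split; [exact: ed|exact: ed|exact: ve|exact: ve].
have -> : 8 * e = e / t * (2 * ((t - - t) + (t - - t))) by field; rewrite gt_eqF.
apply: rect_bound => // x y hx hy hxy.
have zt := rnorm_square_ge (ltW t0) hxy.
rewrite ler_pdivlMr//; apply: le_trans (kz (Complex x y) _ _).
- by rewrite ler_wpM2l ?rnorm_ge0.
- by apply/eqP => z0; move: zt; rewrite z0 rnorm0; lra.
- have h := rnorm_le_reim (Complex x y : C); apply: (le_lt_trans h) => /=.
  have : `|x| <= t by rewrite ler_norml.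
  have : `|y| <= t by rewrite ler_norml.
  lra.
Qed.

(* Integrate [(g z - g 0) / z^2 - c / z] around a square centred at 0. *)
Lemma cauchy_estimate0 g (c : C) (r M : R) : 0 < r ->
  (forall z, rnorm z < r -> exists u, cdiff_at g z u) ->
  (forall z, rnorm z < r -> rnorm (g z) <= M) -> cdiff_at g 0 c ->
  rnorm c <= 12 * M / r.
Proof.
(* Points of the square of half-side s have norm at most 2 s < r. *)
move=> r0 gd gM gc; pose s := r / 3.
have s0 : 0 < s by rewrite divr_gt0.
have ss : - s <= s by lra.
have inr x y : - s <= x <= s -> - s <= y <= s -> rnorm (Complex x y : C) < r.
  move=> hx hy; apply: (le_lt_trans (rnorm_le_reim _)) => /=.
  have : `|x| <= s by rewrite ler_norml.
  have : `|y| <= s by rewrite ler_norml.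
  have rs : r = 3 * s by rewrite /s; field.
  lra.
pose a z := (g z - g 0) * (z^-1 * z^-1).
pose k z := (- c) * z^-1 + a z.
have ad z : rnorm z < r -> z != 0 -> exists u, cdiff_at a z u.
  move=> zr z0; have [u gu] := gd z zr.
  have h1 : cdiff_at (fun w => g w - g 0) z u.
    apply: cdiff_ext (cdiff_lin 1 gu (cdiff_cst (- g 0) z)) _ _ => [w|]; rewrite ?mul1r ?addr0//.
  by eexists; exact: cdiff_mul h1 (cdiff_mul (cdiff_inv z0) (cdiff_inv z0)).
have kd z : rnorm z < r -> z != 0 -> exists u, cdiff_at k z u.
  by move=> zr z0; have [u au] := ad z zr z0; eexists; exact: cdiff_lin (cdiff_inv z0) au.
have rk : rect k (- s) s (- s) s = 0.
  apply: rect_punctured => // [x y hx hy z0|e e0]; first by apply: kd => //; exact: inr.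
  have [d d0 h] := gc e e0; exists d => // z z0 zd.
  have nz : 0 < rnorm z.
    by rewrite lt_def rnorm_ge0 andbT; apply: contra z0 => /eqP/rnorm0_eq0/eqP.
  have := h z; rewrite subr0 => /(_ zd) hz.
  have -> : k z = (g z - g 0 - c * z) * (z^-1 * z^-1) by rewrite /k /a; field.
  rewrite !rnormM !rnormV.
  apply: (@le_trans _ _ (e * rnorm z * ((rnorm z)^-1 * (rnorm z)^-1) * rnorm z)).
    rewrite ler_wpM2r ?rnorm_ge0// ler_wpM2r// mulr_ge0// invr_ge0 rnorm_ge0//.
  by rewrite le_eqVlt; apply/orP; left; apply/eqP; field; rewrite gt_eqF.
have bnz x y := @rnorm_square_ge s x y (ltW s0).
have bnz0 x y : (x == - s) || (x == s) || (y == - s) || (y == s) -> (Complex x y : C) != 0.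
  by move=> /bnz h; apply/eqP => z0; move: h; rewrite z0 rnorm0; lra.
have bi : border (fun z : C => z^-1) (- s) s (- s) s.
  apply: econt_cdiff_border => // x y _ _ hxy.
  by eexists; apply: cdiff_inv; exact: bnz0.
have ba : border a (- s) s (- s) s.
  apply: econt_cdiff_border => // x y hx hy hxy.
  by apply: ad; [exact: inr|exact: bnz0].
have := rect_lin (- c) ss ss bi ba; rewrite -[LHS]/(rect k (- s) s (- s) s) rk mulNr => /esym/eqP.
rewrite addrC subr_eq0 => /eqP ra.
have na : rnorm (rect a (- s) s (- s) s) <= 2 * M / s ^+ 2 * (2 * ((s - - s) + (s - - s))).
  apply: rect_bound => // x y hx hy /bnz hz.
  have z0 : 0 < rnorm (Complex x y : C) by apply: lt_le_trans hz.
  rewrite /a !rnormM !rnormV -invfM ler_pdivrMr ?mulr_gt0//.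
  have gz := gM _ (inr x y hx hy).
  have g0 := gM 0; rewrite rnorm0 in g0; have {}g0 := g0 r0.
  have := rnormD (g (Complex x y)) (- g 0); rewrite rnormN => hg.
  have M0 : 0 <= M by apply: le_trans g0; exact: rnorm_ge0.
  apply: (@le_trans _ _ (2 * M)); first lra.
  rewrite mulrAC ler_pdivlMr ?exprn_gt0// ler_wpM2l ?mulr_ge0// expr2.
  by rewrite ler_pM// ltW.
have := rect_inv_ge s0; set J := rect (fun z : C => z^-1) _ _ _ _ in ra * => J4.
have {}J4 : 4 <= rnorm J.
  by apply: (le_trans J4); apply: le_trans (im_le J); rewrite ler_norm.
move: na; rewrite ra rnormM => na.
(* The boundary has length 8 s, the integrand is at most 2 M / s^2 on it, and [J] has norm at least
   4: so |c| <= 4 M / s = 12 M / r. *)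
have : rnorm c * 4 <= 2 * M / s ^+ 2 * (2 * ((s - - s) + (s - - s))).
  by apply: le_trans na; rewrite ler_wpM2l ?rnorm_ge0.
have -> : 2 * M / s ^+ 2 * (2 * ((s - - s) + (s - - s))) = (12 * M / r) * 4.
  by rewrite /s; field; rewrite gt_eqF.
lra.
Qed.

Lemma cauchy_estimate g (x c : C) (r M : R) : 0 < r ->
  (forall z, rnorm (z - x) < r -> exists u, cdiff_at g z u) ->
  (forall z, rnorm (z - x) < r -> rnorm (g z) <= M) -> cdiff_at g x c ->
  rnorm c <= 12 * M / r.
Proof.
move=> r0 gd gM gc; apply: (@cauchy_estimate0 (fun w => g (x + w))) => //.
- by move=> z zr; have [|u gu] := gd (x + z); [rewrite addrAC subrr add0r|exists u; exact: cdiff_shift].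
- by move=> z zr; apply: gM; rewrite addrAC subrr add0r.
- by apply: cdiff_shift; rewrite addr0.
Qed.

End CauchyEstimate.

(** * Mean value inequality and second-order remainders *)

Section MeanValue.
Variable R : realType.
Local Notation C := R[i].
Local Notation re := (@complex.Re R).
Local Notation im := (@complex.Im R).
Implicit Types (k l g : C -> C) (z w : C).

Lemma is_derive_smallo (u : R -> R) (t p : R) :
  (forall e : R, 0 < e -> exists2 d : R, 0 < d & forall s : R, `|s - t| < d ->
     `|u s - u t - p * (s - t)| <= e * `|s - t|) -> is_derive t 1 u p.
Proof.
move=> ut.
have h : (fun s : R => s^-1 *: (u (s *: 1 + t) - u t)) @ (0 : R)^' --> p.
  apply/cvgrPdist_le => e e0; have [d d0 hd] := ut e e0.
  exists d => // s /=; rewrite sub0r normrN => sd s0.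
  have sn : 0 < `|s| by rewrite normr_gt0.
  rewrite [s *: 1]mulr1; have := hd (s + t); rewrite addrK => /(_ sd) hs.
  rewrite -(ler_pM2r sn) -normrM; apply: le_trans hs.
  rewrite distrC le_eqVlt; apply/orP; left; apply/eqP; congr `|_|.
  by rewrite -[s^-1 *: _]/(s^-1 * _); field.
apply: DeriveDef; first by apply/cvg_ex; exists p.
exact: cvg_lim h.
Qed.

Lemma cdiff_comp k l z u v : cdiff_at k z u -> cdiff_at l (k z) v ->
  cdiff_at (l \o k) z (v * u).
Proof.
move=> kz lz e e0.
pose A := rnorm u + 1; pose B := rnorm v + 1.
have A0 : 0 < A by rewrite ltr_wpDl ?rnorm_ge0.
have B0 : 0 < B by rewrite ltr_wpDl ?rnorm_ge0.
have e2 : 0 < e / 2 by rewrite divr_gt0.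
have [d1 d10 h1] := kz (e / 2 / B) (divr_gt0 e2 B0).
have [d2 d20 h2] := lz (e / 2 / A) (divr_gt0 e2 A0).
have [d3 d30 h3] := cdiff_econt kz d20.
have [d4 d40 h4] := kz 1 ltr01.
exists (Num.min (Num.min d1 d3) d4); first by rewrite !lt_min d10 d30.
move=> w; rewrite !lt_min => /andP[/andP[/h1 w1 /h3/h2 w2] /h4 w4].
have -> : (l \o k) w - (l \o k) z - v * u * (w - z) =
  (l (k w) - l (k z) - v * (k w - k z)) + v * (k w - k z - u * (w - z)) by rewrite /=; ring.
have n0 := rnorm_ge0 (w - z).
have kA : rnorm (k w - k z) <= A * rnorm (w - z).
  have -> : k w - k z = (k w - k z - u * (w - z)) + u * (w - z) by rewrite subrK.
  by rewrite (le_trans (rnormD _ _))// rnormM /A mulrDl mul1r addrC lerD2l -[leRHS]mul1r.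
apply: (le_trans (rnormD _ _)); rewrite (splitr e) mulrDl lerD//.
  have -> : e / 2 * rnorm (w - z) = e / 2 / A * (A * rnorm (w - z)) by field; rewrite gt_eqF.
  by apply: (le_trans w2); rewrite ler_wpM2l// divr_ge0 ?ltW.
have -> : e / 2 * rnorm (w - z) = B * (e / 2 / B * rnorm (w - z)) by field; rewrite gt_eqF.
rewrite rnormM.
by rewrite ler_pM ?rnorm_ge0// lerDl.
Qed.

Lemma cdiff_affine (a b : C) z : cdiff_at (fun w => a * w + b) z a.
Proof.
move=> e e0; exists 1 => // w _; rewrite (_ : _ - _ = 0) ?rnorm0; last by ring.
by rewrite mulr_ge0 ?rnorm_ge0// ltW.
Qed.

(** The real mean value theorem for the real part of conj(w) g(x + t h), where w is the whole
    increment: its variation over [0, 1] is |w|^2. *)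
Lemma mean_value g (x h : C) (M : R) :
  (forall t : R, 0 <= t <= 1 -> exists2 u, cdiff_at g (x + t%:C%C * h) u & rnorm u <= M) ->
  rnorm (g (x + h) - g x) <= M * rnorm h.
Proof.
move=> gd; set w := g (x + h) - g x.
have M0 : 0 <= M.
  by have [|u _] := gd 0; [rewrite lexx ler01|exact: le_trans (rnorm_ge0 _)].
have [w0|w0] := eqVneq w 0; first by rewrite w0 rnorm0 mulr_ge0// rnorm_ge0.
have n0 : 0 < rnorm w.
  by rewrite lt_def rnorm_ge0 andbT; apply: contra w0 => /eqP/rnorm0_eq0/eqP.
have /choice[c hc] : forall t : R, exists u, 0 <= t <= 1 ->
    cdiff_at g (x + t%:C%C * h) u /\ rnorm u <= M.
  move=> t; have [ht|ht] := boolP (0 <= t <= 1); last by exists 0.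
  by have [u u1 u2] := gd t ht; exists u.
pose F (t : R) := re (w^* * g (x + t%:C%C * h)).
have Fd : rprim F (fun t => re (w^* * (c t * h))) 0 1.
  move=> t ht; have [gt _] := hc t ht.
  have p1 : cdiff_at (fun s : C => h * s + x) t%:C%C h by exact: cdiff_affine.
  have p2 : cdiff_at (g \o (fun s : C => h * s + x)) t%:C%C (c t * h).
    by apply: cdiff_comp p1 _; rewrite addrC mulrC.
  have p3 := cdiff_lin w^* p2 (cdiff_cst 0 t%:C%C).
  apply: is_derive_smallo => e e0; have [d d0 hd] := p3 e e0; exists d => // s st.
  have ns : rnorm (s%:C%C - t%:C%C : C) = `|s - t|.
    by rewrite -rmorphB/= /rnorm normc_def /= expr0n addr0 sqrtr_sqr.
  have := hd s%:C%C; rewrite ns => /(_ st); apply: le_trans.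
  apply: le_trans (re_le _); rewrite le_eqVlt; apply/orP; left; apply/eqP; congr `|_|.
  rewrite /F /= !addr0 ![h * _ + x]addrC ![h * _]mulrC 2!reB; congr (_ - _).
  rewrite [in RHS]reM -rmorphB /=; ring.
have [t ht] := rprim_MVT ler01 Fd.
have -> : F 1 - F 0 = rnorm w ^+ 2.
  rewrite /F -reB -mulrBr rmorph1 rmorph0 mul1r mul0r addr0 -/w mulrC.
  by rewrite -normCK -rnorm_sqr.
rewrite subr0 mulr1 => E.
have [_ ct] := hc t ht.
rewrite -(ler_pM2l n0) -expr2 E (le_trans (ler_norm _))// (le_trans (re_le _))// !rnormM rnorm_conj.
by rewrite ler_pM2l// ler_wpM2r ?rnorm_ge0.
Qed.

End MeanValue.

Section BoundedHolomorphic.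
Variable R : realType.
Local Notation C := R[i].
Variables (g : C -> C) (x : C) (r : R).
Hypothesis r0 : 0 < r.
Hypothesis gd : forall z, rnorm (z - x) < r -> exists u, cdiff_at g z u.
Hypothesis g1 : forall z, rnorm (z - x) < r -> rnorm (g z) <= 1.

Let g' z u : rnorm (z - x) < r / 2 -> cdiff_at g z u -> rnorm u <= 24 / r.
Proof.
move=> zr gz; have r2 : 0 < r / 2 by rewrite divr_gt0.
have inr w : rnorm (w - z) < r / 2 -> rnorm (w - x) < r.
  by move=> wz; have := rnormD (w - z) (z - x); rewrite addrA subrK; lra.
have := cauchy_estimate r2 (fun w hw => gd (inr w hw)) (fun w hw => g1 (inr w hw)) gz.
by rewrite (_ : 12 * 1 / (r / 2) = 24 / r)//; field; rewrite gt_eqF.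
Qed.

Lemma real_scale_le (t : R) (h : C) : 0 <= t <= 1 -> rnorm (t%:C%C * h) <= rnorm h.
Proof. by move=> /andP[t0 t1]; rewrite rnormM rnorm_real// ler_piMl// rnorm_ge0. Qed.

Let lip z h : rnorm (z - x) + rnorm h < r / 2 -> rnorm (g (z + h) - g z) <= 24 / r * rnorm h.
Proof.
move=> zh; apply: mean_value => t ht.
have zr : rnorm (z + t%:C%C * h - x) < r / 2.
  rewrite addrAC; apply: le_lt_trans zh; apply: (le_trans (rnormD _ _)).
  by rewrite lerD2l real_scale_le.
have [|u gu] := gd (z := z + t%:C%C * h); first by apply: (lt_trans zr); move: r0; lra.
by exists u => //; exact: g' gu.
Qed.

Lemma bounded_lipschitz h : rnorm h < r / 2 -> rnorm (g (x + h) - g x) <= 24 / r * rnorm h.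
Proof. by move=> hr; apply: lip; rewrite subrr rnorm0 add0r. Qed.

(** The mean value inequality for g(z) - c z needs g'(x + s) - c to be of order |h|. This is
    Cauchy's estimate for z |-> g(s + z) - g(z) on the disc of radius r / 4, where [lip] bounds it
    by (24 / r) |h|; and 12 * 24 * 4 = 1152. *)
Lemma bounded_expansion c h : cdiff_at g x c -> rnorm h < r / 4 ->
  rnorm (g (x + h) - g x - c * h) <= 1152 / r ^+ 2 * rnorm h ^+ 2.
Proof.
move=> gc hr.
have -> : g (x + h) - g x - c * h = (- c * (x + h) + g (x + h)) - (- c * x + g x) by ring.
rewrite expr2 mulrA; apply: (@mean_value _ (fun z => - c * z + g z)) => t ht.
set s := t%:C%C * h; have sh : rnorm s <= rnorm h by exact: real_scale_le.
have [|u gu] := gd (z := x + s).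
  by rewrite addrAC subrr add0r (le_lt_trans sh)//; move: r0 hr; lra.
exists (- c * 1 + u).
  apply: cdiff_lin gu; apply: (cdiff_ext (cdiff_affine 1 0 _)) => // w.
  by rewrite mul1r addr0.
have r4 : 0 < r / 4 by rewrite divr_gt0.
pose G z := g (s + z) - g z.
have Gc : cdiff_at G x (u - c).
  apply: (cdiff_ext (cdiff_lin (- 1) gc (cdiff_shift (k := g) (a := s) (z := x) (u := u) _))).
  - by rewrite addrC.
  - by move=> w; rewrite /G mulN1r addrC.
  - by rewrite mulN1r addrC.
have := cauchy_estimate (M := 24 / r * rnorm h) r4 _ _ Gc.
have -> : 12 * (24 / r * rnorm h) / (r / 4) = 1152 / r ^+ 2 * rnorm h by field; rewrite gt_eqF.
rewrite mulr1 addrC; apply.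
- move=> z zr.
  have [|a ga] := gd (z := z); first lra.
  have [|b gb] := gd (z := s + z).
    by rewrite -addrA; have := rnormD s (z - x); lra.
  exists (-1 * a + b); apply: (cdiff_ext (cdiff_lin (- 1) ga (cdiff_shift gb))) => // w.
  by rewrite /G mulN1r addrC.
- move=> z zr; rewrite /G [s + z]addrC; apply: (@le_trans _ _ (24 / r * rnorm s)).
    by apply: lip; lra.
  by rewrite ler_wpM2l// divr_ge0// ltW.
Qed.

End BoundedHolomorphic.

(** * A Schwarz-Pick estimate *)

Section HarnackStep.
Variable R : realType.
Local Notation C := R[i].

Lemma mobius_identity (a b : C) :
  rnorm (1 - a^* * b) ^+ 2 - rnorm (b - a) ^+ 2 = (1 - rnorm a ^+ 2) * (1 - rnorm b ^+ 2).
Proof.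
rewrite !rnorm_sqrE; case: a b => [a1 a2] [b1 b2] /=; ring.
Qed.

Lemma mobius_den (a b : C) (c : R) : rnorm a <= c -> rnorm b <= 1 ->
  1 - c <= rnorm (1 - a^* * b).
Proof.
move=> ac b1.
have h : rnorm (a^* * b) <= c.
  by rewrite rnormM rnorm_conj; apply: le_trans ac; rewrite ler_piMr ?rnorm_ge0.
have := rnormD (1 - a^* * b) (a^* * b); rewrite subrK.
have -> : rnorm (1 : C) = 1 by rewrite /rnorm normr1.
lra.
Qed.

(* A Schwarz-Pick estimate: the step length does not depend on [c]. *)
Lemma harnack_step (g : C -> C) (x h : C) (r c : R) : 0 < r ->
  (forall z, rnorm (z - x) < r -> exists u, cdiff_at g z u) ->
  (forall z, rnorm (z - x) < r -> rnorm (g z) <= 1) ->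
  c < 1 -> rnorm (g x) <= c -> rnorm h <= r / 48 ->
  rnorm (g (x + h)) <= 1 - 3 / 8 * (1 - c) ^+ 2.
Proof.
move=> r0 gd g1 c1 gx hr; set a := g x.
(* The Moebius transform of g that vanishes at x. It is bounded by 1, so by [bounded_lipschitz] it
   is at most (24 / r) (r / 48) = 1 / 2 at x + h. *)
pose m z := (g z - a) * (1 - a^* * g z)^-1.
have den z : rnorm (z - x) < r -> 1 - c <= rnorm (1 - a^* * g z).
  by move=> zr; apply: mobius_den => //; exact: g1.
have den0 z : rnorm (z - x) < r -> 1 - a^* * g z != 0.
  by move=> /den h0; apply/eqP => z0; move: h0; rewrite z0 rnorm0; lra.
have md z : rnorm (z - x) < r -> exists u, cdiff_at m z u.
  move=> zr; have [u gu] := gd z zr.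
  have p1 : cdiff_at (fun w => g w - a) z u.
    by apply: (cdiff_ext (cdiff_lin 1 gu (cdiff_cst (- a) z))) => [w|]; rewrite ?mul1r ?addr0.
  have p2 : cdiff_at (fun w => 1 - a^* * g w) z (- a^* * u).
    by apply: (cdiff_ext (cdiff_lin (- a^*) gu (cdiff_cst 1 z))) => [w|]; rewrite ?mulNr ?addr0// addrC.
  by eexists; exact: cdiff_mul p1 (cdiff_comp p2 (cdiff_inv (den0 z zr))).
have a0 : rnorm a ^+ 2 <= 1.
  by rewrite expr_le1 ?rnorm_ge0// (le_trans gx)// ltW.
have m1 z : rnorm (z - x) < r -> rnorm (m z) <= 1.
  move=> zr; rewrite /m rnormM rnormV ler_pdivrMr; last by apply: lt_le_trans (den z zr); lra.
  rewrite mul1r -(@ler_pXn2r _ 2) ?nnegrE ?rnorm_ge0// -subr_ge0 mobius_identity.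
  by rewrite mulr_ge0 ?subr_ge0// expr_le1 ?rnorm_ge0// g1.
have hx : rnorm h < r / 2 by lra.
have := bounded_lipschitz r0 md m1 hx.
have xr : rnorm (x + h - x) < r by rewrite addrAC subrr add0r; lra.
have -> : m x = 0 by rewrite /m subrr mul0r.
have d0 : 0 < rnorm (1 - a^* * g (x + h)) by apply: lt_le_trans (den _ xr); lra.
rewrite subr0 rnormM rnormV ler_pdivrMr// => mh.
have m2 : rnorm (g (x + h) - a) <= 1 / 2 * rnorm (1 - a^* * g (x + h)).
  apply: (le_trans mh); rewrite ler_pM2r// mulrAC ler_pdivrMr//; lra.
have := mobius_identity a (g (x + h)); have := den _ xr.
have := rnorm_ge0 (g (x + h)); have := rnorm_ge0 (g (x + h) - a); have := g1 _ xr.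
have := sqr_ge0 (rnorm a).
move: (rnorm (1 - a^* * g (x + h))) (rnorm (g (x + h) - a)) (rnorm (g (x + h))) (rnorm a ^+ 2) a0 d0 m2 => D N G A A1 D0 ND A0 G1 N0 G0 Dc.
have c0 : 0 <= c by exact: le_trans (rnorm_ge0 _) gx.
clear - c0 c1 D0 ND N0 G0 Dc A0 A1 G1 => E.
(* From N <= D / 2, D >= 1 - c and D^2 - N^2 = (1 - A) (1 - G^2) one gets 3/4 (1 - c)^2 <= 1 - G^2,
   whence G <= 1 - 3/8 (1 - c)^2. *)
have q1 : N ^+ 2 <= 1 / 4 * D ^+ 2 by nra.
have q2 : (1 - c) ^+ 2 <= D ^+ 2 by nra.
have q3 : 0 <= (1 - G ^+ 2) by nra.
have q4 : (1 - A) * (1 - G ^+ 2) <= 1 - G ^+ 2 by nra.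
have q5 : 3 / 4 * (1 - c) ^+ 2 <= 1 - G ^+ 2 by lra.
have q6 : (1 - c) ^+ 2 <= 1 by nra.
by move: ((1 - c) ^+ 2) (sqr_ge0 (1 - c)) q5 q6 => s s0 q5 q6; nra.
Qed.

End HarnackStep.

(** * The three domains *)

Section UniformLimits.
Variable R : realType.
Local Notation C := R[i].

Lemma differentiable_cdiff (k : C -> C) (z : C) :
  differentiable k z -> exists u, cdiff_at k z u.
Proof.
move=> /diff_locally/eqaddoP kz'; exists ('d k z 1) => e e0.
have e0' : 0 < e%:C%C by rewrite ltr0c.
have [d d0 hd] := (kz' _ e0' : nbhs (0 : C) _).
have d0' : 0 < complex.Re d by rewrite -ltr0c ReK// ltW.
exists (complex.Re d) => // w wz; have := hd (w - z); rewrite /= sub0r normrN.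
have wd : `|w - z| < d.
  by rewrite -[d]ReK ?ltW// -rnormE ltcR.
move=> /(_ wd); rewrite !fctE subrK opprD addrA.
have -> : 'd k z (w - z) = 'd k z 1 * (w - z).
  have -> : w - z = (w - z) *: (1 : C) by rewrite [RHS]mulr1.
  by rewrite linearZ [_ *: (1 : C)]mulr1 mulrC.
by rewrite -!rnormE -rmorphM/= lecR.
Qed.

Lemma cb_uniform_limit (K : topologicalType) (u : K -> C) :
  (forall e : R, 0 < e -> exists a : Cb R K, forall p, rnorm (u p - a p) <= e) ->
  exists a : Cb R K, forall p, a p = u p.
Proof.
move=> ua.
have ub : u \in @cb_pred R K.
  apply/asboolP; split.
    move=> p; apply/cvgrPdist_lt => e e0.
    have e0' : 0 < complex.Re e by rewrite -ltr0c ReK// ltW.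
    have e3 : 0 < complex.Re e / 3 by rewrite divr_gt0.
    have [a ha] := ua _ e3.
    have e3' : 0 < (complex.Re e / 3)%:C%C by rewrite ltr0c.
    have /cvgrPdist_lt/(_ _ e3') := @cb_continuous R K a p.
    apply: filterS => t; rewrite -!rnormE ltcR -[e]ReK ?ltW// ltcR => pt.
    have -> : u p - u t = (u p - a p) + (a p - a t) - (u t - a t) by ring.
    apply: (le_lt_trans (rnormD _ _)); rewrite rnormN.
    have h1 := ha p; have h2 := ha t; have h3 := rnormD (u p - a p) (a p - a t).
    apply: (@lt_le_trans _ _ (complex.Re e / 3 + complex.Re e / 3 + complex.Re e / 3)).
      by rewrite ltr_leD// (le_lt_trans h3)// ler_ltD.
    by rewrite le_eqVlt; apply/orP; left; apply/eqP; field.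
  have [a ha] := ua 1 ltr01; exists (rnorm a + 1)%:C%C => p _.
  rewrite -rnormE lecR; have -> : u p = a p + (u p - a p) by rewrite addrC subrK.
  by rewrite (le_trans (rnormD _ _))// lerD// rnorm_le cb_norm_ub.
by exists (mkCb ub).
Qed.

Lemma scale_op (V : normedModType R[i]) (a : V) :
  exists L : bop (R[i] : normedModType R[i]) V, forall v : R[i], L v = v *: a.
Proof.
have Lb : (fun v : R[i] => v *: a) \in @bop_pred R R[i] V.
  apply: (@mkbop_subproof _ _ _ _ `|a|) => [c u v|u]; last by rewrite normrZ mulrC.
  by rewrite scalerDl -scalerA.
by exists (Bop Lb).
Qed.

Lemma cb_rnorm_le (K : topologicalType) (a : Cb R K) (M : R) : 0 <= M ->
  (forall p, rnorm (a p) <= M) -> rnorm a <= M.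
Proof.
move=> M0 aM; rewrite -lecR rnormE; apply: cb_norm_le; first by rewrite ler0c.
by move=> p; rewrite -rnormE lecR.
Qed.

(* The principal square root contracts the distance to 1 of unimodular numbers. *)
Lemma unimodular_root (v : C) n : rnorm v = 1 ->
  exists u : C, [/\ rnorm u = 1, u ^+ (2 ^ n) = v & rnorm (u - 1) ^+ 2 <= 4 * (1 / 2) ^+ n].
Proof.
elim: n v => [|n IH] v v1.
  exists v; split=> //; rewrite expr0 mulr1.
  have := rnormD v (- 1); rewrite rnormN v1.
  have -> : rnorm (1 : C) = 1 by rewrite /rnorm normr1.
  by move=> h; have := rnorm_ge0 (v - 1); nra.
have [u [u1 uv un]] := IH v v1.
have [w [wu w0]] : exists w : C, w ^+ 2 = u /\ 0 <= complex.Re w.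
  have [h|h] := leP 0 (complex.Re (sqrtC u)).
    by exists (sqrtC u); rewrite sqrtCK.
  exists (- sqrtC u); rewrite sqrrN sqrtCK; split=> //.
  by case: (sqrtC u) h => a b /= h; rewrite oppr_ge0 ltW.
have ww : rnorm w ^+ 2 = 1 by rewrite expr2 -rnormM -expr2 wu.
have w1 : rnorm w = 1.
  by apply/eqP; rewrite -(@eqrXn2 _ 2) ?rnorm_ge0// ww expr1n.
exists w; split=> //; first by rewrite expnS exprM wu.
(* As Re w >= 0, the factor |w + 1|^2 is at least 2, so each root halves the squared distance to
   1. *)
have e1 : rnorm (u - 1) ^+ 2 = rnorm (w - 1) ^+ 2 * rnorm (w + 1) ^+ 2.
  by rewrite -exprMn -rnormM; congr (rnorm _ ^+ 2); rewrite -wu; ring.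
have e2 : 2 <= rnorm (w + 1) ^+ 2.
  move: ww w0; rewrite !rnorm_sqrE reD imD [complex.Re 1]/= [complex.Im 1]/= addr0.
  by move: (complex.Re w) (complex.Im w) => a b; nra.
rewrite (exprS (1 / 2)); move: un; rewrite e1; move: ((1 / 2) ^+ n) => p.
have h : rnorm (w - 1) ^+ 2 * 2 <= rnorm (w - 1) ^+ 2 * rnorm (w + 1) ^+ 2.
  by rewrite ler_wpM2l ?sqr_ge0.
move=> h2; have := le_trans h h2; move: (rnorm (w - 1) ^+ 2) => a.
by lra.
Qed.

End UniformLimits.

(** * The annulus: bounds uniform over the test functions *)

Section Annulus.
Variables (R : realType) (q : R).
Hypothesis q0 : 0 < q.
Hypothesis q1 : q < 1.
Local Notation C := R[i].
Local Notation D := (annulus q).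

Lemma annulusP (z : C) : annulus_set q z <-> q < rnorm z < 1.
Proof. by rewrite /annulus_set /= -rnormE !ltcR. Qed.

Lemma annulus_ball (x : C) (r : R) : q + r <= rnorm x <= 1 - r ->
  forall v, rnorm (v - x) < r -> annulus_set q v.
Proof.
move=> /andP[h1 h2] v vx; apply/annulusP.
have := rnormD (v - x) x; rewrite subrK; have := rnormD (x - v) v; rewrite subrK rdistC.
by move=> ? ?; apply/andP; split; lra.
Qed.

Lemma annulus_open (x : C) : annulus_set q x ->
  exists r : R, 0 < r /\ q + r <= rnorm x <= 1 - r.
Proof.
move=> /annulusP/andP[h1 h2]; pose r := Num.min (rnorm x - q) (1 - rnorm x).
exists r; split; first by rewrite lt_min !subr_gt0 h1.
have : r <= rnorm x - q by rewrite ge_min lexx.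
have : r <= 1 - rnorm x by rewrite ge_min lexx orbT.
by move: r => r ? ?; apply/andP; split; lra.
Qed.

Let extends (psi : td_fun D) (phi : C -> C) :=
  [/\ forall z, annulus_set q z -> exists u, cdiff_at phi z u,
      forall z, annulus_set q z -> rnorm (phi z) <= 1,
      forall x : td_point D, td_eval x psi = phi (set_val x) &
      phi (Num.sqrt q)%:C%C = 0].

Lemma annulus_test_ext : exists phi : td_fun D -> C -> C, forall psi, extends psi (phi psi).
Proof.
suff /choice[phi h] : forall psi, exists phi, extends psi phi by exists phi.
move=> psi; have [phi [[W [Wo cW dW]] _ _ z0 _] E] := set_valP psi.
exists phi; split=> // [z zq|z zq].
  by apply/differentiable_cdiff/dW/cW; exact: subset_closure.
have := E (SigSub (mem_set zq) : td_point D).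
set w := set_val (set_val psi _) => Ez.
have -> : phi z = w by rewrite Ez.
have h : `|w| <= 1 := set_valP (set_val psi (SigSub (mem_set zq))).
by rewrite -lecR rnormE.
Qed.

(** The derivative at x has to be an element of C_b(Psi). The quotients (E(x + s) - E(x)) / s are,
    and the quadratic bound, the same for every test function, makes them converge to it
    uniformly. *)
Lemma annulus_expansion : eval_expands D.
Proof.
move=> x.
have [phi phiP] := annulus_test_ext.
have [r [r0 xr]] := annulus_open (set_valP x).
have xb := annulus_ball xr.
have /choice[c hc] : forall psi, exists u, cdiff_at (phi psi) (set_val x) u.
  by move=> psi; have [h _ _ _] := phiP psi; apply: h; exact: set_valP.
have [K [K0 quad]] : exists K : R, 0 < K /\ forall psi h, rnorm h < r / 4 ->
    rnorm (phi psi (set_val x + h) - phi psi (set_val x) - c psi * h) <= K * rnorm h ^+ 2.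
  exists (1152 / r ^+ 2); split; first by apply: divr_gt0; [rewrite ltr0n|exact: exprn_gt0].
  move=> psi h; have [h1 h2 _ _] := phiP psi.
  by apply: (bounded_expansion r0 _ _ (hc psi)) => z zx; [apply: h1|apply: h2]; exact: xb.
have [a ac] : exists a : Cb R (td_fun D), forall psi, a psi = c psi.
  apply: cb_uniform_limit => e e0.
  (* [r / 8] stays within the range of [quad], and [e / K] makes the error K s of the quotient at
     most e. *)
  pose s := Num.min (r / 8) (e / K).
  have s0 : 0 < s by rewrite lt_min; apply/andP; split; apply: divr_gt0.
  have sr : s < r / 4.
    by apply: (@le_lt_trans _ _ (r / 8)); [rewrite ge_min lexx|move: r0; lra].
  have ns : rnorm (s%:C%C : C) = s by rewrite rnorm_real// ltW.
  have dy : annulus_set q (set_val x + s%:C%C).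
    by apply: xb; rewrite addrAC subrr add0r ns; move: r0 sr; lra.
  pose y : td_point D := SigSub (mem_set dy).
  exists (((s^-1)%:C%C : C) *: (td_eval y - td_eval x)) => psi.
  have [_ _ h3 _] := phiP psi.
  have := quad psi s%:C%C; rewrite ns => /(_ sr) h.
  have sC : s%:C%C != 0 :> C by rewrite (inj_eq (@complexI R) _ 0) gt_eqF.
  have -> : c psi - (((s^-1)%:C%C : C) *: (td_eval y - td_eval x) : Cb R (td_fun D)) psi =
      - ((s%:C%C)^-1 * (phi psi (set_val x + s%:C%C) - phi psi (set_val x) - c psi * s%:C%C)).
    change (c psi - (s^-1)%:C%C * (td_eval y psi - td_eval x psi) =
      - ((s%:C%C)^-1 * (phi psi (set_val x + s%:C%C) - phi psi (set_val x) - c psi * s%:C%C))).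
    rewrite !h3 fmorphV; change (set_val y) with (set_val x + s%:C%C); field.
    by rewrite sC.
  rewrite rnormN rnormM rnormV ns ler_pdivrMl//; apply: (le_trans h).
  rewrite expr2 mulrA mulrC ler_pM2l// -ler_pdivlMl// mulrC.
  by rewrite ge_min lexx orbT.
have [L LE] := scale_op (a : Cb R (td_fun D)).
exists L, K, (r / 4); split; first by rewrite divr_gt0.
move=> w wx; rewrite LE; apply: cb_rnorm_le.
  by rewrite mulr_ge0 ?sqr_ge0// ltW.
move=> psi; have [_ _ h3 _] := phiP psi.
change (rnorm (td_eval w psi - td_eval x psi - (set_val w - set_val x) * a psi) <=
  K * rnorm (set_val w - set_val x) ^+ 2).
rewrite !h3 ac mulrC; have := quad psi (set_val w - set_val x) wx.
by rewrite (addrC (set_val x)) subrK.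
Qed.

Lemma annulus_lt1 (x : td_point D) : exists c : R, 0 <= c < 1 /\ rnorm (td_eval x) <= c.
Proof.
have [phi phiP] := annulus_test_ext.
pose S z := exists2 c : R, 0 <= c < 1 & forall psi, rnorm (phi psi z) <= c.
(* [r] is a margin to the boundary along the whole chain, so [harnack_step] applies with the same
   step r / 48 at every point, whatever bound c < 1 has been reached. *)
have chain (r : R) n (p : nat -> C) : 0 < r ->
    (forall i, (i <= n)%N -> q + r <= rnorm (p i) <= 1 - r) ->
    (forall i, (i < n)%N -> rnorm (p i.+1 - p i) <= r / 48) -> S (p 0%N) -> S (p n).
  move=> r0; elim: n => // n IH pb ps S0.
  have [|||c /andP[c0 c1] hc] := IH; try by move=> *; [apply: pb|apply: ps]; rewrite ltnW.
  - by move=> i ni; apply: pb; rewrite ltnW.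
  - by move=> i ni; apply: ps; rewrite ltnW.
  - by [].
  exists (1 - 3 / 8 * (1 - c) ^+ 2); first by apply/andP; split; nra.
  move=> psi; have [h1 h2 _ _] := phiP psi; have xb := annulus_ball (pb n (leqnSn n)).
  rewrite -[p n.+1](subrK (p n)) addrC.
  apply: (harnack_step r0 _ _ c1 (hc psi) (ps n (ltnSn n))) => z /xb; [exact: h1|exact: h2].
suff [c c01 hc] : S (set_val x).
  exists c; split=> //; apply: cb_rnorm_le => [|psi]; first by case/andP: c01.
  by have [_ _ -> _] := phiP psi.
have /annulusP/andP[xq x1] := set_valP x; set z := set_val x in xq x1 *.
pose t := Num.sqrt q; pose s := rnorm z.
have tq : t ^+ 2 = q by rewrite sqr_sqrtr// ltW.
have t0 : 0 <= t by exact: sqrtr_ge0.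
have t1 : t < 1 by move: q1; rewrite -tq; nra.
have qt : q < t by move: q0; rewrite -tq; nra.
pose r := Num.min (Num.min (s - q) (1 - s)) (Num.min (t - q) (1 - t)).
have r0 : 0 < r by rewrite !lt_min !subr_gt0 xq x1 qt t1.
have rs : q + r <= s <= 1 - r.
  have : r <= s - q by rewrite !ge_min lexx.
  have : r <= 1 - s by rewrite !ge_min lexx orbT.
  by move=> ? ?; apply/andP; split; lra.
have rt : q + r <= t <= 1 - r.
  have : r <= t - q by rewrite !ge_min lexx !orbT.
  have : r <= 1 - t by rewrite !ge_min lexx !orbT.
  by move=> ? ?; apply/andP; split; lra.
have r48 : 0 < r / 48 by rewrite divr_gt0.
have St : S t%:C%C.
  exists 0; first by rewrite lexx ltr01.
  by move=> psi; have [_ _ _ ->] := phiP psi; rewrite rnorm0.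
(* First leg: the segment from sqrt q to |z|, on which convexity keeps the margin r. *)
have Ss : S s%:C%C.
  pose N := Num.bound (`|s - t| / (r / 48)).
  have Nb : `|s - t| / (r / 48) < N%:R by apply: archi_boundP; rewrite divr_ge0// ltW.
  have N0 : 0 < N%:R :> R by apply: le_lt_trans Nb; rewrite divr_ge0// ltW.
  pose p (i : nat) : C := (t + i%:R / N%:R * (s - t))%:C%C.
  have -> : s%:C%C = p N by rewrite /p divff ?gt_eqF// mul1r addrC subrK.
  apply: (chain r) => //.
  - move=> i iN; have i1 : i%:R / N%:R <= 1 :> R by rewrite ler_pdivrMr// mul1r ler_nat.
    have i0 : 0 <= i%:R / N%:R :> R by rewrite divr_ge0// ltW.
    move: rs rt r0; rewrite /p; move: (i%:R / N%:R) i0 i1 => a a0 a1.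
    move=> /andP[s1 s2] /andP[t2 t3] r0.
    have ? : q + r <= t + a * (s - t) by nra.
    have ? : t + a * (s - t) <= 1 - r by nra.
    rewrite rnorm_real; first by apply/andP.
    by move: q0; lra.
  - move=> i iN; rewrite /p -rmorphB /= opprD addrACA subrr add0r -mulrBl -mulrBl.
    rewrite -natrB// subSnn /rnorm normc_def /= expr0n addr0 sqrtr_sqr !normrM.
    rewrite normfV !normr_nat mul1r ler_pdivrMl//.
    by rewrite -ler_pdivrMr// ltW.
  - by rewrite /p mul0r mul0r addr0.
have s0 : 0 < s by move: q0 xq; rewrite -/s; lra.
have nv : rnorm (z / s%:C%C) = 1.
  by rewrite rnormM rnormV rnorm_real ?ltW// divff// gt_eqF.
(* Second leg: along the circle of radius s, multiplying by a 2^n-th root u of z / s, with n large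
   enough for |u - 1| <= r / 48. *)
have [||n hn] := @expr_small R (1 / 2) ((r / 48) ^+ 2 / 4).
- by apply/andP; split; lra.
- by rewrite divr_gt0// exprn_gt0.
have [u [u1 un us]] := unimodular_root n nv.
have ur : rnorm (u - 1) <= r / 48.
  rewrite -(@ler_pXn2r _ 2) ?nnegrE ?rnorm_ge0 ?(ltW r48)//; apply: (le_trans us).
  by rewrite mulrC -ler_pdivlMr// ltW// hn.
have nu i : rnorm (s%:C%C * u ^+ i) = s.
  rewrite rnormM rnorm_real ?ltW//; elim: i => [|i IH].
    by rewrite expr0 /rnorm normr1 mulr1.
  by rewrite exprS rnormM u1 mul1r.
have -> : z = s%:C%C * u ^+ (2 ^ n).
  by rewrite un mulrC divfK// (inj_eq (@complexI R) _ 0) gt_eqF.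
apply: (chain r _ (fun i => s%:C%C * u ^+ i)) => // [i _|i _|].
- by rewrite nu.
- rewrite exprSr mulrA -[X in _ - X]mulr1 -mulrBr rnormM nu.
  by apply: le_trans ur; rewrite ler_piMl ?rnorm_ge0// ltW.
- by rewrite expr0 mulr1.
Qed.

End Annulus.

(** * The bidisc *)

Section Pairs.
Variable R : realType.
Local Notation C := R[i].
Local Notation C2 := ((R[i] * R[i])%type : normedModType R[i]).

Lemma pair_norm1 (v : C2) : rnorm v.1 <= rnorm v.
Proof. by rewrite rnorm_le; case: v => a b; rewrite prod_normE comparable_le_max ?real_comparable ?normr_real// lexx. Qed.

Lemma pair_norm2 (v : C2) : rnorm v.2 <= rnorm v.
Proof. by rewrite rnorm_le; case: v => a b; rewrite prod_normE comparable_le_max ?real_comparable ?normr_real// lexx orbT. Qed.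

Lemma pair_op (V : normedModType R[i]) (a b : V) :
  exists L : bop C2 V, forall v : C2, L v = v.1 *: a + v.2 *: b.
Proof.
have Lb : (fun v : C2 => v.1 *: a + v.2 *: b) \in @bop_pred R C2 V.
  apply: (@mkbop_subproof _ _ _ _ (`|a| + `|b|)) => [c u v|u].
    by rewrite !scalerDl scalerDr !scalerA addrACA.
  rewrite (le_trans (ler_normD _ _))// !normrZ mulrDl.
  apply: lerD; rewrite mulrC ler_wpM2l// -rnorm_le; [exact: pair_norm1|exact: pair_norm2].
by exists (Bop Lb).
Qed.

Lemma bidiscP (v : C2) : bidisc_set v <-> rnorm v.1 < 1 /\ rnorm v.2 < 1.
Proof. by rewrite /bidisc_set /= -!rnormE !ltcR. Qed.

Local Notation D := (bidisc R).

Lemma bidisc_open (x : C2) : @td_dom R D x ->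
  exists d : R, 0 < d /\ forall v, rnorm (v - x) < d -> @td_dom R D v.
Proof.
move=> /bidiscP[h1 h2]; exists (Num.min (1 - rnorm x.1) (1 - rnorm x.2)).
split; first by rewrite lt_min !subr_gt0 h1.
move=> v; rewrite lt_min => /andP[v1 v2]; apply/bidiscP.
have := pair_norm1 (v - x); have := pair_norm2 (v - x).
have := rnormD (v - x).1 x.1; have := rnormD (v - x).2 x.2.
rewrite -[(v - x).1]/(v.1 - x.1) -[(v - x).2]/(v.2 - x.2) !subrK.
by move=> ? ? ? ?; split; lra.
Qed.

Lemma bidisc_evalP (psi : td_fun D) :
  (forall x : td_point D, td_eval x psi = (set_val x).1) \/
  (forall x : td_point D, td_eval x psi = (set_val x).2).
Proof. by case: (set_valP psi) => h; [left|right] => x; rewrite -h. Qed.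

Lemma bidisc_lt1 (x : td_point D) : exists c : R, 0 <= c < 1 /\ rnorm (td_eval x) <= c.
Proof.
have /bidiscP[h1 h2] := set_valP x.
exists (Num.max (rnorm (set_val x).1) (rnorm (set_val x).2)).
rewrite le_max rnorm_ge0 gt_max h1 h2; split=> //; apply: cb_rnorm_le.
  by rewrite le_max rnorm_ge0.
by move=> psi; case: (bidisc_evalP psi) => ->; rewrite le_max lexx ?orbT.
Qed.

(** E is the restriction of a linear map. Its coefficients lie in C_b(Psi) because they are
    evaluations: 2 E(1/2, 0) is 1 at z_1 and 0 at z_2, and 2 E(0, 1/2) the reverse. *)
Lemma bidisc_expansion : eval_expands D.
Proof.
move=> x.
pose half : C := (1 / 2)%:C%C.
have nh : rnorm half < 1 by rewrite rnorm_real; lra.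
have n0 : rnorm (0 : C) < 1 by rewrite rnorm0.
have d1 : @td_dom R D (half, 0) by apply/bidiscP.
have d2 : @td_dom R D (0, half) by apply/bidiscP.
pose y1 : td_point D := SigSub (mem_set d1).
pose y2 : td_point D := SigSub (mem_set d2).
have [L LE] := pair_op ((2 : C) *: td_eval y1) ((2 : C) *: td_eval y2).
have hh : 2 * half = 1.
  by apply: complexP; rewrite ?reM ?imM /=; field.
exists L, 0, 1; split=> // w _; rewrite mul0r LE; apply: cb_rnorm_le => // psi.
set s := set_val w - set_val x.
change (rnorm (td_eval w psi - td_eval x psi -
  (s.1 * (2 * td_eval y1 psi) + s.2 * (2 * td_eval y2 psi))) <= 0).
have -> : s.1 = (set_val w).1 - (set_val x).1 by [].
have -> : s.2 = (set_val w).2 - (set_val x).2 by [].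
case: (bidisc_evalP psi) => E; rewrite !E.
  change (set_val y1).1 with half; change (set_val y2).1 with (0 : C).
  by rewrite hh mulr1 !mulr0 addr0 subrr rnorm0.
change (set_val y1).2 with (0 : C); change (set_val y2).2 with half.
by rewrite hh mulr1 !mulr0 add0r subrr rnorm0.
Qed.

End Pairs.

(** * The symmetrized bidisc *)

Section SymmetrizedBidisc.
Variable R : realType.
Local Notation C := R[i].
Local Notation C2 := ((R[i] * R[i])%type : normedModType R[i]).
Local Notation D := (symbidisc R).

Lemma rnorm_lerB (a b : C) : rnorm a - rnorm b <= rnorm (a - b).
Proof. by have := rnormD (a - b) b; rewrite subrK; lra. Qed.

Lemma rnorm_nat (n : nat) : rnorm (n%:R : C) = n%:R.
Proof. by rewrite -[n%:R in LHS](rmorph_nat (@real_complex R)) rnorm_real. Qed.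

(** For s = a + b and p = a b one has s - p conj(s) = a (1 - |b|^2) + b (1 - |a|^2), and 1 - |p|^2
    exceeds |a| (1 - |b|^2) + |b| (1 - |a|^2) by (1 - |a| |b|) (1 - |a|) (1 - |b|). *)
Lemma symbidisc_sym_le (a b : C) : rnorm a <= 1 -> rnorm b <= 1 ->
  rnorm (a + b - a * b * (a + b)^*) <= 1 - rnorm (a * b) ^+ 2.
Proof.
move=> a1 b1.
have -> : a + b - a * b * (a + b)^* =
    a * (1 - rnorm b ^+ 2)%:C%C + b * (1 - rnorm a ^+ 2)%:C%C.
  by rewrite !rnorm_sqrE; case: a b {a1 b1} => [x y] [z t]; apply: complexP => /=; ring.
have a2 : 0 <= 1 - rnorm a ^+ 2 by rewrite subr_ge0 expr_le1 ?rnorm_ge0.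
have b2 : 0 <= 1 - rnorm b ^+ 2 by rewrite subr_ge0 expr_le1 ?rnorm_ge0.
apply: (le_trans (rnormD _ _)); rewrite !rnormM (rnorm_real a2) (rnorm_real b2).
have := rnorm_ge0 a; have := rnorm_ge0 b; move: a1 b1.
move: (rnorm a) (rnorm b) => x y x1 y1 y0 x0.
have h : 0 <= (1 - x * y) * ((1 - x) * (1 - y)).
  by rewrite !mulr_ge0 ?subr_ge0// mulr_ile1.
by rewrite exprMn; move: h; nra.
Qed.

(** With s = a + b and p = a b, [symbidisc_sym_le] bounds the real part of t (s - p conj(s)) by |t|
    (1 - |p|^2). The difference of the squares is then at least (1 - |t|) (4 - |s|^2 (1 + |t|) + 4
    |t| |p|^2), whose last factor is nonnegative since |s|^2 <= 2 |a|^2 + 2 |b|^2 and |a|, |b| <=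
    1. *)
Lemma symbidisc_test_le1 (t a b : C) : rnorm t <= 1 -> rnorm a <= 1 -> rnorm b <= 1 ->
  rnorm (2 * t * (a * b) - (a + b)) <= rnorm (2 - t * (a + b)).
Proof.
move=> t1 a1 b1; have sl := symbidisc_sym_le a1 b1.
have s2 : rnorm (a + b) ^+ 2 <= 2 * rnorm a ^+ 2 + 2 * rnorm b ^+ 2.
  have := rnormD a b; rewrite -(@ler_pXn2r _ 2) ?nnegrE ?addr_ge0 ?rnorm_ge0// => h.
  by have := sqr_ge0 (rnorm a - rnorm b); move: (rnorm a) (rnorm b) h => v w h; lra.
have p2 : rnorm (a * b) ^+ 2 = rnorm a ^+ 2 * rnorm b ^+ 2 by rewrite rnormM exprMn.
have rt := re_le (t * (a + b - a * b * (a + b)^*)); rewrite rnormM in rt.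
have E : rnorm (2 - t * (a + b)) ^+ 2 - rnorm (2 * t * (a * b) - (a + b)) ^+ 2 =
   4 - rnorm (a + b) ^+ 2 + rnorm t ^+ 2 * (rnorm (a + b) ^+ 2 - 4 * rnorm (a * b) ^+ 2)
   - 4 * complex.Re (t * (a + b - a * b * (a + b)^*)).
  have -> : 2 = Complex 2 0 :> C by apply: complexP => /=; lra.
  rewrite !rnorm_sqrE; move: (a + b) (a * b) => s p.
  by rewrite !(reB, imB, reM, imM); case: t {t1 rt} s p => [? ?] [? ?] [? ?] /=; ring.
rewrite -(@ler_pXn2r _ 2) ?nnegrE ?rnorm_ge0// -subr_ge0 E.
have A1 : rnorm a ^+ 2 <= 1 by rewrite expr_le1 ?rnorm_ge0.
have B1 : rnorm b ^+ 2 <= 1 by rewrite expr_le1 ?rnorm_ge0.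
move: rt; set c := complex.Re _; move: sl s2; rewrite p2.
move: (sqr_ge0 (rnorm a)) (sqr_ge0 (rnorm b)) A1 B1 => A0 B0 A1 B1.
have := rnorm_ge0 t; have := rnorm_ge0 (a + b - a * b * (a + b)^*).
move: (rnorm (a + b - _)) (rnorm t) t1 => w r t1 w0 r0 sl s2 /(le_trans (ler_norm _)).
move: c (rnorm (a + b) ^+ 2) (rnorm a ^+ 2) (rnorm b ^+ 2) A0 B0 A1 B1 s2 sl => c S A B A0 B0 A1 B1 s2 sl cr.
have cr' : c <= r * (1 - A * B).
  by apply: le_trans cr _; rewrite ler_wpM2l.
have q1 : 0 <= (1 - A) * (1 - B) by rewrite mulr_ge0 ?subr_ge0.
have q2 : 0 <= 4 - S * (1 + r) + 4 * r * (A * B).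
  have : S * (1 + r) <= (2 * A + 2 * B) * (1 + r) by rewrite ler_wpM2r//; lra.
  by have := mulr_ge0 r0 q1; nra.
have : 0 <= (1 - r) * (4 - S * (1 + r) + 4 * r * (A * B)).
  by rewrite mulr_ge0// subr_ge0.
by move: cr'; lra.
Qed.

Lemma symbidiscP (x : C2) : @td_dom R D x -> exists (a b : C) (r : R),
  [/\ 0 < r < 1, rnorm a <= r, rnorm b <= r, x.1 = a + b & x.2 = a * b].
Proof.
case=> -[a b] /bidiscP[/= a1 b1] <-.
(* Halfway to 1, so that r is positive even for a = b = 0 and [symbidisc_lt1] may divide by it. *)
exists a, b, ((1 + Num.max (rnorm a) (rnorm b)) / 2).
have m0 : rnorm a <= Num.max (rnorm a) (rnorm b) by rewrite le_max lexx.
have m1 : rnorm b <= Num.max (rnorm a) (rnorm b) by rewrite le_max lexx orbT.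
have m2 : Num.max (rnorm a) (rnorm b) < 1 by rewrite gt_max a1 b1.
have m3 := rnorm_ge0 a; move: (Num.max _ _) m0 m1 m2 => m m0 m1 m2.
by split=> //; first (by apply/andP; split; lra); lra.
Qed.

Lemma symbidisc_dom (a b : C) : rnorm a < 1 -> rnorm b < 1 -> @td_dom R D (a + b, a * b).
Proof. by move=> a1 b1; exists (a, b) => //; apply/bidiscP. Qed.

(** A nearby v is the symmetrization of the roots of X^2 - v.1 X + v.2. A root t with |t| >= 1 would
    give (1 - r)^2 |t|^2 <= |t - a| |t - b| <= |v.1 - x.1| |t| + |v.2 - x.2| < (1 - r)^2 (|t| + 1) /
    2, which is impossible. *)
Lemma symbidisc_open (x : C2) : @td_dom R D x ->
  exists d : R, 0 < d /\ forall v, rnorm (v - x) < d -> @td_dom R D v.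
Proof.
move=> /symbidiscP[a [b [r [/andP[r0 r1] ar br xs xp]]]].
exists ((1 - r) ^+ 2 / 2); split; first by rewrite divr_gt0// exprn_gt0// subr_gt0.
move=> v vx.
have v1 : rnorm (v.1 - (a + b)) < (1 - r) ^+ 2 / 2.
  by rewrite -xs; apply: le_lt_trans vx; exact: (pair_norm1 (v - x)).
have v2 : rnorm (v.2 - a * b) < (1 - r) ^+ 2 / 2.
  by rewrite -xp; apply: le_lt_trans vx; exact: (pair_norm2 (v - x)).
have root1 t : t * (v.1 - t) = v.2 -> rnorm t < 1.
  move=> tv; rewrite ltNge; apply/negP => t1.
  have E : (t - a) * (t - b) = (v.1 - (a + b)) * t - (v.2 - a * b) by rewrite -tv; ring.
  have ta : (1 - r) * rnorm t <= rnorm (t - a) by have := rnorm_lerB t a; nra.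
  have tb : (1 - r) * rnorm t <= rnorm (t - b) by have := rnorm_lerB t b; nra.
  have := rnormD ((v.1 - (a + b)) * t) (- (v.2 - a * b)); rewrite -E rnormN !rnormM.
  have r10 : 0 <= (1 - r) * rnorm t by rewrite mulr_ge0 ?rnorm_ge0// subr_ge0 ltW.
  have h1 := ler_pM r10 r10 ta tb.
  have h2 : rnorm (v.1 - (a + b)) * rnorm t < (1 - r) ^+ 2 / 2 * rnorm t.
    by rewrite ltr_pM2r//; lra.
  have h3 : 0 <= (1 - r) ^+ 2 * rnorm t * (rnorm t - 1).
    by apply: mulr_ge0; [apply: mulr_ge0; [exact: sqr_ge0|exact: rnorm_ge0]|rewrite subr_ge0].
  have h4 : 0 <= (1 - r) ^+ 2 * (rnorm t - 1).
    by apply: mulr_ge0; [exact: sqr_ge0|rewrite subr_ge0].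
  move: (rnorm (t - a) * rnorm (t - b)) (rnorm (v.1 - (a + b)) * rnorm t) h1 h2 v2 => P Q h1 h2 v2.
  by move: (rnorm (v.2 - a * b)) v2 => V v2 PQ; nra.
pose t := (v.1 + sqrtC (v.1 ^+ 2 - 4 * v.2)) / 2.
have tv : t * (v.1 - t) = v.2.
  have -> : t * (v.1 - t) = (v.1 ^+ 2 - sqrtC (v.1 ^+ 2 - 4 * v.2) ^+ 2) / 4 by rewrite /t; field.
  by rewrite sqrtCK; field.
have -> : v = (t + (v.1 - t), t * (v.1 - t)) by rewrite tv addrC subrK; case: (v).
apply: symbidisc_dom; apply: root1 => //; rewrite subKr mulrC //.
Qed.

Lemma symbidisc_evalP (psi : td_fun D) : exists t : C, rnorm t <= 1 /\
  forall x : td_point D, td_eval x psi = symbidisc_test t (set_val x).1 (set_val x).2.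
Proof.
have [t t1 h] := set_valP psi; exists t; split=> [|x]; first by rewrite -lecR rnormE.
by rewrite -h.
Qed.

Lemma symbidisc_den (t s : C) : rnorm t <= 1 -> 2 - rnorm s <= rnorm (2 - t * s).
Proof.
move=> t1; have := rnorm_lerB 2 (t * s); rewrite rnorm_nat rnormM.
have : rnorm t * rnorm s <= rnorm s by rewrite ler_piMl ?rnorm_ge0.
by lra.
Qed.

(* Rescaling: the value at [(r s, r^2 p)] for the parameter [t] is [r] times the
   value at [(s, p)] for the parameter [t r]. *)
Lemma symbidisc_lt1 (x : td_point D) : exists c : R, 0 <= c < 1 /\ rnorm (td_eval x) <= c.
Proof.
have [a [b [r [/andP[r0 r1] ar br xs xp]]]] := symbidiscP (set_valP x).
exists r; split; first by rewrite ltW.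
apply: cb_rnorm_le => [|psi]; first exact: ltW.
have [t [t1 ->]] := symbidisc_evalP psi; rewrite xs xp /symbidisc_test.
have rC : r%:C%C != 0 :> C by rewrite (inj_eq (@complexI R) _ 0) gt_eqF.
have nr : rnorm (r%:C%C : C) = r by rewrite rnorm_real// ltW.
have sc (u : C) : rnorm u <= r -> rnorm (u / r%:C%C) <= 1.
  by move=> ur; rewrite rnormM rnormV nr ler_pdivrMr// mul1r.
have d0 : 0 < rnorm (2 - t * (a + b)).
  apply: lt_le_trans (symbidisc_den _ t1); have := rnormD a b; move: r1 ar br; lra.
have tr : rnorm (t * r%:C%C) <= 1.
  by rewrite rnormM nr (le_trans _ (ltW r1))// ler_piMl// ltW.
have := symbidisc_test_le1 tr (sc a ar) (sc b br).
rewrite rnormM rnormV ler_pdivrMr//.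
have -> : 2 - t * r%:C%C * (a / r%:C%C + b / r%:C%C) = 2 - t * (a + b) by field.
have -> : 2 * t * (a * b) - (a + b) = r%:C%C *
   (2 * (t * r%:C%C) * (a / r%:C%C * (b / r%:C%C)) - (a / r%:C%C + b / r%:C%C)) by field.
by rewrite [rnorm (r%:C%C * _)]rnormM nr ler_pM2l.
Qed.

Lemma cb_inv (K : topologicalType) (d : Cb R K) (m : R) : 0 < m ->
  (forall p, m <= rnorm (d p)) -> exists b : Cb R K, forall p, b p = (d p)^-1.
Proof.
move=> m0 dm.
have ub : (fun p => (d p)^-1) \in @cb_pred R K.
  apply/asboolP; split.
    move=> p; apply: cvgV; last exact: (@cb_continuous R K d p).
    by apply/eqP => d0; have := dm p; rewrite d0 rnorm0; lra.
  exists (m^-1)%:C%C => p _; rewrite -rnormE lecR rnormV lef_pV2 ?posrE//.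
  exact: lt_le_trans (dm p).
by exists (mkCb ub).
Qed.

Lemma symbidisc_expansion : eval_expands D.
Proof.
move=> x.
pose half : C := (1 / 2)%:C%C.
have nh : rnorm half < 1 by rewrite rnorm_real; lra.
have nh' : rnorm (- half) < 1 by rewrite rnormN.
pose y : td_point D := SigSub (mem_set (symbidisc_dom nh nh')).
(* The parameter of the test function: at [(0, -1/4)] it takes the value [- t / 4]. *)
pose al : Cb R (td_fun D) := (- 4 : C) *: td_eval y.
have alE psi t : (forall x : td_point D, td_eval x psi = symbidisc_test t (set_val x).1 (set_val x).2) ->
    al psi = t.
  move=> tE; change (- 4 * td_eval y psi = t); rewrite tE /symbidisc_test.
  change (set_val y).1 with (half + - half); change (set_val y).2 with (half * - half).
  have -> : half = 1 / 2 by rewrite /half rmorphM /= rmorph1 fmorphV rmorph_nat.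
  by rewrite subrr; field.
set s := (set_val x).1; set p := (set_val x).2; pose m := 2 - rnorm s.
have [s2 p1] : rnorm s < 2 /\ rnorm p <= 1.
  have [a [b [r [/andP[r0 r1] ar br xs xp]]]] := symbidiscP (set_valP x).
  rewrite /s /p xs xp rnormM; split; first by have := rnormD a b; lra.
  by rewrite mulr_ile1 ?rnorm_ge0//; lra.
have m0 : 0 < m by rewrite subr_gt0.
pose den : Cb R (td_fun D) := 2 - s *: al.
have denE psi : den psi = 2 - al psi * s.
  by rewrite [al psi * s]mulrC.
have [b bE] : exists b : Cb R (td_fun D), forall psi, b psi = (den psi)^-1.
  apply: (cb_inv m0) => psi; rewrite denE; have [t [t1 tE]] := symbidisc_evalP psi.
  by rewrite (alE psi t tE); exact: symbidisc_den.
(* The partial derivatives of phi = (2 t p - s) / (2 - t s) in p and in s are 2 t / (2 - t s) and (t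
   phi - 1) / (2 - t s). Written with [al] in place of t, they are elements of C_b(Psi). *)
pose A2 : Cb R (td_fun D) := (2 : C) *: (al * b).
pose A1 : Cb R (td_fun D) := (td_eval x * al - 1) * b.
have [L LE] := pair_op A1 A2.
exists L, (32 / m ^+ 3), (m / 2); split; first by rewrite divr_gt0.
move=> w wx; rewrite LE; apply: cb_rnorm_le.
  by rewrite mulr_ge0 ?sqr_ge0// divr_ge0// exprn_ge0// ltW.
move=> psi; have [t [t1 tE]] := symbidisc_evalP psi; have at_ := alE psi t tE.
set v := set_val w - set_val x.
have nh1 := pair_norm1 v; have nk1 := pair_norm2 v.
pose h := v.1; pose k := v.2; rewrite -/h -/k in nh1 nk1 *.
have w1 : (set_val w).1 = s + h by rewrite /s /h addrC subrK.
have w2 : (set_val w).2 = p + k by rewrite /p /k addrC subrK.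
change (rnorm (td_eval w psi - td_eval x psi -
  (h * ((td_eval x psi * al psi - 1) * b psi) + k * (2 * (al psi * b psi)))) <=
  32 / m ^+ 3 * rnorm v ^+ 2).
rewrite bE denE at_ !tE w1 w2 /symbidisc_test -/s -/p.
have dm : m <= rnorm (2 - t * s) by exact: symbidisc_den.
have dm' : m / 2 <= rnorm (2 - t * (s + h)).
  by apply: le_trans (symbidisc_den _ t1); have := rnormD s h; move: wx; rewrite -/v /m; lra.
have d0 : 2 - t * s != 0 by apply/eqP => d0; move: dm; rewrite d0 rnorm0; lra.
have d0' : 2 - t * (s + h) != 0 by apply/eqP => d0'; move: dm'; rewrite d0' rnorm0; lra.
(* The remainder is exactly l (t h) divided by (2 - t s)^2 (2 - t (s + h)). The bounds |l| <= 16 |v|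
   and |t h| <= |v|, with factors at least m, m and m / 2 in the denominator, give 32 / m^3. *)
pose l := (2 * t * k - h) * (2 - t * s) + (2 * t * p - s) * (t * h).
set lhs := (X in rnorm X).
have -> : lhs = l * (t * h) * ((2 - t * s)^-1 * (2 - t * s)^-1 * (2 - t * (s + h))^-1).
  by rewrite /lhs /l; field; rewrite d0 d0'.
have n0 := rnorm_ge0 v.
have ts : rnorm (t * s) <= 2.
  by rewrite rnormM (le_trans _ (ltW s2))// ler_piMl ?rnorm_ge0.
have q1 : rnorm (2 - t * s) <= 4.
  by have := rnormD (2 : C) (- (t * s)); rewrite rnormN rnorm_nat; lra.
have q2 : rnorm (2 * t * k - h) <= 3 * rnorm v.
  have := rnormD (2 * t * k) (- h); rewrite rnormN !rnormM rnorm_nat -mulrA.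
  have : rnorm t * rnorm k <= rnorm v by apply: le_trans nk1; rewrite ler_piMl ?rnorm_ge0.
  by lra.
have q3 : rnorm (2 * t * p - s) <= 4.
  have := rnormD (2 * t * p) (- s); rewrite rnormN !rnormM rnorm_nat -mulrA.
  have : rnorm t * rnorm p <= 1 by rewrite mulr_ile1 ?rnorm_ge0.
  by lra.
have q4 : rnorm (t * h) <= rnorm v.
  by rewrite rnormM; apply: le_trans nh1; rewrite ler_piMl ?rnorm_ge0.
have q5 : rnorm l <= 16 * rnorm v.
  apply: (le_trans (rnormD _ _)); rewrite rnormM [rnorm (_ * (t * h))]rnormM.
  have -> : 16 * rnorm v = 3 * rnorm v * 4 + 4 * rnorm v by ring.
  by apply: lerD; rewrite ler_pM ?rnorm_ge0.
rewrite !rnormM -[rnorm t * rnorm h]rnormM !rnormV.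
have i1 : (rnorm (2 - t * s))^-1 <= m^-1 by rewrite lef_pV2 ?posrE//; lra.
have i2 : (rnorm (2 - t * (s + h)))^-1 <= (m / 2)^-1 by rewrite lef_pV2 ?posrE//; lra.
have i0 u : 0 <= (rnorm (u : C))^-1 by rewrite invr_ge0 rnorm_ge0.
have -> : 32 / m ^+ 3 * rnorm v ^+ 2 = 16 * rnorm v * rnorm v * (m^-1 * m^-1 * (m / 2)^-1).
  by field; rewrite gt_eqF.
by do ![apply: ler_pM]; rewrite ?mulr_ge0 ?rnorm_ge0.
Qed.

End SymmetrizedBidisc.

Theorem theorem7 (R : realType) (D : test_domain R) (U Y : hilbertType R)
    (hD : setting D U Y)
    (n : nat) (hn : (0 < n)%N) (z : 'I_n -> td_point D) (B : 'I_n -> bop U Y)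
    (Gamma : td_point D -> td_point D -> bop (Cb R (td_fun D)) (bop Y Y))
    (hGamma : cp_kernel (range z) Gamma)
    (hGammaB : forall i j, id_op Y - B i \oc adj (B j) =
       Gamma (z i) (z j) (1 - td_eval (z i) * cb_conj (td_eval (z j))))
    (f : td_space D -> bop U Y) (hf : schur_class f)
    (hfB : forall i, f (set_val (z i)) = B i)
    (haff : affiliated z f Gamma)
    (X : hilbertType R) (mu : Cb R (td_fun D) -> bop X X)
    (h : td_point D -> bop X Y)
    (hkol : kolmogorov (range z) Gamma mu h) :
  exists2 t : td_space D -> bop (csub (spaceM1 z B mu h)) (csub (spaceM2 z mu h)),
    schur_class t &
    forall x : td_point D,
      let G := transferG z B mu h x in
      let T := id_op (csub (spaceM2 z mu h)) - t (set_val x) \oc block11 G in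
      op_invertible T /\
      f (set_val x) =
        block22 G + block21 G \oc op_inv T \oc t (set_val x) \oc block12 G.
Proof.
case: hD n hn z B Gamma hGamma hGammaB f hf hfB haff X mu h hkol => [{}U {}Y|{}U {}Y|q q0 q1]
  n hn z B Gamma hGamma hGammaB f hf hfB haff X mu h hkol.
- exact: (@theorem7_of_domain R (bidisc R) U Y (@bidisc_open R) (@bidisc_lt1 R)
    (@bidisc_expansion R) _ _ _ _ hGammaB _ hfB haff _ _ _ hkol).
- exact: (@theorem7_of_domain R (symbidisc R) U Y (@symbidisc_open R) (@symbidisc_lt1 R)
    (@symbidisc_expansion R) _ _ _ _ hGammaB _ hfB haff _ _ _ hkol).
- apply: (@theorem7_of_domain R (annulus q) R[i] R[i] _ (annulus_lt1 q0 q1)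
    (@annulus_expansion R q) _ _ _ _ hGammaB _ hfB haff _ _ _ hkol) => x /annulus_open[r [r0 xr]].
  by exists r; split=> //; exact: (annulus_ball xr).
Qed.
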